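(* Let $p \in [1,\infty]$. Let $\omega : \mathbb{R}^d \to [0,\infty)$ be a continuous function that is non-decreasing (that is, $\omega(x) \le \omega(y)$ whenever $|x| \le |y|$) and moderate, i.e., there is $C>0$ such that $\omega(x+y) \le C\,\omega(x)$ for all $x \in \mathbb{R}^d$ and all $y$ with $|y| \le 1$. Let $(\chi^0,\chi^1) \in \mathcal{D}\times\mathcal{D}$ satisfy the moment-wise decomposition factorization property (MDFP). Then for any $f \in \mathcal{D}'$: (i) $f \in \mathcal{K}^p_\omega$ if and only if there exists $r>0$ such that for all $n \in \mathbb{N}$ and $\alpha \in \mathbb{N}^d$, $$\sup_{j \in \mathbb{N},\ \ell \in \{0,1\}} 2^{-rj}\, \| \partial^\alpha[f * \chi^\ell_j]\, e^{n\omega} \|_{L^p} < \infty .$$ (ii) $f \in \mathcal{O}_C'(\mathcal{D},\mathcal{K}^p_\omega)$ if and only if for all $n \in \mathbb{N}$ there exists $r>0$ such that $$\sup_{j \in \mathbb{N},\ \ell \in \{0,1\}} 2^{-rj}\, \| [f * \chi^\ell_j]\, e^{n\omega} \|_{L^p} < \infty .$$ (iii) $f \in \mathcal{O}_M(\mathcal{K}^\infty_\omega,\mathcal{K}^p_\omega)$ if and only if there exists $r>0$ such that for all $\alpha \in \mathbb{N}^d$ there is $n \in \mathbb{N}$ with $$\sup_{j \in \mathbb{N},\ \ell \in \{0,1\}} 2^{-rj}\, \| \partial^\alpha[f * \chi^\ell_j]\, e^{-n\omega} \|_{L^p} < \infty .$$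
   Context: $\mathbb{N}=\{0,1,2,\dots\}$. $\mathcal{D}=\mathcal{D}(\mathbb{R}^d)$ is the space of compactly supported smooth functions on $\mathbb{R}^d$ and $\mathcal{D}'$ its dual (distributions). For $\phi\in\mathcal{D}$ and $j\in\mathbb{N}$, $\phi_j := 2^{jd}\phi(2^j\,\cdot\,)$; in particular $\chi^\ell_j = 2^{jd}\chi^\ell(2^j\,\cdot\,)$. Spaces: $$\mathcal{K}^p_\omega := \{ f \in C^\infty(\mathbb{R}^d) : f^{(\alpha)}e^{n\omega}\in L^p(\mathbb{R}^d) \text{ for all } n\in\mathbb{N},\ \alpha\in\mathbb{N}^d\},$$ $$\mathcal{O}_C'(\mathcal{D},\mathcal{K}^p_\omega) := \{ f\in\mathcal{D}' : f*\phi\in\mathcal{K}^p_\omega \text{ for all } \phi\in\mathcal{D}\},$$ $$\mathcal{O}_M(\mathcal{K}^\infty_\omega,\mathcal{K}^p_\omega) := \{ f\in C^\infty(\mathbb{R}^d) : f\cdot\phi\in\mathcal{K}^p_\omega \text{ for all } \phi\in\mathcal{K}^\infty_\omega\}.$$ For a compact set $K\subset\mathbb{R}^d$, $\mathcal{D}(K)$ is the space of smooth functions supported in $K$, and for $L\in\mathbb{N}$, $\mathcal{D}_L(K) := \{\varphi\in\mathcal{D}(K) : \int_{\mathbb{R}^d} x^\alpha\varphi(x)\,dx=0 \text{ for all } |\alpha|<L\}$. MDFP: a pair $(\chi^0,\chi^1)\in\mathcal{D}\times\mathcal{D}$ has the moment-wise decomposition factorization property if for some compact $K\subset\mathbb{R}^d$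 there exist non-trivial functions $(\varphi^\ell_L,\psi^\ell_L)\in\mathcal{D}(K)\times\mathcal{D}_L(K)$, $\ell\in\{0,1\}$, $L\in\mathbb{N}$, such that for every $L\in\mathbb{N}$: $2^d\varphi^0_L(2\,\cdot\,)-\varphi^0_L=\Delta\psi^0_L$; $\int_{\mathbb{R}^d}\varphi^0_L(x)\,dx=1$; $\varphi^0_L=\chi^0*\varphi^0_L+\chi^1*\varphi^1_L$ and $\psi^0_L=\chi^0*\psi^0_L+\chi^1*\psi^1_L$. Here $\Delta$ is the Laplace operator. *)

(* Defs.v *)
From HB Require Import structures.
From mathcomp Require Import all_boot all_order all_algebra.
From mathcomp Require Import all_classical all_reals all_analysis.
From mathcomp Require Import complex.

Set Implicit Arguments.
Unset Strict Implicit.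
Unset Printing Implicit Defensive.
Import Order.TTheory GRing.Theory Num.Theory.
Import numFieldNormedType.Exports.
Local Open Scope classical_set_scope.
Local Open Scope ring_scope.
Local Open Scope complex_scope.

(* R^d is ['rV[R]_d], with the sigma-algebra generated by the coordinates,
   which is that of the Borel sets. *)

Definition rV_display : measure_display -> measure_display.
Proof. exact. Qed.

Section measurable_rV.
Context {R : realType} {n : nat}.

Let coord (i : 'I_n) (v : 'rV[R]_n) : measurableTypeR R := v ord0 i.

Let rV_set0 : g_sigma_preimage coord set0.
Proof. exact: sigma_algebra0. Qed.

Let rV_setC A : g_sigma_preimage coord A -> g_sigma_preimage coord (~` A).
Proof. exact: sigma_algebraC. Qed.

Let rV_bigcup (F : (set 'rV[R]_n)^nat) : (forall i, g_sigma_preimage coord (F i)) ->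
  g_sigma_preimage coord (\bigcup_i (F i)).
Proof. exact: sigma_algebra_bigcup. Qed.

HB.instance Definition _ := @isMeasurable.Build
  (rV_display default_measure_display) 'rV[R]_n
  (g_sigma_preimage coord) rV_set0 rV_setC rV_bigcup.

Lemma measurable_coord_rV (i : 'I_n) :
  measurable_fun [set: 'rV[R]_n]
    (fun v : 'rV[R]_n => v ord0 i : measurableTypeR R).
Proof.
move=> _ Y mY; rewrite setTI; apply: sub_sigma_algebra => /=.
rewrite -bigcup_seq/=; exists i => /=; first by rewrite mem_index_enum.
by exists Y => //; rewrite setTI.
Qed.

Lemma measurable_fun_rV d (T : measurableType d) (f : T -> 'rV[R]_n) :
  (forall i,
    measurable_fun [set: T] (fun x => f x ord0 i : measurableTypeR R)) ->
  measurable_fun [set: T] f.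
Proof.
move=> mf _ Y mY; rewrite setTI.
suff: g_sigma_preimage coord `<=`
    [set B | d.-measurable (f @^-1` B)] by exact.
apply: smallest_sub.
  split => /=.
  - by rewrite preimage_set0; exact: measurable0.
  - by move=> A mA; rewrite setTD preimage_setC; exact: measurableC.
  - by move=> F mF; rewrite preimage_bigcup; exact: bigcup_measurable.
rewrite -bigcup_seq => B /= [i _ [A mA <-]].
by rewrite setTI -comp_preimage -[X in measurable X]setTI; exact: mf.
Qed.

End measurable_rV.

Section lebesgue_rV_succ.
Local Open Scope ereal_scope.
Context {R : realType} {n : nat}.

Definition rV_cons (p : measurableTypeR R * 'rV[R]_n) : 'rV[R]_n.+1 :=
  \row_(i < n.+1) if unlift ord0 i is Some j then p.2 ord0 j else p.1.

Lemma measurable_rV_cons : measurable_fun setT rV_cons.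
Proof.
apply: measurable_fun_rV => i; rewrite /rV_cons.
case: (unliftP ord0 i) => [j ->|->].
  under eq_fun do rewrite mxE liftK.
  exact: (measurableT_comp (measurable_coord_rV j)).
under eq_fun do rewrite mxE unlift_none.
exact: measurable_fst.
Qed.

Definition rV_uncons (v : 'rV[R]_n.+1) : measurableTypeR R * 'rV[R]_n :=
  (v ord0 ord0, \row_j v ord0 (lift ord0 j)).

Lemma measurable_rV_uncons : measurable_fun setT rV_uncons.
Proof.
apply/measurable_fun_pair; first exact: measurable_coord_rV.
apply: measurable_fun_rV => i.
under eq_fun do rewrite mxE.
exact: measurable_coord_rV.
Qed.

Lemma rV_consK : cancel rV_cons rV_uncons.
Proof.
case=> x v; rewrite /rV_uncons /rV_cons mxE unlift_none; congr pair.
by apply/rowP => j; rewrite !mxE liftK.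
Qed.

Variable m : {sigma_finite_measure set 'rV[R]_n -> \bar R}.

Definition lebesgue_rV_succ (A : set 'rV[R]_n.+1) : \bar R :=
  (@lebesgue_measure R \x m) (rV_cons @^-1` A).

Let succ0 : lebesgue_rV_succ set0 = 0.
Proof. by rewrite /lebesgue_rV_succ preimage_set0 measure0. Qed.

Let succ_ge0 A : 0 <= lebesgue_rV_succ A.
Proof. exact: measure_ge0. Qed.

Let succ_sigma_additive : semi_sigma_additive lebesgue_rV_succ.
Proof.
have mcons A : measurable A -> measurable (rV_cons @^-1` A).
  by move=> mA; rewrite -[X in measurable X]setTI; exact: measurable_rV_cons.
move=> F mF tF mUF; rewrite /lebesgue_rV_succ preimage_bigcup.
apply: measure_semi_sigma_additive => [k||].
- exact: mcons.
- apply/trivIsetP => i j _ _ ij; rewrite -preimage_setI.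
  by move/trivIsetP : tF => /(_ _ _ _ _ ij) ->//; rewrite preimage_set0.
- by rewrite -preimage_bigcup; exact: mcons.
Qed.

HB.instance Definition _ := isMeasure.Build _ _ _ lebesgue_rV_succ
  succ0 succ_ge0 succ_sigma_additive.

Let succ_sigma_finite : sigma_finite setT lebesgue_rV_succ.
Proof.
have /sigma_finiteP[F [TF ndF Foo]] := sigma_finiteT (@lebesgue_measure R).
have /sigma_finiteP[G [TG ndG Goo]] := sigma_finiteT m.
exists (fun k => rV_uncons @^-1` (F k `*` G k)).
  apply/esym; rewrite -subTset => v _.
  have [k _ Fk] : (\bigcup_k F k) (rV_uncons v).1 by rewrite -TF.
  have [l _ Gl] : (\bigcup_k G k) (rV_uncons v).2 by rewrite -TG.
  exists (maxn k l) => //; split.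
  - by move: Fk; exact/subsetPset/ndF/leq_maxl.
  - by move: Gl; exact/subsetPset/ndG/leq_maxr.
move=> k; have [mF Fk] := Foo k; have [mG Gk] := Goo k; split.
  rewrite -[X in measurable X]setTI; apply: measurable_rV_uncons => //.
  exact: measurableX.
rewrite /lebesgue_rV_succ -comp_preimage.
rewrite (_ : rV_uncons \o rV_cons = id) ?preimage_id; last first.
  exact/funext/rV_consK.
by rewrite product_measure1E// lte_mul_pinfty// ge0_fin_numE.
Qed.

HB.instance Definition _ := Measure_isSigmaFinite.Build _ _ _ lebesgue_rV_succ
  succ_sigma_finite.

End lebesgue_rV_succ.

(* Lebesgue measure on R^n as the n-fold product of Lebesgue measure on R; the
   unit mass when n = 0. *)
Fixpoint lebesgue_rV (R : realType) (n : nat) :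
    {sigma_finite_measure set 'rV[R]_n -> \bar R} :=
  match n return {sigma_finite_measure set 'rV[R]_n -> \bar R} with
  | 0%N => dirac (0 : 'rV[R]_0)
  | n'.+1 => lebesgue_rV_succ (lebesgue_rV R n')
  end.

(* The canonical norm of ['rV[R]_d] is the sup norm, not the Euclidean one. *)
Definition eucl_norm (R : realType) (d : nat) (x : 'rV[R]_d) : R :=
  Num.sqrt (\sum_i x ord0 i ^+ 2).

Section functions.
Context {R : realType} {d : nat}.
Local Notation re := (@complex.Re R).
Local Notation im := (@complex.Im R).
Implicit Types (f g phi : 'rV[R]_d -> R[i]) (a : 'I_d -> nat).

(* Real-valued modulus; the norm of [R[i]] takes its values in [R[i]]. *)
Definition cabs (z : R[i]) : R := Normc.normc z.

Definition cintegral f : R[i] :=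
  (\int[lebesgue_rV R d]_x re (f x)) +i* (\int[lebesgue_rV R d]_x im (f x)).

Definition LpNorm (p : \bar R) f : \bar R :=
  ('N[lebesgue_rV R d]_p[EFin \o (cabs \o f)])%E.

Definition LpSpace (p : \bar R) : set ('rV[R]_d -> R[i]) :=
  [set f | [/\ measurable_fun setT (fun x => re (f x)),
              measurable_fun setT (fun x => im (f x)) &
              (LpNorm p f < +oo)%E]].

Definition partial (i : 'I_d) f : 'rV[R]_d -> R[i] := fun x =>
  'D_(delta_mx ord0 i) (fun y => re (f y)) x +i*
  'D_(delta_mx ord0 i) (fun y => im (f y)) x.

Definition mpartial a f : 'rV[R]_d -> R[i] :=
  foldr (fun i g => iter (a i) (partial i) g) f (enum 'I_d).

Definition morder a : nat := (\sum_(i < d) a i)%N.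

Definition laplacian f : 'rV[R]_d -> R[i] :=
  fun x => \sum_(i < d) partial i (partial i f) x.

(* All iterated partial derivatives, in any order, exist and are continuous. *)
Definition smooth f : Prop :=
  forall s : seq 'I_d, let g := foldr partial f s in
    [/\ continuous (fun x => re (g x)), continuous (fun x => im (g x)) &
        forall i x, derivable (fun y => re (g y)) x (delta_mx ord0 i) /\
                    derivable (fun y => im (g y)) x (delta_mx ord0 i)].

Definition tsupport f : set 'rV[R]_d := closure [set x | f x != 0].

Definition test : set ('rV[R]_d -> R[i]) :=
  [set f | smooth f /\ compact (tsupport f)].

Definition test_on (K : set 'rV[R]_d) : set ('rV[R]_d -> R[i]) :=
  [set f | smooth f /\ tsupport f `<=` K].

Definition monomial a (x : 'rV[R]_d) : R := \prod_(i < d) x ord0 i ^+ a i.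

Definition test_on_moments (L : nat) (K : set 'rV[R]_d) :
    set ('rV[R]_d -> R[i]) :=
  [set f | test_on K f /\ forall a, (morder a < L)%N ->
    cintegral (fun x => (monomial a x)%:C * f x) = 0].

(* phi_j = 2^(jd) phi(2^j .). *)
Definition dilate (j : nat) f : 'rV[R]_d -> R[i] :=
  fun x => (2 ^ (j * d))%:R * f ((2 ^ j)%:R *: x).

Definition conv f g : 'rV[R]_d -> R[i] :=
  fun x => cintegral (fun y => f y * g (x - y)).

Definition CN_norm (N : nat) f : \bar R :=
  ereal_sup [set z | exists a x, (morder a <= N)%N /\
                                 z = (cabs (mpartial a f x))%:E].

(* A linear functional is continuous on D (for the inductive limit topology) iff
   on each D(K) it is bounded by a C^N norm. Functionals are represented as
   defined on all functions; their values outside D are irrelevant. *)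
Definition is_distribution : set (('rV[R]_d -> R[i]) -> R[i]) :=
  [set u | (forall (c : R[i]) phi psi, test phi -> test psi ->
              u (fun x => c * phi x + psi x) = c * u phi + u psi) /\
           (forall K : set 'rV[R]_d, compact K ->
              exists (c : R) (N : nat), forall phi, test_on K phi ->
                ((cabs (u phi))%:E <= c%:E * CN_norm N phi)%E)].

Definition distr_of f : ('rV[R]_d -> R[i]) -> R[i] :=
  fun phi => cintegral (fun x => f x * phi x).

(* The distribution [u] is (integration against) a function in [X]. *)
Definition is_function_in (X : set ('rV[R]_d -> R[i]))
    (u : ('rV[R]_d -> R[i]) -> R[i]) : Prop :=
  exists2 f, X f & forall phi, test phi -> u phi = distr_of f phi.

(* (u * phi)(x) = <u, phi(x - .)> *)
Definition dconv (u : ('rV[R]_d -> R[i]) -> R[i]) phi : 'rV[R]_d -> R[i] :=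
  fun x => u (fun y => phi (x - y)).

Definition weight (omega : 'rV[R]_d -> R) (t : R) f : 'rV[R]_d -> R[i] :=
  fun x => f x * (expR (t * omega x))%:C.

Definition Kspace (p : \bar R) (omega : 'rV[R]_d -> R) :
    set ('rV[R]_d -> R[i]) :=
  [set f | smooth f /\ forall (n : nat) a,
    LpSpace p (weight omega n%:R (mpartial a f))].

Definition OCspace (p : \bar R) (omega : 'rV[R]_d -> R) :
    set (('rV[R]_d -> R[i]) -> R[i]) :=
  [set u | is_distribution u /\
           forall phi, test phi -> Kspace p omega (dconv u phi)].

Definition OMspace (p : \bar R) (omega : 'rV[R]_d -> R) :
    set ('rV[R]_d -> R[i]) :=
  [set f | smooth f /\ forall phi, Kspace +oo%E omega phi ->
    Kspace p omega (fun x => f x * phi x)].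

Definition nondecreasing_radial (omega : 'rV[R]_d -> R) : Prop :=
  forall x y, eucl_norm x <= eucl_norm y -> omega x <= omega y.

Definition moderate (omega : 'rV[R]_d -> R) : Prop :=
  exists2 C : R, 0 < C &
    forall x y, eucl_norm y <= 1 -> omega (x + y) <= C * omega x.

Definition MDFP (chi : 'I_2 -> 'rV[R]_d -> R[i]) : Prop :=
  exists K : set 'rV[R]_d, compact K /\
  exists phi psi : 'I_2 -> nat -> 'rV[R]_d -> R[i],
    (forall l L, [/\ test_on K (phi l L), test_on_moments L K (psi l L),
                     phi l L <> (fun=> 0) & psi l L <> (fun=> 0)]) /\
    forall L : nat,
      [/\ forall x, dilate 1 (phi 0 L) x - phi 0 L x = laplacian (psi 0 L) x,
          cintegral (phi 0 L) = 1,
          forall x, phi 0 L x =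
            conv (chi 0) (phi 0 L) x + conv (chi 1) (phi 1 L) x &
          forall x, psi 0 L x =
            conv (chi 0) (psi 0 L) x + conv (chi 1) (psi 1 L) x].

(* sup over j and l of 2^(-rj) || g_{j,l} ||_{L^p}, for a family [g]. *)
Definition sup_norm (p : \bar R) (r : R)
    (g : nat -> 'I_2 -> 'rV[R]_d -> R[i]) : \bar R :=
  ereal_sup (range (fun jl : nat * 'I_2 =>
    ((2 `^ (- r * jl.1%:R))%:E * LpNorm p (g jl.1 jl.2))%E)).

End functions.

(* Main.v *)
(* Write phi_j, psi_j, chi_j for dilates and f_j^l for f * chi_j^l.  The identity
   2^d phi^0(2 .) - phi^0 = Delta psi^0 gives, after convolution with f,
     f * phi^0_(j+1) - f * phi^0_j = 2^(-2j) sum_l psi_j^l * Delta f_j^l ,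
   because psi^0 = sum_l chi^l * psi^l.  If psi^l has L vanishing moments, then
   |psi_j^l * g| is at most 2^(-jL) times a local average of derivatives of g (Taylor
   expansion, then a Sobolev inequality), and local averages are harmless for moderate
   weights and Lebesgue norms.  Choosing L larger than the growth exponent r makes the
   telescoping series converge: f is a smooth function with the required bounds in (i)
   and (iii); in (ii) the moments are spent on the test function instead.

   Conversely, in (i) the bounds hold with r = d.  In (ii) and (iii) the exponent r
   comes from a gliding hump argument, applied in (ii) to the functions f_j^l, since
   sum_j c_j chi_j^l is a test function for rapidly decreasing c; and in (iii) to
   f theta_j, where theta_j is a smooth partition of unity along the slabs
   j <= omega < j + 1, since sum_j c_j theta_j is then in K^oo_omega. *)

Require Import Defs.
From mathcomp Require Import all_boot all_order all_algebra.
From mathcomp Require Import all_classical all_reals all_analysis.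
From mathcomp Require Import complex.
From mathcomp Require Import measurable_realfun.
From mathcomp Require Import ring lra.

Set Implicit Arguments.
Unset Strict Implicit.
Unset Printing Implicit Defensive.
Import Order.TTheory GRing.Theory Num.Theory.
Import numFieldNormedType.Exports.
Local Open Scope classical_set_scope.
Local Open Scope ring_scope.
Local Notation conv := Defs.conv.

(** * The modulus and one-variable calculus *)

(** All estimates pass through pointwise domination by a local average, [avg_le]: it survives the
    weights at the price of another weight exponent, and every Lebesgue norm at the price of a
    constant, so that one argument serves all [p]. No constant is sharp; most factors 2 come from
    treating real and imaginary parts separately. The proof is shaped by the order of the
    quantifiers. In (i) and (iii) the exponent [r] does not depend on the derivative, so [L] is
    fixed once and the loss of [L] derivatives, and of those in the Sobolev inequality, is harmless.
    In (ii) no derivative of f_j^l is controlled and [r] depends on [n]; there [L] is chosen after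
    [n], after the radius of the averages and after the weight exponent that this radius imposes.
    This is possible because the compact set of the MDFP is the same for all [L]. The exponent [d]
    is the growth of the sup norms of chi_j^l, whose supports stay in a fixed ball. It serves in
    (iii) as well as in (i): there the gliding hump yields the weight exponent [n], one derivative
    at a time, since every derivative of a multiplier is a multiplier. *)

Section modulus.
Context {R : realType}.
Local Open Scope complex_scope.
Implicit Types z w : R[i].

Lemma cabs_ge0 z : 0 <= cabs z.
Proof. by case: z => a b; exact: sqrtr_ge0. Qed.

Lemma cabs0 : cabs (0 : R[i]) = 0.
Proof. exact: Normc.normc0. Qed.

Lemma cabs0_eq0 z : cabs z = 0 -> z = 0.
Proof. exact: Normc.eq0_normc. Qed.

Lemma cabsM z w : cabs (z * w) = cabs z * cabs w.
Proof. exact: Normc.normcM. Qed.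

Lemma cabsD z w : cabs (z + w) <= cabs z + cabs w.
Proof. exact: (@le_normcD R z w). Qed.

Lemma cabsN z : cabs (- z) = cabs z.
Proof. exact: (@normcN R z). Qed.

Lemma cabsB z w : cabs (z - w) <= cabs z + cabs w.
Proof. by rewrite -(cabsN w); exact: cabsD. Qed.

Lemma cabsBC z w : cabs (z - w) = cabs (w - z).
Proof. by rewrite -cabsN opprB. Qed.

Lemma cabs_real (t : R) : cabs t%:C = `|t|.
Proof. by rewrite /cabs/= expr0n/= addr0 sqrtr_sqr. Qed.

Lemma cabs_Re z : `|complex.Re z| <= cabs z.
Proof.
case: z => a b /=; rewrite -sqrtr_sqr ler_sqrt ?addr_ge0 ?sqr_ge0//.
by rewrite lerDl sqr_ge0.
Qed.

Lemma cabs_Im z : `|complex.Im z| <= cabs z.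
Proof.
case: z => a b /=; rewrite -sqrtr_sqr ler_sqrt ?addr_ge0 ?sqr_ge0//.
by rewrite lerDr sqr_ge0.
Qed.

Lemma cabs_ReIm z : cabs z <= `|complex.Re z| + `|complex.Im z|.
Proof.
case: z => a b /=; rewrite -[leRHS]ger0_norm ?addr_ge0// -sqrtr_sqr.
rewrite ler_sqrt ?sqr_ge0// sqrrD !real_normK ?num_real//.
have := mulr_ge0 (normr_ge0 a) (normr_ge0 b); lra.
Qed.

Lemma ReD z w : complex.Re (z + w) = complex.Re z + complex.Re w.
Proof. by case: z w => ? ? [? ?]. Qed.
Lemma ImD z w : complex.Im (z + w) = complex.Im z + complex.Im w.
Proof. by case: z w => ? ? [? ?]. Qed.
Lemma ReN z : complex.Re (- z) = - complex.Re z.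
Proof. by case: z. Qed.
Lemma ImN z : complex.Im (- z) = - complex.Im z.
Proof. by case: z. Qed.
Lemma ReM z w :
  complex.Re (z * w) = complex.Re z * complex.Re w - complex.Im z * complex.Im w.
Proof. by case: z w => ? ? [? ?]. Qed.
Lemma ImM z w :
  complex.Im (z * w) = complex.Re z * complex.Im w + complex.Im z * complex.Re w.
Proof. by case: z w => ? ? [? ?]. Qed.
Lemma Re_realM (t : R) z : complex.Re (t%:C * z) = t * complex.Re z.
Proof. by rewrite ReM/= mul0r subr0. Qed.
Lemma Im_realM (t : R) z : complex.Im (t%:C * z) = t * complex.Im z.
Proof. by rewrite ImM/= mul0r addr0. Qed.
Lemma cabs_sum (I : Type) (r : seq I) (F : I -> R[i]) :
  cabs (\sum_(i <- r) F i) <= \sum_(i <- r) cabs (F i).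
Proof.
elim/big_ind2 : _ => [|a b c e h1 h2|//]; first by rewrite cabs0.
exact: le_trans (cabsD _ _) (lerD h1 h2).
Qed.

End modulus.

Section real_derivative.
Context {R : realType}.

(** With the division cleared, [t = 0] needs no exclusion, and the errors of real and imaginary
    parts can be recombined under one modulus. *)
Lemma is_deriveP (V : normedModType R) (h : V -> R) (x v : V) (c : R) :
  is_derive x v h c <->
  forall e, 0 < e -> exists2 dl, 0 < dl &
    forall t, `|t| < dl -> `|h (x + t *: v) - h x - t * c| <= e * `|t|.
Proof.
split=> [[dh hc] e e0|H].
- have : h0^-1 *: ((h \o shift x) (h0 *: v) - h x) @[h0 --> 0^'] --> c.
    by rewrite -hc; exact: dh.
  move/cvgrPdist_le => /(_ _ e0) [dl /= dl0 Hd]; exists dl => // t tdl.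
  have [->|t0] := eqVneq t 0.
    by rewrite scale0r addr0 subrr mul0r subr0 normr0 mulr0.
  have := Hd t; rewrite /ball_/= sub0r normrN => /(_ tdl t0).
  rewrite distrC (addrC (t *: v)) => {}Hd.
  have -> : h (x + t *: v) - h x - t * c =
    t * (t^-1 *: (h (x + t *: v) - h x) - c).
    by rewrite mulrBr -[t^-1 *: _]/(t^-1 * _) mulrA divff// mul1r.
  by rewrite normrM mulrC ler_wpM2r.
- have K : h0^-1 *: ((h \o shift x) (h0 *: v) - h x) @[h0 --> 0^'] --> c.
    apply/cvgrPdist_le => e e0; have [dl dl0 Hd] := H _ e0.
    exists dl => // t /=; rewrite sub0r normrN => tdl t0.
    rewrite distrC (addrC (t *: v)).
    have -> : t^-1 *: (h (x + t *: v) - h x) - c =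
      t^-1 * (h (x + t *: v) - h x - t * c).
      by rewrite mulrBr mulrA mulVf// mul1r.
    rewrite normrM normfV mulrC ler_pdivrMr ?normr_gt0//.
    exact: Hd.
  by apply: DeriveDef; [apply: cvgP K|apply: cvg_lim K].
Qed.

Lemma mean_value_bound (f df : R -> R) (a b c B : R) : a <= b ->
  (forall x, a <= x <= b -> is_derive x 1 f (df x)) ->
  (forall x, a <= x <= b -> `|df x - c| <= B) ->
  `|f b - f a - (b - a) * c| <= B * (b - a).
Proof.
move=> ab df1 dfB.
have cf : {within `[a, b], continuous f}.
  apply: derivable_within_continuous => x; rewrite in_itv/= => xab.
  by have [] := df1 x xab.
have df2 x : x \in `]a, b[ -> is_derive x 1 f (df x).
  by rewrite in_itv/= => /andP[ax xb]; apply: df1; rewrite !ltW.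
have [x] := MVT_segment ab df2 cf.
rewrite in_itv/= => xab ->.
rewrite mulrC -mulrBr normrM ger0_norm ?subr_ge0// mulrC ler_wpM2r ?subr_ge0//.
exact: dfB.
Qed.

(** A negative [t] is absorbed by reversing the direction, which reduces to the segment [[0, |t|]].
    The free constant [c] covers both uses: [c = 0] gives a Lipschitz bound, the derivative at [x]
    gives a Taylor remainder. *)
Lemma mean_value_line (V : normedModType R) (h : V -> R) (h' : V -> R)
    (x v : V) (t c B : R) :
  (forall u, `|u| <= `|t| -> is_derive (x + u *: v) v h (h' (x + u *: v))) ->
  (forall u, `|u| <= `|t| -> `|h' (x + u *: v) - c| <= B) ->
  `|h (x + t *: v) - h x - t * c| <= B * `|t|.
Proof.
move=> dh hB.
pose w := if 0 <= t then v else - v.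
pose k := if 0 <= t then c else - c.
have tv : t *: v = `|t| *: w.
  rewrite /w; case: leP => t0; first by rewrite ger0_norm.
  by rewrite ltr0_norm// scaleNr scalerN opprK.
have tc : t * c = `|t| * k.
  rewrite /k; case: leP => t0; first by rewrite ger0_norm.
  by rewrite ltr0_norm// mulrNN.
pose s : R := if 0 <= t then 1 else -1.
have sw u : u *: w = (s * u) *: v.
  by rewrite /w /s; case: ifP => _; rewrite ?mul1r// mulN1r scalerN scaleNr.
have su u : `|s * u| = `|u|.
  by rewrite /s; case: ifP => _; rewrite ?mul1r// mulN1r normrN.
have := @mean_value_bound (fun u => h (x + u *: w)) (fun u => s * h' (x + u *: w))
  0 `|t| k B (normr_ge0 _).
rewrite !subr0 scale0r addr0 -tv -tc; apply.
- move=> u /andP[u0 ut]; apply/is_deriveP => e e0.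
  have uu : `|s * u| <= `|t| by rewrite su ger0_norm.
  have /is_deriveP/(_ _ e0)[dl dl0 Hd] := dh _ uu.
  exists dl => // z zdl; have := Hd (s * z); rewrite su => /(_ zdl).
  rewrite -!sw -[x + _ + _]addrA -scalerDl [z *: 1]mulr1.
  by rewrite (mulrC s z) -mulrA.
- move=> u /andP[u0 ut].
  have uu : `|s * u| <= `|t| by rewrite su ger0_norm.
  have := hB _ uu; rewrite -sw /s /k; case: ifP => _; first by rewrite mul1r.
  by rewrite mulN1r -opprD normrN.
Qed.

End real_derivative.

Section real_continuity.
Context {R : realType} {T : topologicalType}.
Implicit Types f g : T -> R.

Lemma cont_addr f g : continuous f -> continuous g ->
  continuous (fun x => f x + g x).
Proof. by move=> cf cg x; apply: cvgD; [exact: cf|exact: cg]. Qed.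

Lemma cont_subr f g : continuous f -> continuous g ->
  continuous (fun x => f x - g x).
Proof. by move=> cf cg x; apply: cvgB; [exact: cf|exact: cg]. Qed.

Lemma cont_mulr f g : continuous f -> continuous g ->
  continuous (fun x => f x * g x).
Proof. by move=> cf cg x; apply: cvgM; [exact: cf|exact: cg]. Qed.

Lemma cont_normr f : continuous f -> continuous (fun x => `|f x|).
Proof. by move=> cf x; apply: cvg_norm; exact: cf. Qed.

Lemma cont_comp (g : R -> R) f : continuous f -> continuous g ->
  continuous (fun x => g (f x)).
Proof.
by move=> cf cg x; apply: (@continuous_comp _ _ _ f g); [exact: cf|exact: cg].
Qed.

End real_continuity.

(** * Complex partial derivatives *)

Section coordinates.
Context {R : realType} {d : nat}.
Implicit Types v : 'rV[R]_d.

Lemma coord_le_norm v i : `|v ord0 i| <= `|v|.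
Proof.
rewrite [leRHS]/Num.norm/= mx_normrE.
exact: (@le_bigmax _ _ _ _ (fun ij : 'I_1 * 'I_d => `|v ij.1 ij.2|) (ord0, i)).
Qed.

Lemma norm_le_coord v B : 0 <= B -> (forall i, `|v ord0 i| <= B) -> `|v| <= B.
Proof.
move=> B0 vB; rewrite [leLHS]/Num.norm/= mx_normrE; apply/bigmax_leP.
by split => // -[i j] _; rewrite ord1; exact: vB.
Qed.

Lemma norm_delta_le (t : R) i : `|t *: delta_mx ord0 i : 'rV[R]_d| <= `|t|.
Proof.
apply: norm_le_coord => // j; rewrite !mxE normrM.
by case: eqP => _; case: eqP => _ /=; rewrite ?normr0 ?normr1 ?mulr0 ?mulr1.
Qed.

Lemma sum_coord_le v : \sum_i `|v ord0 i| <= d%:R * `|v|.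
Proof.
apply: (@le_trans _ _ (\sum_(i < d) `|v|)).
  by apply: ler_sum => i _; exact: coord_le_norm.
by rewrite sumr_const card_ord mulr_natl.
Qed.

End coordinates.

Section complex_derivative.
Context {R : realType} {d : nat}.
Local Open Scope complex_scope.
Local Notation E := 'rV[R]_d.
Local Notation C := R[i].
Local Notation re := (@complex.Re R).
Local Notation im := (@complex.Im R).
Local Notation e_ i := (delta_mx ord0 i : E).
Implicit Types (F H : E -> C) (x : E) (i : 'I_d) (c : C).

(** Directional differentiability of a complex function with an explicit error, in place of two real
    [is_derive] statements. It makes sums, scalings and limits one-line estimates. *)
Definition cder F i x c := forall e, 0 < e -> exists2 dl, 0 < dl &
  forall t : R, `|t| < dl ->
    cabs (F (x + t *: e_ i) - F x - t%:C * c) <= e * `|t|.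

Definition ccont F := forall x e, 0 < e -> exists2 dl, 0 < dl &
  forall v, `|v| < dl -> cabs (F (x + v) - F x) <= e.

Lemma cderP F i x c : cder F i x c <->
  is_derive x (e_ i) (fun y => re (F y)) (re c) /\
  is_derive x (e_ i) (fun y => im (F y)) (im c).
Proof.
split=> [H|[/is_deriveP H1 /is_deriveP H2] e e0].
  split; apply/is_deriveP => e e0; have [dl dl0 Hd] := H _ e0;
    exists dl => // t tdl; apply: le_trans (Hd t tdl).
  - by apply: le_trans (cabs_Re _); rewrite !ReD !ReN Re_realM.
  - by apply: le_trans (cabs_Im _); rewrite !ImD !ImN Im_realM.
have e20 : 0 < e / 2 by rewrite divr_gt0.
have [d1 d10 K1] := H1 _ e20; have [d2 d20 K2] := H2 _ e20.
exists (Num.min d1 d2); first by rewrite lt_min d10.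
move=> t; rewrite lt_min => /andP[t1 t2].
apply: le_trans (cabs_ReIm _) _; rewrite !ReD !ReN Re_realM !ImD !ImN Im_realM.
by rewrite [e]splitr mulrDl lerD// ?K1 ?K2.
Qed.

Lemma cder_partial F i x c : cder F i x c -> partial i F x = c.
Proof.
by move=> /cderP[[_ h1] [_ h2]]; rewrite /partial h1 h2; case: c {h1 h2}.
Qed.

Lemma smooth_cder F i x : smooth F -> cder F i x (partial i F x).
Proof.
move=> /(_ [::])[_ _ /(_ i x)[h1 h2]]; apply/cderP.
by split; [exact: (DeriveDef h1 erefl)|exact: (DeriveDef h2 erefl)].
Qed.

Lemma smooth_D F s : smooth F -> smooth (foldr partial F s).
Proof. by move=> sF s'; rewrite -foldr_cat; exact: sF. Qed.

Lemma smooth_partial F i : smooth F -> smooth (partial i F).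
Proof. exact: (@smooth_D F [:: i]). Qed.

Lemma real_contP (h : E -> R) : continuous h <->
  forall x e, 0 < e -> exists2 dl, 0 < dl &
    forall v, `|v| < dl -> `|h (x + v) - h x| <= e.
Proof.
split=> [ch x e e0|H x].
  have /cvgrPdist_le/(_ _ e0)/nbhs_normP[dl /= dl0 Hd] := ch x.
  exists dl => // v vdl; rewrite distrC; apply: Hd.
  by rewrite /ball_/= opprD addrA subrr sub0r normrN.
apply/(@cvgrPdist_le _ _ _ (nbhs x)) => e e0; have [dl dl0 Hd] := H x _ e0.
suff : nbhs x [set y | `|h x - h y| <= e] by [].
rewrite -nbhs_nbhs_norm; exists dl => // y /=; rewrite distrC => yx.
by have := Hd _ yx; rewrite [x + _]addrC subrK distrC.
Qed.

Lemma ccontP F : ccont F <->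
  continuous (fun y => re (F y)) /\ continuous (fun y => im (F y)).
Proof.
split=> [H|[/real_contP H1 /real_contP H2] x e e0].
  split; apply/real_contP => x e e0; have [dl dl0 Hd] := H x _ e0;
    exists dl => // v vdl; apply: le_trans (Hd v vdl).
  - by apply: le_trans (cabs_Re _); rewrite !ReD !ReN.
  - by apply: le_trans (cabs_Im _); rewrite !ImD !ImN.
have e20 : 0 < e / 2 by rewrite divr_gt0.
have [d1 d10 K1] := H1 x _ e20; have [d2 d20 K2] := H2 x _ e20.
exists (Num.min d1 d2); first by rewrite lt_min d10.
move=> v; rewrite lt_min => /andP[t1 t2].
apply: le_trans (cabs_ReIm _) _; rewrite !ReD !ReN !ImD !ImN.
by rewrite [e]splitr lerD// ?K1 ?K2.
Qed.

Lemma smooth_ccont F : smooth F -> ccont F.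
Proof. by move=> /(_ [::])[? ? _]; apply/ccontP. Qed.

(** A family indexed by words and stable under one further differentiation must be the family of
    iterated derivatives. Smoothness and the formula for all derivatives are therefore always
    obtained together. *)
Lemma smooth_intro (G : seq 'I_d -> E -> C) :
  (forall s, ccont (G s)) ->
  (forall s i x, cder (G s) i x (G (i :: s) x)) ->
  smooth (G [::]) /\ forall s, foldr partial (G [::]) s = G s.
Proof.
move=> cG dG.
have GE s : foldr partial (G [::]) s = G s.
  by elim: s => //= i s ->; apply/funext => x; exact: cder_partial.
split=> // s; rewrite /= GE; have /ccontP[? ?] := cG s.
split=> // i x; have /cderP[h1 h2] := dG s i x.
by split; [have [] := h1|have [] := h2].
Qed.

(** The mean value theorem fails for complex values; applied to the two parts separately it costs
    the factor 2. *)
Lemma cmean_value F (F' : E -> C) i x t c B :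
  (forall u, `|u| <= `|t| -> cder F i (x + u *: e_ i) (F' (x + u *: e_ i))) ->
  (forall u, `|u| <= `|t| -> cabs (F' (x + u *: e_ i) - c) <= B) ->
  cabs (F (x + t *: e_ i) - F x - t%:C * c) <= 2 * B * `|t|.
Proof.
move=> dF FB; apply: le_trans (cabs_ReIm _) _.
rewrite !ReD !ReN Re_realM !ImD !ImN Im_realM -mulrA mulr_natl mulr2n.
apply: lerD.
- apply: (@mean_value_line _ _ (fun y => re (F y)) (fun y => re (F' y))) => u ut.
    by have /cderP[] := dF u ut.
  by rewrite -ReN -ReD; apply: le_trans (cabs_Re _) (FB u ut).
- apply: (@mean_value_line _ _ (fun y => im (F y)) (fun y => im (F' y))) => u ut.
    by have /cderP[] := dF u ut.
  by rewrite -ImN -ImD; apply: le_trans (cabs_Im _) (FB u ut).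
Qed.

(** The segment from [x] to [x + v] is replaced by a path along the axes, changing one coordinate at
    a time. In the sup norm this path never leaves the ball of radius [|v|] around [x], so the
    hypothesis on [F'] applies along it. *)
Lemma cmean_value_vec F (F' : 'I_d -> E -> C) x (v : E) (cs : 'I_d -> C) B :
  (forall i z, cder F i z (F' i z)) ->
  (forall i w, `|w| <= `|v| -> cabs (F' i (x + w) - cs i) <= B) ->
  cabs (F (x + v) - F x - \sum_i (v ord0 i)%:C * cs i) <=
    2 * B * \sum_i `|v ord0 i|.
Proof.
move=> dF FB.
pose vk k : E := \row_j if (j < k)%N then v ord0 j else 0.
suff H k : (k <= d)%N ->
    cabs (F (x + vk k) - F x - \sum_(i < d | (i < k)%N) (v ord0 i)%:C * cs i) <=
    2 * B * \sum_(i < d | (i < k)%N) `|v ord0 i|.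
  have := H d (leqnn d).
  have -> : vk d = v by apply/rowP => j; rewrite !mxE ltn_ord.
  have eb (V : nmodType) (f : 'I_d -> V) :
      \sum_(i < d | (i < d)%N) f i = \sum_i f i.
    by apply: eq_bigl => i; rewrite ltn_ord.
  by rewrite !eb.
elim: k => [_|k IH kd].
  have eb (V : nmodType) (f : 'I_d -> V) : \sum_(i < d | (i < 0)%N) f i = 0.
    by rewrite big_pred0// => i; rewrite ltn0.
  rewrite !eb.
  have -> : vk 0%N = 0 by apply/rowP => j; rewrite !mxE ltn0.
  by rewrite addr0 subrr subr0 cabs0 mulr0.
pose ik := Ordinal kd.
have vkS : vk k.+1 = vk k + v ord0 ik *: e_ ik.
  apply/rowP => j; rewrite !mxE eqxx/= ltnS leq_eqVlt.
  have [jk|jk] := eqVneq j ik.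
    by subst j; rewrite /= eqxx ltnn mulr1 add0r.
  rewrite mulr0 addr0; have -> // : (nat_of_ord j == k) = false.
  by apply/negbTE; apply: contra jk => /eqP jk; apply/eqP/val_inj.
have sumS (V : nmodType) (f : 'I_d -> V) : \sum_(i < d | (i < k.+1)%N) f i =
    f ik + \sum_(i < d | (i < k)%N) f i.
  rewrite (bigD1 ik)//=; congr (_ + _); apply: eq_bigl => i.
  rewrite ltnS leq_eqVlt; have [->|ik0] := eqVneq i ik.
    by rewrite andbF ltnn.
  rewrite andbT; have -> // : (nat_of_ord i == k) = false.
  by apply/negbTE; apply: contra ik0 => /eqP jk; apply/eqP/val_inj.
rewrite !sumS mulrDr opprD.
have -> : forall a b c e : C, a - b + (- c - e) =
    (a - F (x + vk k) - c) + (F (x + vk k) - b - e) by move=> *; ring.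
apply: le_trans (cabsD _ _) _; apply: lerD; last exact/IH/ltnW.
rewrite vkS addrA; apply: (cmean_value (F' := F' ik)) => [//|u ut].
rewrite -addrA; apply: FB; apply: norm_le_coord => // j; rewrite !mxE eqxx/=.
case: ifP => jk.
  have -> : (j == ik) = false.
    by apply/negbTE; apply: contraTN jk => /eqP ->; rewrite /= ltnn.
  by rewrite mulr0 addr0 coord_le_norm.
rewrite add0r normrM; case: eqP => _; last by rewrite normr0 mulr0.
by rewrite normr1 mulr1; apply: le_trans ut (coord_le_norm _ _).
Qed.

Lemma ccont_bounded F rho : ccont F ->
  exists2 B, 0 <= B & forall x, `|x| <= rho -> cabs (F x) <= B.
Proof.
move=> /ccontP[c1 c2].
have Kc : compact [set x : E | `|x| <= rho].
  apply: bounded_closed_compact.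
    exists rho; split; first exact: num_real.
    by move=> y ry x /= /le_trans; apply; exact: ltW.
  by apply: (@closed_comp _ _ (fun x : E => `|x|) [set t | t <= rho]);
    [move=> x _; exact: norm_continuous|exact: closed_le].
have [r0|r0] := leP 0 rho; last first.
  by exists 0 => // x /le_lt_trans/(_ r0); rewrite ltNge normr_ge0.
have K0 : [set x : E | `|x| <= rho] !=set0 by exists 0; rewrite /= normr0.
have cs : {within [set x : E | `|x| <= rho],
    continuous (fun x => `|re (F x)| + `|im (F x)|)}.
  apply: continuous_subspaceT; apply: (@cont_addr R E) => x;
    apply: (@cont_normr R E); [exact: c1|exact: c2].
have [z _ Hz] := compact_EVT_max K0 Kc cs.
exists (`|re (F z)| + `|im (F z)|); first by rewrite addr_ge0.
by move=> x xr; apply: le_trans (cabs_ReIm _) (Hz x _); rewrite inE.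
Qed.

Lemma smooth_bounded F rho : smooth F ->
  exists2 B, 0 <= B & forall x, `|x| <= rho -> cabs (F x) <= B.
Proof. by move=> /smooth_ccont; exact: ccont_bounded. Qed.

Lemma lip_ccont F : (forall rho, exists2 B, 0 <= B & forall x v, `|x| <= rho ->
  `|v| <= 1 -> cabs (F (x + v) - F x) <= B * `|v|) -> ccont F.
Proof.
move=> H x e e0; have [B B0 HB] := H `|x|.
exists (Num.min 1 (e / (B + 1))).
  by rewrite lt_min ltr01 divr_gt0// ltr_wpDl.
move=> v; rewrite lt_min => /andP[v1 ve].
apply: le_trans (HB _ _ (lexx _) (ltW v1)) _.
have B10 : 0 < B + 1 by rewrite ltr_wpDl.
move: ve; rewrite ltr_pdivlMr// => /ltW; apply: le_trans.
by rewrite mulrC ler_wpM2l// lerDl.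
Qed.

End complex_derivative.

(** * Geometric rates of convergence *)

Section geometric.
Context {R : realType}.
Implicit Types (K e : R).

Lemma geo_gt0 J : 0 < (2^-1 : R) ^+ J.
Proof. by rewrite exprn_gt0. Qed.

Lemma geo_small K e : 0 < e -> exists J, forall j, (J <= j)%N -> K * 2^-1 ^+ j <= e.
Proof.
move=> e0; have [K0|K0] := leP K 0.
  exists 0%N => j _; apply: (@le_trans _ _ 0); last exact: ltW.
  by rewrite mulr_le0_ge0// ltW// geo_gt0.
exists (Num.bound (K / e)) => j Jj.
rewrite exprVn ler_pdivrMr ?exprn_gt0// mulrC -ler_pdivrMr//.
apply: ltW; apply: lt_le_trans (archi_boundP _) _; first by rewrite divr_ge0 ?ltW.
by rewrite -natrX ler_nat (leq_trans Jj)// ltnW// ltn_expl.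
Qed.

Lemma le_geo (a b K : R) : (forall J, a <= b + K * 2^-1 ^+ J) -> a <= b.
Proof.
move=> H; rewrite leNgt; apply/negP => ba.
have [|J HJ] := @geo_small K ((a - b) / 2); first by rewrite divr_gt0// subr_gt0.
have := le_trans (H J) (lerD (lexx b) (HJ J (leqnn J))).
lra.
Qed.

(** The limit is the supremum of the increasing sequence [u J - 2 B 2^-J], which stays below the
    decreasing [u J + 2 B 2^-J]. The error is then claimed for every admissible [B']: limits chosen
    pointwise can later be given a constant uniform in the point. *)
Lemma real_geo_limit (u : nat -> R) (B : R) :
  (forall J, `|u J.+1 - u J| <= B * 2^-1 ^+ J) ->
  exists l, forall B', (forall J, `|u J.+1 - u J| <= B' * 2^-1 ^+ J) ->
    forall J, `|u J - l| <= 2 * B' * 2^-1 ^+ J.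
Proof.
move=> H0.
pose a B J := u J - 2 * B * 2^-1 ^+ J; pose b B J := u J + 2 * B * 2^-1 ^+ J.
have ab B' : (forall J, `|u J.+1 - u J| <= B' * 2^-1 ^+ J) ->
    forall J (K : nat), a B' J <= b B' K.
  move=> H.
  have am : {homo a B' : x y / (x <= y)%N >-> x <= y}.
    apply: homo_leq => [//|x y z|J]; first exact: le_trans.
    by have := H J; rewrite ler_norml /a exprS => /andP[]; lra.
  have bm : {homo b B' : x y / (x <= y)%N >-> y <= x}.
    apply: homo_leq => [//|x y z yx zx|J]; first exact: le_trans zx yx.
    by have := H J; rewrite ler_norml /b exprS => /andP[]; lra.
  have B0 : 0 <= B'.
    by have := H 0%N; rewrite expr0 mulr1; apply: le_trans.
  move=> J K; apply: le_trans (am _ _ (leq_maxl J K)) _.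
  apply: le_trans (bm _ _ (leq_maxr J K)); rewrite /a /b lerD2l.
  by have := mulr_ge0 B0 (ltW (geo_gt0 (maxn J K))); lra.
pose l := sup (range (a B)); exists l => B' H J.
have hs : has_sup (range (a B)).
  split; first by exists (a B 0%N); exists 0%N.
  by exists (b B 0%N) => _ [K _ <-]; exact: ab.
have l1 (K : nat) : a B K <= l by apply: (sup_upper_bound hs); exists K.
have l2 (K : nat) : l <= b B K.
  by apply: ge_sup => [|_ [K' _ <-]]; [case: hs|exact: ab].
have la (K : nat) : `|u K - l| <= 2 * B * 2^-1 ^+ K.
  by have := l1 K; have := l2 K; rewrite /a /b ler_norml; lra.
have B0 : 0 <= B' by have := H 0%N; rewrite expr0 mulr1; apply: le_trans.
have tail0 (n : nat) :
    `|u J - u (J + n)%N| <= 2 * B' * 2^-1 ^+ J - 2 * B' * 2^-1 ^+ (J + n).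
  elim: n => [|n IH]; first by rewrite addn0 !subrr normr0.
  rewrite addnS; have := H (J + n)%N; rewrite exprS.
  by move: IH; rewrite !ler_norml => /andP[? ?] /andP[? ?]; lra.
have tail (n : nat) : `|u J - u (J + n)%N| <= 2 * B' * 2^-1 ^+ J.
  apply: le_trans (tail0 n) _; rewrite lerBlDr lerDl.
  by rewrite mulr_ge0// ?mulr_ge0// ltW// geo_gt0.
apply: (@le_geo _ _ (2 * B * 2^-1 ^+ J)) => n.
rewrite -(mulrA (2 * B)) -exprD -(subrKA (u (J + n)%N)).
by apply: le_trans (ler_normD _ _) (lerD (tail n) (la _)).
Qed.

End geometric.

(** * Operations on smooth functions *)

Section smooth_closure.
Context {R : realType} {d : nat}.
Local Open Scope complex_scope.
Local Notation E := 'rV[R]_d.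
Local Notation C := R[i].
Local Notation re := (@complex.Re R).
Local Notation im := (@complex.Im R).
Local Notation e_ i := (delta_mx ord0 i : E).
Local Notation D s F := (foldr partial F s).
Implicit Types (F H : E -> C) (x : E) (i : 'I_d) (c k : C).

Lemma cderD F H i x c k : cder F i x c -> cder H i x k ->
  cder (fun y => F y + H y) i x (c + k).
Proof.
move=> h1 h2 e e0; have e20 : 0 < e / 2 by rewrite divr_gt0.
have [d1 d10 K1] := h1 _ e20; have [d2 d20 K2] := h2 _ e20.
exists (Num.min d1 d2); first by rewrite lt_min d10.
move=> t; rewrite lt_min => /andP[t1 t2].
have -> : F (x + t *: e_ i) + H (x + t *: e_ i) - (F x + H x) - t%:C * (c + k) =
  (F (x + t *: e_ i) - F x - t%:C * c) + (H (x + t *: e_ i) - H x - t%:C * k).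
  by ring.
by apply: le_trans (cabsD _ _) _; rewrite [e]splitr mulrDl lerD// ?K1 ?K2.
Qed.

Lemma cderZ F i x c k : cder F i x c -> cder (fun y => k * F y) i x (k * c).
Proof.
move=> h e e0.
have e1 : 0 < e / (cabs k + 1) by rewrite divr_gt0// ltr_wpDl// cabs_ge0.
have [dl dl0 K] := h _ e1; exists dl => // t tdl.
have -> : k * F (x + t *: e_ i) - k * F x - t%:C * (k * c) =
  k * (F (x + t *: e_ i) - F x - t%:C * c) by ring.
rewrite cabsM; apply: (@le_trans _ _ ((cabs k + 1) * (e / (cabs k + 1) * `|t|))).
  by apply: ler_pM; rewrite ?cabs_ge0 ?lerDl// K.
by rewrite mulrA mulrCA divff ?mulr1// gt_eqF// ltr_wpDl// cabs_ge0.
Qed.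

Lemma cder_cst c i x : cder (fun=> c) i x 0.
Proof.
by move=> e e0; exists 1 => // t _; rewrite subrr mulr0 subr0 cabs0 mulr_ge0// ltW.
Qed.

Lemma cder_sum (I : Type) (r : seq I) (F : I -> E -> C) (G : I -> C) i x :
  (forall j, cder (F j) i x (G j)) ->
  cder (fun y => \sum_(j <- r) F j y) i x (\sum_(j <- r) G j).
Proof.
move=> h; elim: r => [|j r IH].
  under eq_fun do rewrite big_nil.
  by rewrite big_nil; exact: cder_cst.
under eq_fun do rewrite big_cons.
by rewrite big_cons; exact: (cderD (h j) IH).
Qed.

Lemma cderM F H i x c k : cder F i x c -> cder H i x k ->
  cder (fun y => F y * H y) i x (c * H x + F x * k).
Proof.
move=> /cderP[f1 f2] /cderP[h1 h2]; apply/cderP; split.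
- rewrite (_ : (fun y => _) = (fun y => re (F y)) * (fun y => re (H y))
    - (fun y => im (F y)) * (fun y => im (H y))); last first.
    by apply/funext => y; rewrite ReM.
  apply: (is_derive_eq (is_deriveB (is_deriveM f1 h1) (is_deriveM f2 h2))).
  by rewrite ReD !ReM /GRing.scale/=; ring.
- rewrite (_ : (fun y => _) = (fun y => re (F y)) * (fun y => im (H y))
    + (fun y => im (F y)) * (fun y => re (H y))); last first.
    by apply/funext => y; rewrite ImM.
  apply: (is_derive_eq (is_deriveD (is_deriveM f1 h2) (is_deriveM f2 h1))).
  by rewrite ImD !ImM /GRing.scale/=; ring.
Qed.

Lemma cder_affine F i x (a : E) (s : R) c : cder F i (a + s *: x) c ->
  cder (fun y => F (a + s *: y)) i x (s%:C * c).
Proof.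
move=> h e e0; have e1 : 0 < e / (`|s| + 1) by rewrite divr_gt0// ltr_wpDl.
have [dl dl0 K] := h _ e1; exists (dl / (`|s| + 1)).
  by rewrite divr_gt0// ltr_wpDl.
have s1 : 0 < `|s| + 1 by rewrite ltr_wpDl.
move=> t; rewrite ltr_pdivlMr// => tdl.
have st : `|s * t| < dl.
  by rewrite normrM; apply: le_lt_trans tdl; rewrite mulrC ler_wpM2l// lerDl.
have := K _ st; rewrite scalerDr addrA scalerA.
have -> : (s * t)%:C * c = t%:C * (s%:C * c) by rewrite rmorphM/= mulrAC mulrC.
move=> /le_trans; apply.
rewrite normrM mulrA ler_wpM2r// mulrAC ler_pdivrMr//.
by rewrite ler_wpM2l ?(ltW e0)// lerDl.
Qed.

Lemma ccont_cst c : ccont (fun _ : E => c).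
Proof. by move=> x e e0; exists 1 => // v _; rewrite subrr cabs0 ltW. Qed.

Lemma ccontD F H : ccont F -> ccont H -> ccont (fun y => F y + H y).
Proof.
move=> /ccontP[f1 f2] /ccontP[h1 h2]; apply/ccontP; split.
- by under eq_fun do rewrite ReD; exact: (cont_addr f1 h1).
- by under eq_fun do rewrite ImD; exact: (cont_addr f2 h2).
Qed.

Lemma ccontM F H : ccont F -> ccont H -> ccont (fun y => F y * H y).
Proof.
move=> /ccontP[f1 f2] /ccontP[h1 h2]; apply/ccontP; split.
- under eq_fun do rewrite ReM.
  exact: (cont_subr (cont_mulr f1 h1) (cont_mulr f2 h2)).
- under eq_fun do rewrite ImM.
  exact: (cont_addr (cont_mulr f1 h2) (cont_mulr f2 h1)).
Qed.

Lemma ccontZ k F : ccont F -> ccont (fun y => k * F y).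
Proof. by move=> cF; exact: (ccontM (ccont_cst k) cF). Qed.

Lemma ccont_sum (I : Type) (r : seq I) (F : I -> E -> C) :
  (forall j, ccont (F j)) -> ccont (fun y => \sum_(j <- r) F j y).
Proof.
move=> h; elim: r => [|j r IH].
  by under eq_fun do rewrite big_nil; exact: ccont_cst.
by under eq_fun do rewrite big_cons; exact: (ccontD (h j) IH).
Qed.

Lemma ccont_affine F (a : E) (s : R) : ccont F -> ccont (fun y => F (a + s *: y)).
Proof.
move=> h x e e0; have [dl dl0 K] := h (a + s *: x) e e0.
have s1 : 0 < `|s| + 1 by rewrite ltr_wpDl.
exists (dl / (`|s| + 1)); first by rewrite divr_gt0.
move=> v; rewrite ltr_pdivlMr// => vdl; rewrite scalerDr addrA; apply: K.
by rewrite normrZ; apply: le_lt_trans vdl; rewrite mulrC ler_wpM2l// lerDl.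
Qed.

Lemma smooth_cst c : smooth (fun _ : E => c).
Proof.
have [||//] := @smooth_intro R d (fun s => if s is [::] then fun=> c else fun=> 0).
  by case=> [|i s]; exact: ccont_cst.
by case=> [|j s] i x; exact: cder_cst.
Qed.

Lemma smoothD F H : smooth F -> smooth H -> smooth (fun y => F y + H y) /\
  forall s, D s (fun y => F y + H y) = (fun y => D s F y + D s H y).
Proof.
move=> sF sH; apply: (@smooth_intro _ _ (fun s y => D s F y + D s H y)).
  by move=> s; exact: (ccontD (smooth_ccont (smooth_D s sF))
    (smooth_ccont (smooth_D s sH))).
by move=> s i x; exact: (cderD (smooth_cder i x (smooth_D s sF))
  (smooth_cder i x (smooth_D s sH))).
Qed.

Lemma smoothZ k F : smooth F -> smooth (fun y => k * F y) /\
  forall s, D s (fun y => k * F y) = (fun y => k * D s F y).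
Proof.
move=> sF; apply: (@smooth_intro _ _ (fun s y => k * D s F y)).
  by move=> s; exact: (ccontZ k (smooth_ccont (smooth_D s sF))).
by move=> s i x; exact: (cderZ k (smooth_cder i x (smooth_D s sF))).
Qed.

Lemma smooth_sum (I : Type) (r : seq I) (F : I -> E -> C) :
  (forall j, smooth (F j)) -> smooth (fun y => \sum_(j <- r) F j y) /\
  forall s, D s (fun y => \sum_(j <- r) F j y) =
    (fun y => \sum_(j <- r) D s (F j) y).
Proof.
move=> sF; apply: (@smooth_intro _ _ (fun s y => \sum_(j <- r) D s (F j) y)).
  by move=> s; apply: (@ccont_sum _ r (fun j => D s (F j))) => j;
    exact: (smooth_ccont (smooth_D s (sF j))).
by move=> s i x; apply: (@cder_sum _ r (fun j => D s (F j))) => j;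
  exact: (smooth_cder i x (smooth_D s (sF j))).
Qed.

Lemma smooth_affine F (a : E) (t : R) : smooth F ->
  smooth (fun y => F (a + t *: y)) /\
  forall s, D s (fun y => F (a + t *: y)) =
    (fun y => t%:C ^+ size s * D s F (a + t *: y)).
Proof.
move=> sF.
have [] := @smooth_intro _ _ (fun s y => t%:C ^+ size s * D s F (a + t *: y)).
- by move=> s; exact: (ccontZ _ (ccont_affine a t (smooth_ccont (smooth_D s sF)))).
- move=> s i x; rewrite /= exprSr -mulrA.
  exact: (cderZ _ (cder_affine (smooth_cder i (a + t *: x) (smooth_D s sF)))).
rewrite /= (_ : (fun y => 1 * _) = (fun y => F (a + t *: y)))//.
by apply/funext => y; rewrite mul1r.
Qed.

(** All ways of sharing the letters of a word between two factors, listed with repetition so that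
    the product rule has no binomial coefficients. *)
Fixpoint leibniz (s : seq 'I_d) : seq (seq 'I_d * seq 'I_d) :=
  if s is i :: s' then
    [seq (i :: p.1, p.2) | p <- leibniz s'] ++ [seq (p.1, i :: p.2) | p <- leibniz s']
  else [:: ([::], [::])].

Lemma smoothM F H : smooth F -> smooth H -> smooth (fun y => F y * H y) /\
  forall s, D s (fun y => F y * H y) =
    (fun y => \sum_(p <- leibniz s) D p.1 F y * D p.2 H y).
Proof.
move=> sF sH.
have [] := @smooth_intro _ _
  (fun s y => \sum_(p <- leibniz s) D p.1 F y * D p.2 H y).
- move=> s; apply: (@ccont_sum _ _ (fun p y => D p.1 F y * D p.2 H y)) => p.
  exact: (ccontM (smooth_ccont (smooth_D p.1 sF)) (smooth_ccont (smooth_D p.2 sH))).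
- move=> s i x; rewrite /= big_cat !big_map /= -big_split/=.
  apply: (@cder_sum _ _ (fun p y => D p.1 F y * D p.2 H y)) => p.
  exact: (cderM (smooth_cder i x (smooth_D p.1 sF))
    (smooth_cder i x (smooth_D p.2 sH))).
rewrite /= (_ : (fun y => \sum_(p <- [:: _]) _) = (fun y => F y * H y))//.
by apply/funext => y; rewrite big_seq1.
Qed.

Lemma smooth_coord j : smooth (fun y : E => (y ord0 j)%:C).
Proof.
have [||//] := @smooth_intro R d (fun s y => if s is i :: s' then
  if s' is [::] then (i == j)%:R else 0 else (y ord0 j)%:C).
- case=> [|i [|i' s]]; [|exact: ccont_cst|exact: ccont_cst].
  move=> x e e0; exists e => // v ve; rewrite mxE -rmorphB addrAC subrr add0r.
  by rewrite cabs_real; apply: le_trans (coord_le_norm _ _) (ltW ve).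
- case=> [|i [|i' s]] i0 x; [|exact: cder_cst|exact: cder_cst].
  move=> e e0; exists 1 => // t _; rewrite !mxE eqxx/= -rmorphB addrAC subrr add0r.
  rewrite rmorphM rmorph_nat (eq_sym i0 j) subrr cabs0.
  by rewrite mulr_ge0// ltW.
Qed.

(** The second difference of [F] along [t e_i] and [t e_j] is symmetric in [i] and [j]. Two mean
    value estimates show that it is [t^2] times either mixed derivative up to [4 e' t^2], so the two
    derivatives differ by an arbitrarily small amount. *)
Lemma partialC F i j : smooth F -> partial i (partial j F) = partial j (partial i F).
Proof.
move=> sF; apply/funext => x; apply/eqP; rewrite -subr_eq0; apply/eqP/cabs0_eq0.
apply/eqP; rewrite eq_le cabs_ge0 andbT; apply/ler_addgt0Pr => e e0; rewrite add0r.
have key (i1 j1 : 'I_d) e' : 0 < e' -> exists2 dl, 0 < dl &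
    forall t : R, `|t| < dl ->
    cabs (F (x + t *: e_ i1 + t *: e_ j1) - F (x + t *: e_ i1) - F (x + t *: e_ j1) + F x
      - t%:C * (t%:C * partial j1 (partial i1 F) x)) <= 4 * e' * `|t| ^+ 2.
  move=> e0'.
  have [dl dl0 Hd] := smooth_ccont (smooth_partial j1 (smooth_partial i1 sF)) x e0'.
  exists (dl / 2); first by rewrite divr_gt0.
  move=> t tdl.
  pose h y := F (y + t *: e_ j1) + -1 * F y.
  pose h' y := partial i1 F (y + t *: e_ j1) + -1 * partial i1 F y.
  have dh y : cder h i1 y (h' y).
    apply: (@cderD (fun y => F (y + t *: e_ j1)) (fun y => -1 * F y));
      last exact: (cderZ _ (smooth_cder i1 y sF)).
    have := @cder_affine F i1 y (t *: e_ j1) 1 (partial i1 F (t *: e_ j1 + 1 *: y)).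
    rewrite mul1r scale1r [t *: _ + y]addrC => /(_ (smooth_cder _ _ sF)).
    by rewrite (_ : (fun y => _) = (fun y => F (y + t *: e_ j1)))//; apply/funext => z; rewrite scale1r addrC.
  have -> : F (x + t *: e_ i1 + t *: e_ j1) - F (x + t *: e_ i1)
      - F (x + t *: e_ j1) + F x - t%:C * (t%:C * partial j1 (partial i1 F) x) =
    h (x + t *: e_ i1) - h x - t%:C * (t%:C * partial j1 (partial i1 F) x).
    by rewrite /h; ring.
  apply: (@le_trans _ _ (2 * (2 * e' * `|t|) * `|t|)); last first.
    by rewrite expr2; lra.
  apply: (cmean_value (F' := h')) => [//|u ut].
  rewrite /h' mulN1r.
  apply: (cmean_value (F' := partial j1 (partial i1 F))) => w wt.
    exact/smooth_cder/smooth_partial.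
  rewrite -addrA; apply: Hd; apply: le_lt_trans (ler_normD _ _) _.
  apply: (@le_lt_trans _ _ (`|t| + `|t|)); last by lra.
  by apply: lerD; apply: le_trans (norm_delta_le _ _) _.
have e8 : 0 < e / 8 by rewrite divr_gt0.
have [d1 d10 K1] := key i j _ e8; have [d2 d20 K2] := key j i _ e8.
pose t := Num.min d1 d2 / 2.
have m0 : 0 < Num.min d1 d2 by rewrite lt_min d10.
have t0 : 0 < t by rewrite divr_gt0.
have tm : `|t| < Num.min d1 d2 by rewrite gtr0_norm// /t; lra.
move: tm; rewrite lt_min => /andP[/K1 {}K1 /K2 {}K2].
rewrite -(ler_pM2l (exprn_gt0 2 t0)).
have -> : t ^+ 2 * cabs (partial i (partial j F) x - partial j (partial i F) x) =
  cabs (t%:C * (t%:C * (partial i (partial j F) x - partial j (partial i F) x))).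
  by rewrite !cabsM !cabs_real gtr0_norm// expr2 mulrA.
rewrite gtr0_norm// in K1 K2.
have K := lerD K1 K2; apply: (@le_trans _ _ (4 * (e / 8) * t ^+ 2 + 4 * (e / 8) * t ^+ 2)).
  apply: le_trans K; rewrite -[X in _ <= _ + X]cabsN; apply: le_trans (cabsD _ _).
  rewrite le_eqVlt; apply/orP; left; apply/eqP; congr cabs.
  have Hring (u f1 f2 f3 f4 a b : C) : u * (u * (a - b)) =
    (f1 - f2 - f3 + f4 - u * (u * b)) - (f1 - f3 - f2 + f4 - u * (u * a)) by ring.
  by rewrite [x + t *: e_ j + _]addrAC; exact: Hring.
rewrite -mulrDl mulrC ler_wpM2l ?sqr_ge0//.
by clear -e0; lra.
Qed.

End smooth_closure.

(** * Smooth and test functions *)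

Section smooth_estimates.
Context {R : realType} {d : nat}.
Local Open Scope complex_scope.
Local Notation E := 'rV[R]_d.
Local Notation C := R[i].
Local Notation e_ i := (delta_mx ord0 i : E).
Local Notation D s F := (foldr partial F s).
Implicit Types (F H : E -> C) (x : E) (i : 'I_d) (c k : C).

Lemma smooth_lip F rho : smooth F -> exists2 B, 0 <= B &
  forall x v, `|x| <= rho -> `|v| <= 1 -> cabs (F (x + v) - F x) <= B * `|v|.
Proof.
move=> sF.
have /choice[Bf Hf] : forall i, exists B, 0 <= B /\
    forall x, `|x| <= rho + 1 -> cabs (partial i F x) <= B.
  by move=> i; have [B B0 HB] := smooth_bounded (rho + 1) (smooth_partial i sF); exists B.
pose B := \sum_i Bf i.
have B0 : 0 <= B by apply: sumr_ge0 => i _; case: (Hf i).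
exists (2 * B * d%:R); first by rewrite !mulr_ge0.
move=> x v xr v1; rewrite -[_ * d%:R * _]mulrA.
apply: (@le_trans _ _ (2 * B * \sum_i `|v ord0 i|)); last first.
  by apply: ler_wpM2l; [rewrite mulr_ge0|exact: sum_coord_le].
have := @cmean_value_vec R d F (fun i => partial i F) x v (fun=> 0) B.
rewrite big1 ?subr0; last by move=> i _; rewrite mulr0.
apply=> [i z|i w wv]; first exact: smooth_cder.
rewrite subr0; have [Bi0 HBi] := Hf i; apply: le_trans (HBi _ _) _.
  by apply: le_trans (ler_normD _ _) (lerD xr (le_trans wv v1)).
by rewrite /B (bigD1 i)//= lerDl sumr_ge0// => j _; case: (Hf j).
Qed.

Lemma smooth_taylor2 F rho : smooth F -> exists2 B, 0 <= B &
  forall x v, `|x| <= rho -> `|v| <= 1 ->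
  cabs (F (x + v) - F x - \sum_i (v ord0 i)%:C * partial i F x) <= B * `|v| ^+ 2.
Proof.
move=> sF.
have /choice[Bf Hf] : forall i, exists B, 0 <= B /\
    forall x v, `|x| <= rho -> `|v| <= 1 ->
      cabs (partial i F (x + v) - partial i F x) <= B * `|v|.
  by move=> i; have [B B0 HB] := smooth_lip rho (smooth_partial i sF); exists B.
pose B := \sum_i Bf i.
have B0 : 0 <= B by apply: sumr_ge0 => i _; case: (Hf i).
exists (2 * B * d%:R); first by rewrite !mulr_ge0.
move=> x v xr v1.
have -> : 2 * B * d%:R * `|v| ^+ 2 = 2 * (B * `|v|) * (d%:R * `|v|).
  by rewrite expr2; ring.
apply: (@le_trans _ _ (2 * (B * `|v|) * \sum_i `|v ord0 i|)); last first.
  by apply: ler_wpM2l; [rewrite !mulr_ge0|exact: sum_coord_le].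
apply: (@cmean_value_vec R d F (fun i => partial i F)) => [i z|i w wv].
  exact: smooth_cder.
have [Bi0 HBi] := Hf i; apply: le_trans (HBi _ _ xr (le_trans wv v1)) _.
apply: ler_pM => //.
by rewrite /B (bigD1 i)//= lerDl sumr_ge0// => j _; case: (Hf j).
Qed.

Lemma sum_delta (t : R) i (f : 'I_d -> C) :
  \sum_j ((t *: e_ i) ord0 j)%:C * f j = t%:C * f i.
Proof.
rewrite (bigD1 i)//= !mxE !eqxx mulr1 big1 ?addr0// => j ji.
by rewrite !mxE eqxx (negbTE ji) mulr0 mul0r.
Qed.

(** Quadratic remainders pass unchanged through an integral or a distribution; this is how
    convolutions are differentiated. *)
Lemma quadratic_cder F i x c B (dl : R) : 0 < dl ->
  (forall t : R, `|t| <= dl -> cabs (F (x + t *: e_ i) - F x - t%:C * c) <= B * t ^+ 2) ->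
  cder F i x c.
Proof.
move=> dl0 H e e0.
have B1 : 0 < `|B| + 1 by rewrite ltr_wpDl.
exists (Num.min dl (e / (`|B| + 1))); first by rewrite lt_min dl0 divr_gt0.
move=> t; rewrite lt_min => /andP[t1 te].
apply: le_trans (H t (ltW t1)) _; rewrite -real_normK ?num_real// expr2 mulrA.
rewrite ler_wpM2r//; move: te; rewrite ltr_pdivlMr// => /ltW; apply: le_trans.
rewrite mulrC ler_wpM2l//; apply: le_trans (ler_norm B) _.
by rewrite lerDl.
Qed.

Lemma zero_outside_D F rho s : smooth F ->
  (forall x, rho < `|x| -> F x = 0) -> forall x, rho < `|x| -> D s F x = 0.
Proof.
move=> sF H; elim: s => //= i s IH x xr.
apply: cder_partial => e e0; exists (`|x| - rho); first by rewrite subr_gt0.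
move=> t tx; rewrite !IH//; first by rewrite mulr0 !subr0 cabs0 mulr_ge0// ltW.
have := lerB_normD x (t *: e_ i); apply: lt_le_trans.
by have := norm_delta_le t i; move: tx; lra.
Qed.

(** The working form of a support condition: in a convolution the radii simply add up. *)
Definition zero_outside (rho : R) F := forall x, rho < `|x| -> F x = 0.

Lemma compact_norm_ball (rho : R) : compact [set x : E | `|x| <= rho].
Proof.
apply: bounded_closed_compact.
  exists rho; split; first exact: num_real.
  by move=> y ry x /= /le_trans; apply; exact: ltW.
by apply: (@closed_comp _ _ (fun x : E => `|x|) [set t | t <= rho]);
  [move=> x _; exact: norm_continuous|exact: closed_le].
Qed.

Lemma compact_sub_ball (K : set E) : compact K ->
  exists2 rho, 0 <= rho & K `<=` [set x | `|x| <= rho].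
Proof.
move=> /compact_bounded[M [_ HM]]; exists (`|M| + 1); first by rewrite addr_ge0.
by move=> x Kx; apply: HM => //; rewrite (le_lt_trans (ler_norm M))// ltrDl.
Qed.

Lemma test_on_ballP rho F : test_on [set x | `|x| <= rho] F <->
  smooth F /\ zero_outside rho F.
Proof.
split=> -[sF H]; split=> //.
- move=> x xr; apply: contrapT => /eqP Fx; move: xr; apply/negP; rewrite -leNgt.
  exact/H/subset_closure.
- rewrite /tsupport (closure_id [set x : E | `|x| <= rho]).1; last first.
    by apply: compact_closed; [exact: norm_hausdorff|exact: compact_norm_ball].
  apply: closureS => x /= /eqP Fx; rewrite leNgt; apply/negP => xr.
  by apply: Fx; exact: H.
Qed.

Lemma test_on_zero_outside (K : set E) F rho : K `<=` [set x | `|x| <= rho] ->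
  test_on K F -> smooth F /\ zero_outside rho F.
Proof. by move=> Kr [sF FK]; apply/test_on_ballP; split => // x /FK /Kr. Qed.

Lemma testP F : test F <-> smooth F /\ exists2 rho, 0 <= rho & zero_outside rho F.
Proof.
split=> [[sF cF]|[sF [rho r0 Hr]]].
  have [rho r0 Kr] := compact_sub_ball cF.
  split => //; exists rho => //.
  by have [] := @test_on_zero_outside _ F _ Kr; first by split.
have [_ h] := (test_on_ballP rho F).2 (conj sF Hr).
split => //; apply: subclosed_compact h; first exact: closed_closure.
exact: compact_norm_ball.
Qed.

Lemma testD F H : test F -> test H -> test (fun x => F x + H x).
Proof.
move=> /testP[sF [r1 r10 h1]] /testP[sH [r2 r20 h2]].
apply/testP; split; first exact: (smoothD sF sH).1.
exists (Num.max r1 r2); first by rewrite le_max r10.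
by move=> x; rewrite gt_max => /andP[x1 x2]; rewrite h1// h2// addr0.
Qed.

Lemma testZ k F : test F -> test (fun x => k * F x).
Proof.
move=> /testP[sF [r1 r10 h1]]; apply/testP; split; first exact: (smoothZ k sF).1.
by exists r1 => // x x1; rewrite h1// mulr0.
Qed.

Lemma test_cst0 : test (fun _ : E => 0 : C).
Proof.
by apply/testP; split; [exact: smooth_cst|exists 0].
Qed.

Lemma test_sum (I : Type) (r : seq I) (F : I -> E -> C) :
  (forall j, test (F j)) -> test (fun y => \sum_(j <- r) F j y).
Proof.
move=> h; elim: r => [|j r IH].
  by under eq_fun do rewrite big_nil; exact: test_cst0.
by under eq_fun do rewrite big_cons; exact: (testD (h j) IH).
Qed.

Lemma test_D F s : test F -> test (D s F).
Proof.
move=> /testP[sF [r1 r10 h1]]; apply/testP; split; first exact: smooth_D.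
by exists r1 => //; exact: zero_outside_D.
Qed.

Lemma test_affine F (a : E) (t : R) : t != 0 -> test F -> test (fun y => F (a + t *: y)).
Proof.
move=> t0 /testP[sF [r1 r10 h1]]; apply/testP; split.
  exact: (smooth_affine a t sF).1.
exists ((`|a| + r1) / `|t|); first by rewrite divr_ge0// addr_ge0.
move=> x; rewrite ltr_pdivrMr ?normr_gt0// => xr; apply: h1.
have := lerB_normD (t *: x) a; rewrite normrZ (addrC a); apply: lt_le_trans.
by rewrite ltrBrDl mulrC.
Qed.

Lemma test_smooth F : test F -> smooth F.
Proof. by case. Qed.

Lemma test_bounded F : test F -> exists2 B, 0 <= B & forall x, cabs (F x) <= B.
Proof.
move=> /testP[sF [r r0 h]]; have [B B0 HB] := smooth_bounded r sF.
exists B => // x; have [xr|xr] := leP `|x| r; first exact: HB.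
by rewrite h// cabs0.
Qed.

Lemma test_lip F : test F -> exists2 B, 0 <= B &
  forall x v, `|v| <= 1 -> cabs (F (x + v) - F x) <= B * `|v|.
Proof.
move=> /testP[sF [r r0 h]]; have [B B0 HB] := smooth_lip (r + 1) sF.
exists B => // x v v1; have [xr|xr] := leP `|x| (r + 1); first exact: HB.
rewrite !h ?subrr ?cabs0 ?mulr_ge0//.
- by apply: lt_trans xr; rewrite ltrDl.
- by have := lerB_normD x v; apply: lt_le_trans; move: xr v1; lra.
Qed.

Lemma test_taylor2 F : test F -> exists2 B, 0 <= B &
  forall x v, `|v| <= 1 ->
  cabs (F (x + v) - F x - \sum_i (v ord0 i)%:C * partial i F x) <= B * `|v| ^+ 2.
Proof.
move=> /testP[sF [r r0 h]]; have [B B0 HB] := smooth_taylor2 (r + 1) sF.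
exists B => // x v v1; have [xr|xr] := leP `|x| (r + 1); first exact: HB.
have xr' : r < `|x| by apply: lt_trans xr; rewrite ltrDl.
rewrite h; last by have := lerB_normD x v; apply: lt_le_trans; move: xr v1; lra.
rewrite h// big1 ?subrr ?cabs0 ?mulr_ge0 ?sqr_ge0// => i _.
have /= -> := @zero_outside_D F r [:: i] sF h x xr'; exact: mulr0.
Qed.

Lemma complex_geo_limit (u : nat -> C) :
  exists l, forall B, (forall J, cabs (u J.+1 - u J) <= B * 2^-1 ^+ J) ->
    forall J, cabs (u J - l) <= 4 * B * 2^-1 ^+ J.
Proof.
(* If no constant is admissible the value 0 is arbitrary. The limit can thus be chosen for all words
   and points at once, before any bound is invoked. *)
have [[B HB]|nB] := pselect (exists B, forall J, cabs (u J.+1 - u J) <= B * 2^-1 ^+ J);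
  last by exists 0 => B HB; exfalso; apply: nB; exists B.
have hre B' : (forall J, cabs (u J.+1 - u J) <= B' * 2^-1 ^+ J) ->
    forall J, `|complex.Re (u J.+1) - complex.Re (u J)| <= B' * 2^-1 ^+ J.
  by move=> h J; apply: le_trans (h J); rewrite -ReN -ReD cabs_Re.
have him B' : (forall J, cabs (u J.+1 - u J) <= B' * 2^-1 ^+ J) ->
    forall J, `|complex.Im (u J.+1) - complex.Im (u J)| <= B' * 2^-1 ^+ J.
  by move=> h J; apply: le_trans (h J); rewrite -ImN -ImD cabs_Im.
have [a Ha] := real_geo_limit (hre B HB).
have [b Hb] := real_geo_limit (him B HB).
exists (a +i* b) => B' HB' J; apply: le_trans (cabs_ReIm _) _.
rewrite ReD ImD ReN ImN /=.
apply: le_trans (lerD (Ha _ (hre _ HB') J) (Hb _ (him _ HB') J)) _.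
by rewrite -mulrDl -mulrDl (_ : 2 + 2 = 4 :> R)//; rewrite -natrD.
Qed.

(** The limit [G] of the derivatives is differentiated by the mean value estimate for [f J]. The
    radius [dl] comes from the continuity of the limit [G (i :: s)] and so does not depend on [J],
    which is then sent to infinity by [le_geo]. *)
Lemma smooth_limit (f : nat -> E -> C) : (forall j, smooth (f j)) ->
  (forall s rho, exists2 B, 0 <= B & forall J x, `|x| <= rho ->
     cabs (D s (f J.+1) x - D s (f J) x) <= B * 2^-1 ^+ J) ->
  exists2 g, smooth g & forall s rho, exists2 B, 0 <= B & forall J x, `|x| <= rho ->
     cabs (D s (f J) x - D s g x) <= B * 2^-1 ^+ J.
Proof.
move=> sf fB.
have /choice[G0 HG0] : forall sx : seq 'I_d * E, exists l, forall B,
    (forall J, cabs (D sx.1 (f J.+1) sx.2 - D sx.1 (f J) sx.2) <= B * 2^-1 ^+ J) ->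
    forall J, cabs (D sx.1 (f J) sx.2 - l) <= 4 * B * 2^-1 ^+ J.
  by move=> sx; exact: complex_geo_limit.
pose G s x := G0 (s, x).
have HG s rho : exists2 B, 0 <= B & forall J x, `|x| <= rho ->
    cabs (D s (f J) x - G s x) <= B * 2^-1 ^+ J.
  have [B B0 HB] := fB s rho; exists (4 * B); first by rewrite mulr_ge0.
  by move=> J x xr; apply: (HG0 (s, x)) => J'; exact: HB.
have cG s : ccont (G s).
  move=> x e e0; have [B B0 HB] := HG s (`|x| + 1).
  have e40 : 0 < e / 4 by rewrite divr_gt0.
  have [J HJ] := geo_small B e40.
  have [dl dl0 Hd] := smooth_ccont (smooth_D s (sf J)) x (divr_gt0 e0 (ltr0n R 2)).
  exists (Num.min dl 1); first by rewrite lt_min dl0 ltr01.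
  move=> v; rewrite lt_min => /andP[vd v1].
  have xv : `|x + v| <= `|x| + 1 by apply: le_trans (ler_normD _ _) _; rewrite lerD2l ltW.
  have xx : `|x| <= `|x| + 1 by rewrite lerDl.
  have h1 := le_trans (HB J _ xv) (HJ J (leqnn J)).
  have h2 := le_trans (HB J _ xx) (HJ J (leqnn J)).
  have h3 := Hd _ vd.
  have -> : G s (x + v) - G s x = - (D s (f J) (x + v) - G s (x + v)) +
      ((D s (f J) (x + v) - D s (f J) x) + (D s (f J) x - G s x)).
    have Hr (a b p q : C) : a - b = - (p - a) + ((p - q) + (q - b)) by ring.
    exact: Hr.
  apply: le_trans (cabsD _ _) _; rewrite cabsN.
  apply: le_trans (lerD h1 (le_trans (cabsD _ _) (lerD h3 h2))) _.
  by clear; lra.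
have dG s i x : cder (G s) i x (G (i :: s) x).
  move=> e e0; have e40 : 0 < e / 4 by rewrite divr_gt0.
  have [dl dl0 Hd] := cG (i :: s) x _ e40.
  exists (Num.min dl 1); first by rewrite lt_min dl0 ltr01.
  move=> t; rewrite lt_min => /andP[td t1].
  have [B B0 HB] := HG s (`|x| + 1).
  have [B' B'0 HB'] := HG (i :: s) (`|x| + 1).
  have xu u : `|u| <= `|t| -> `|x + u *: e_ i| <= `|x| + 1.
    move=> ut; apply: le_trans (ler_normD _ _) _; rewrite lerD2l.
    by apply: le_trans (norm_delta_le _ _) (le_trans ut (ltW t1)).
  apply: (@le_geo _ _ _ (2 * B + 2 * B')) => J.
  have xx : `|x| <= `|x| + 1 by rewrite lerDl.
  have h1 := HB J _ (xu t (lexx _)).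
  have h2 := HB J _ xx.
  have h3 : cabs (D s (f J) (x + t *: e_ i) - D s (f J) x - t%:C * G (i :: s) x) <=
      2 * (B' * 2^-1 ^+ J + e / 4) * `|t|.
    apply: (cmean_value (F' := D (i :: s) (f J))) => u ut.
      exact/smooth_cder/smooth_D.
    have Hr (a b c : C) : a - b = (a - c) + (c - b) by ring.
    rewrite (Hr _ _ (G (i :: s) (x + u *: e_ i))).
    apply: le_trans (cabsD _ _) (lerD (HB' J _ (xu _ ut)) _).
    by apply: Hd; apply: le_lt_trans (norm_delta_le _ _) (le_lt_trans ut td).
  have -> : G s (x + t *: e_ i) - G s x - t%:C * G (i :: s) x =
     - (D s (f J) (x + t *: e_ i) - G s (x + t *: e_ i)) +
     ((D s (f J) x - G s x) +
      (D s (f J) (x + t *: e_ i) - D s (f J) x - t%:C * G (i :: s) x)).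
    have Hr (a b k p q : C) : a - b - k = - (p - a) + ((q - b) + (p - q - k)) by ring.
    exact: Hr.
  apply: le_trans (cabsD _ _) _; rewrite cabsN.
  apply: le_trans (lerD h1 (le_trans (cabsD _ _) (lerD h2 h3))) _.
  have : 2 * B' * 2^-1 ^+ J * `|t| <= 2 * B' * 2^-1 ^+ J.
    by apply: ler_piMr; [rewrite !mulr_ge0// ltW// geo_gt0|exact: ltW].
  have : 0 <= e * `|t| by rewrite mulr_ge0// ltW.
  rewrite [2 * (_ + _) * `|t|](_ : _ = 2 * B' * 2^-1 ^+ J * `|t| + e * `|t| / 2);
    last by field.
  by set q := 2^-1 ^+ J; clear; move=> *; lra.
have [sG DG] := smooth_intro cG dG.
by exists (G [::]) => // s rho; rewrite DG; exact: HG.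
Qed.

Lemma D_partial F i s : smooth F -> D s (partial i F) = partial i (D s F).
Proof.
move=> sF; elim: s => [//|j s /= ->]; exact: (partialC j i (smooth_D s sF)).
Qed.

Lemma D_swap F s1 s2 : smooth F -> D (s1 ++ s2) F = D (s2 ++ s1) F.
Proof.
move=> sF; elim: s1 s2 => [|i s1 IH] s2; first by rewrite cats0.
rewrite /= IH -D_partial; last exact: sF.
rewrite [RHS]foldr_cat /= -(D_partial i s1 sF) -foldr_cat.
by [].
Qed.

Lemma D_perm F s1 s2 : smooth F -> perm_eq s1 s2 -> D s1 F = D s2 F.
Proof.
move=> sF s12; apply/esym.
apply: (catCA_perm_ind (P := fun s => D s F = D s1 F) _ s12 erefl) => a b c.
by rewrite !catA ![foldr _ _ (_ ++ c)]foldr_cat D_swap//; exact: smooth_D.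
Qed.

(** Multi-indices appear only in the statement; the proof works with words. Since partial
    derivatives commute, a word matters only through its letter counts, and [mseq] is the sorted
    word with given counts. *)
Definition mseq (a : 'I_d -> nat) : seq 'I_d :=
  flatten [seq nseq (a i) i | i <- enum 'I_d].

Lemma mpartialE a F : mpartial a F = D (mseq a) F.
Proof.
rewrite /mpartial /mseq; elim: (enum 'I_d) => //= i s ->.
by rewrite foldr_cat; elim: (a i) => //= n ->.
Qed.

Lemma size_mseq a : size (mseq a) = morder a.
Proof.
rewrite /mseq size_flatten /shape -map_comp sumnE big_map /morder big_enum/=.
by apply: eq_bigr => i _; rewrite size_nseq.
Qed.

Lemma perm_mseq s : perm_eq s (mseq (fun i => count_mem i s)).
Proof.
apply/allP => i _; rewrite /= count_flatten -map_comp sumnE big_map big_enum/=.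
rewrite (bigD1 i)//= count_nseq /= eqxx mul1n big1 ?addn0// => j ji.
by rewrite count_nseq /= (negbTE ji) mul0n.
Qed.

End smooth_estimates.

(** * Lebesgue measure on row vectors *)

Section borel_rV.
Context {R : realType} {n : nat}.
Local Notation E := 'rV[R]_n.

Lemma measurable_coordR (i : 'I_n) :
  measurable_fun [set: E] (fun v : E => v ord0 i).
Proof. exact: measurable_coord_rV. Qed.

Lemma measurable_box (a : E) (r : R) :
  measurable [set v : E | forall i, `|v ord0 i - a ord0 i| < r].
Proof.
have -> : [set v : E | forall i, `|v ord0 i - a ord0 i| < r] =
    \bigcap_(i in [set: 'I_n]) ((fun v : E => v ord0 i) @^-1`
      [set` `]a ord0 i - r, a ord0 i + r[%R]).
  apply/seteqP; split => v H i.
    by move=> _; rewrite /= in_itv/= -ltr_distl; exact: H.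
  by have := H i I; rewrite /= in_itv/= -ltr_distl.
apply: fin_bigcap_measurable => // i _; rewrite -[X in measurable X]setTI.
by apply: measurable_coordR => //; exact: measurable_itv.
Qed.

(** An open set is the union of the rational boxes it contains, and these are countably many. This
    ties the sigma-algebra of the coordinates to the topology. *)
Lemma open_measurable_rV (U : set E) : open U -> measurable U.
Proof.
move=> oU.
pose B (p : 'rV[rat]_n * nat) :=
  [set v : E | forall i, `|v ord0 i - ratr (p.1 ord0 i)| < p.2.+1%:R^-1].
have -> : U = \bigcup_(p in [set: 'rV[rat]_n * nat])
    (if `[< B p `<=` U >] then B p else set0).
  apply/seteqP; split => [x Ux|x [p _]]; last first.
    by case: asboolP => [|//]; exact.
  have := oU; rewrite openE => /(_ x Ux); rewrite /interior -nbhs_nbhs_norm.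
  move=> [e /= e0 He].
  have [m Hm] : exists m, 2 * m.+1%:R^-1 < e.
    exists (Num.bound (2 / e)); rewrite ltr_pdivrMr ?ltr0n// mulrC -ltr_pdivrMr//.
    apply: lt_trans (archi_boundP _) _; first by rewrite divr_ge0 ?ltW.
    by rewrite ltr_nat.
  have m0 : 0 < (m.+1%:R^-1 : R) by rewrite invr_gt0 ltr0n.
  have /choice[q Hq] : forall i, exists q : rat, `|x ord0 i - ratr q| < m.+1%:R^-1.
    move=> i; have [|q] := @rat_in_itvoo R (x ord0 i - m.+1%:R^-1) (x ord0 i + m.+1%:R^-1).
      by rewrite ltrBlDr -addrA ltrDl addr_gt0.
    by rewrite in_itv/= -ltr_distl distrC => qx; exists q.
  exists (\row_i q i, m) => //.
  have Bx : B (\row_i q i, m) x by move=> i /=; rewrite mxE.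
  rewrite asboolT// => y By; apply: He => /=.
  apply: le_lt_trans Hm; apply: norm_le_coord => [|i].
    by rewrite mulr_ge0// ltW.
  rewrite !mxE mulr_natl mulr2n -(subrKA (ratr (q i))).
  apply: le_trans (ler_normD _ _) (lerD (ltW (Hq i)) _).
  by have := By i; rewrite /= mxE distrC => /ltW.
apply: countable_bigcupT_measurable => [|p]; first exact: countableP.
case: ifP => _ //.
rewrite (_ : B p = [set v : E | forall i, `|v ord0 i - (\row_j ratr (p.1 ord0 j)) ord0 i|
    < p.2.+1%:R^-1]); first exact: measurable_box.
by apply/seteqP; split => v H i; have := H i; rewrite mxE.
Qed.

Lemma continuous_measurable_rV (h : E -> R) : continuous h ->
  measurable_fun [set: E] h.
Proof.
move=> /continuousP ch; apply: (measurability _ (RGenOpens.measurableE R)).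
move=> _ [_ [a [b ->] <-]]; rewrite setTI; apply: open_measurable_rV.
exact/ch/interval_open.
Qed.

End borel_rV.

Section lebesgue_rV_theory.
Local Open Scope ereal_scope.
Context {R : realType}.
Local Notation lambda := (@lebesgue_measure R).

(** By uniqueness of Lebesgue measure: [|c|] times its image under the affine map agrees with it on
    half-open intervals, hence everywhere. *)
Lemma ge0_integral_affine1 (a c : R) (F : R -> \bar R) : c != 0%R ->
  measurable_fun [set: R] F -> (forall t, 0 <= F t) ->
  \int[lambda]_t F (a + c * t)%R = (`|c|^-1)%:E * \int[lambda]_t F t.
Proof.
move=> c0 mF F0.
have nc0 : (0 < `|c|)%R by rewrite normr_gt0.
pose phi : measurableTypeR R -> measurableTypeR R := fun t : R => (a + c * t)%R.
have mphi : measurable_fun setT phi.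
  apply: (@continuous_measurable_fun R) => t.
  by apply: cvgD; [exact: cvg_cst|exact: mulrl_continuous].
pose nu : {measure set measurableTypeR R -> \bar R} :=
  mscale (NngNum (ltW nc0)) (measure_function_pushforward__canonical__measure_function_Measure lambda mphi).
have nuE : forall A, measurable A -> lambda A = nu A.
  apply: lebesgue_measure_unique => _ [[x y] _ <-].
  rewrite [RHS](_ : _ = `|c|%:E * lambda (phi @^-1` `]x, y]%classic))//.
  have [xy|xy] := ltP x y; last first.
    by rewrite set_itv_ge ?bnd_simp -?leNgt// preimage_set0 !measure0 mule0.
  have [cp|cn] := ltP 0%R c.
    have -> : phi @^-1` `]x, y]%classic = `]((x - a) / c)%R, ((y - a) / c)%R]%classic.
      apply/seteqP; split=> t; rewrite /= /phi !in_itv/= ltr_pdivrMr// ler_pdivlMr//.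
        by rewrite ltrBlDl lerBrDl (mulrC t).
      by rewrite ltrBlDl lerBrDl (mulrC t).
    rewrite !lebesgue_measure_itv/= !lte_fin xy ltr_pM2r ?invr_gt0// ltrD2r xy.
    rewrite gtr0_norm// -!EFinB -EFinM; congr EFin.
    by field; rewrite gt_eqF.
  have {}cn : (c < 0)%R by rewrite lt_neqAle c0.
  (* A negative [c] swaps the open and the closed end; the length is unaffected. *)
  have -> : phi @^-1` `]x, y]%classic = `[((y - a) / c)%R, ((x - a) / c)%R[%classic.
    apply/seteqP; split=> t; rewrite /= /phi !in_itv/= ltr_ndivlMr// ler_ndivrMr//.
      by rewrite ltrBlDl lerBrDl (mulrC t) andbC.
    by rewrite ltrBlDl lerBrDl (mulrC t) andbC.
  rewrite !lebesgue_measure_itv/= !lte_fin xy ltr_nM2r ?invr_lt0// ltrD2r xy.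
  rewrite ltr0_norm// -!EFinB -EFinM; congr EFin.
  by field; rewrite lt_eqF.
have push A : measurable A -> pushforward lambda phi A = (`|c|^-1)%:E * lambda A.
  move=> mA; rewrite nuE// /nu /mscale/= muleA -EFinM mulVf ?gt_eqF//.
  by rewrite mul1e.
have := ge0_integral_pushforward mphi lambda measurableT mF (fun t _ => F0 t).
rewrite preimage_setT => <-.
have cV0 : (0 <= `|c|^-1)%R by rewrite invr_ge0.
rewrite -(@ge0_integral_mscale _ _ _ lambda _ measurableT (NngNum cV0))//.
by apply: eq_measure_integral => A mA _; exact: push.
Qed.

Lemma integral_rV_succ n (F : 'rV[R]_n.+1 -> \bar R) :
  measurable_fun setT F -> (forall x, 0 <= F x) ->
  \int[lebesgue_rV R n.+1]_x F x =
  \int[lambda]_t \int[lebesgue_rV R n]_v F (rV_cons (t, v)).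
Proof.
move=> mF F0.
have mFc : measurable_fun setT (F \o @rV_cons R n).
  exact: (measurableT_comp mF measurable_rV_cons).
rewrite -(@fubini_tonelli1 _ _ _ _ _ lambda (lebesgue_rV R n) (F \o @rV_cons R n))//;
  last by move=> x; exact: F0.
have := ge0_integral_pushforward (@measurable_rV_cons R n)
  (lambda \x lebesgue_rV R n) measurableT mF (fun t _ => F0 t).
by rewrite preimage_setT => <-; apply: eq_measure_integral; first exact: measurable_rV_cons.
Qed.

Lemma rV_cons_affine n (a : 'rV[R]_n.+1) (c t : R) v :
  (a + c *: rV_cons (t, v) =
   rV_cons (a ord0 ord0 + c * t, (\row_j a ord0 (lift ord0 j)) + c *: v))%R.
Proof.
apply/rowP => i; rewrite /rV_cons !mxE; case: (unliftP ord0 i) => [j ->|->];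
  by rewrite ?liftK ?unlift_none ?mxE.
Qed.

Lemma measurable_affine_rV n (a : 'rV[R]_n) (c : R) :
  measurable_fun [set: 'rV[R]_n] (fun v : 'rV[R]_n => a + c *: v)%R.
Proof.
apply: measurable_fun_rV => i; under eq_fun do rewrite !mxE.
apply: measurable_funD => //.
by apply: measurable_funM => //; exact: measurable_coordR.
Qed.

Lemma ge0_integral_affine n (a : 'rV[R]_n) (c : R) (F : 'rV[R]_n -> \bar R) :
  c != 0%R -> measurable_fun setT F -> (forall x, 0 <= F x) ->
  \int[lebesgue_rV R n]_x F (a + c *: x)%R =
  ((`|c| ^- n)%R)%:E * \int[lebesgue_rV R n]_x F x.
Proof.
move=> c0; elim: n a F => [|n IH] a F mF F0.
  rewrite expr0 invr1 mul1e; apply: eq_integral => x _; congr F.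
  by apply/rowP => -[].
have mc := measurableT_comp mF (@measurable_rV_cons R n).
rewrite integral_rV_succ//; last first.
  exact: (measurableT_comp mF (measurable_affine_rV a c)).
under eq_integral do under eq_integral do rewrite rV_cons_affine.
have mF1 t : measurable_fun setT (fun v => F (rV_cons (t, v))).
  exact: (measurableT_comp mc (pair1_measurable _)).
under eq_integral do rewrite (IH (\row_j a ord0 (lift ord0 j)) (fun v =>
  F (rV_cons (a ord0 ord0 + c * _, v)%R)) (mF1 _) (fun=> F0 _)).
have mG : measurable_fun [set: R]
    (fun t => \int[lebesgue_rV R n]_v F (rV_cons (t, v))).
  by apply: (measurable_fun_fubini_tonelli_F (F \o @rV_cons R n)) => // x; exact: F0.
have G0 t : 0 <= \int[lebesgue_rV R n]_v F (rV_cons (t, v)).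
  by apply: integral_ge0 => v _; exact: F0.
have k0 : (0 <= `|c| ^- n)%R by rewrite invr_ge0 exprn_ge0.
rewrite (ge0_integral_affine1 (a ord0 ord0) c0 (F := fun t => (`|c| ^- n)%:E *
  \int[lebesgue_rV R n]_v F (rV_cons (t, v)))); first last.
- by move=> t; rewrite mule_ge0.
- exact: emeasurable_funM.
rewrite ge0_integralZl_EFin// -integral_rV_succ// muleA -EFinM.
by rewrite -invfM exprS.
Qed.

Lemma measurable_ball_rV n (rho : R) :
  measurable [set v : 'rV[R]_n | (`|v| <= rho)%R].
Proof.
rewrite (_ : [set v : 'rV[R]_n | (`|v| <= rho)%R] =
  (fun v : 'rV[R]_n => `|v|%R) @^-1` `]-oo, rho]%classic); last first.
  by apply/seteqP; split => v /=; rewrite in_itv.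
rewrite -[X in measurable X]setTI.
apply: continuous_measurable_rV => //; exact: norm_continuous.
Qed.

(** The norm is the sup norm, so the ball is a cube of side [2 rho]. *)
Lemma lebesgue_rV_ball n (rho : R) : (0 <= rho)%R ->
  lebesgue_rV R n [set v : 'rV[R]_n | (`|v| <= rho)%R] = ((2 * rho) ^+ n)%:E.
Proof.
move=> r0; elim: n => [|n IH].
  rewrite /= diracE mem_set//=; last by rewrite normr0.
rewrite /= /lebesgue_rV_succ.
have -> : rV_cons @^-1` [set v : 'rV[R]_n.+1 | (`|v| <= rho)%R] =
    `[(- rho)%R, rho]%classic `*` [set v : 'rV[R]_n | (`|v| <= rho)%R].
  apply/seteqP; split => -[t v] /=; rewrite in_itv/= -ler_norml.
    move=> H; split.
      have := le_trans (coord_le_norm _ ord0) H.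
      by rewrite /rV_cons mxE unlift_none.
    apply: norm_le_coord => // i.
    have := le_trans (coord_le_norm _ (lift ord0 i)) H.
    by rewrite /rV_cons mxE liftK.
  move=> [tr vr]; apply: norm_le_coord => // i; rewrite /rV_cons mxE.
  case: (unliftP ord0 i) => [j _|_]//=.
  exact: le_trans (coord_le_norm _ _) vr.
rewrite product_measure1E//; last exact: measurable_ball_rV.
rewrite IH -[X in X * _]/(lambda (`[(- rho)%R, rho]%classic : set R)).
rewrite lebesgue_measure_itv/= lte_fin.
case: ltP => h; last first.
  have -> : rho = 0%R by move: r0 h; lra.
  by rewrite mul0e mulr0 expr0n.
by rewrite -EFinB -EFinM exprS; congr ((_ * _)%:E); ring.
Qed.

End lebesgue_rV_theory.

(** * Integrals of complex functions *)

Section complex_integral.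
Context {R : realType} {d : nat}.
Local Open Scope complex_scope.
Local Notation E := 'rV[R]_d.
Local Notation C := R[i].
Local Notation re := (@complex.Re R).
Local Notation im := (@complex.Im R).
Local Notation mu := (lebesgue_rV R d).
Implicit Types (f g h : E -> C) (c k : C).

Definition cmeas f := measurable_fun setT (fun x => re (f x)) /\
  measurable_fun setT (fun x => im (f x)).

Lemma ccont_cmeas f : ccont f -> cmeas f.
Proof. by move=> /ccontP[? ?]; split; exact: continuous_measurable_rV. Qed.

Lemma cmeas_cst c : cmeas (fun=> c).
Proof. by split; exact: measurable_cst. Qed.

Lemma cmeasD f g : cmeas f -> cmeas g -> cmeas (fun x => f x + g x).
Proof.
move=> [f1 f2] [g1 g2]; split.
- by under eq_fun do rewrite ReD; exact: measurable_funD.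
- by under eq_fun do rewrite ImD; exact: measurable_funD.
Qed.

Lemma cmeasM f g : cmeas f -> cmeas g -> cmeas (fun x => f x * g x).
Proof.
move=> [f1 f2] [g1 g2]; split.
- under eq_fun do rewrite ReM.
  by apply: measurable_funB; exact: measurable_funM.
- under eq_fun do rewrite ImM.
  by apply: measurable_funD; exact: measurable_funM.
Qed.

Lemma cmeas_comp f (T : E -> E) : measurable_fun setT T -> cmeas f ->
  cmeas (fun x => f (T x)).
Proof.
by move=> mT [f1 f2]; split;
  [exact: (measurableT_comp f1 mT)|exact: (measurableT_comp f2 mT)].
Qed.

Lemma cmeas_cabs f : cmeas f -> measurable_fun setT (fun x => cabs (f x)).
Proof.
move=> [f1 f2].
rewrite (_ : (fun x => _) = (fun x => Num.sqrt (re (f x) ^+ 2 + im (f x) ^+ 2)));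
  last by apply/funext => x; rewrite /cabs; case: (f x).
apply: (@measurableT_comp _ _ _ _ _ _ (@Num.sqrt R)).
  by apply: continuous_measurable_fun; exact: sqrt_continuous.
by apply: measurable_funD; exact: measurable_funX.
Qed.

Definition cintegrable f := mu.-integrable setT (fun x => (re (f x))%:E) /\
  mu.-integrable setT (fun x => (im (f x))%:E).

Lemma cintegralD f g : cintegrable f -> cintegrable g ->
  cintegral (fun x => f x + g x) = cintegral f + cintegral g.
Proof.
move=> [f1 f2] [g1 g2]; rewrite /cintegral.
under eq_Rintegral do rewrite ReD.
under [X in _ +i* X]eq_Rintegral do rewrite ImD.
by rewrite !RintegralD.
Qed.

Lemma cintegrableD f g : cintegrable f -> cintegrable g ->
  cintegrable (fun x => f x + g x).
Proof.
move=> [f1 f2] [g1 g2]; split.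
- by under eq_fun do rewrite ReD EFinD; exact: (integrableD _ f1 g1).
- by under eq_fun do rewrite ImD EFinD; exact: (integrableD _ f2 g2).
Qed.

Lemma cintegralZ c f : cintegrable f ->
  cintegral (fun x => c * f x) = c * cintegral f.
Proof.
move=> [f1 f2]; rewrite /cintegral; apply/eqP; rewrite eq_complex /= ReM ImM /=.
have Z1 (k : R) : mu.-integrable setT (fun x => (k * re (f x))%:E).
  by under eq_fun do rewrite EFinM; exact: integrableZl.
have Z2 (k : R) : mu.-integrable setT (fun x => (k * im (f x))%:E).
  by under eq_fun do rewrite EFinM; exact: integrableZl.
have e1 : \int[mu]_x re (c * f x) =
    re c * (\int[mu]_x re (f x)) - im c * (\int[mu]_x im (f x)).
  by under eq_Rintegral do rewrite ReM; rewrite (RintegralB measurableT (Z1 _) (Z2 _)) (RintegralZl _ measurableT f1) (RintegralZl _ measurableT f2).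
have e2 : \int[mu]_x im (c * f x) =
    re c * (\int[mu]_x im (f x)) + im c * (\int[mu]_x re (f x)).
  by under eq_Rintegral do rewrite ImM; rewrite (RintegralD measurableT (Z2 _) (Z1 _)) (RintegralZl _ measurableT f1) (RintegralZl _ measurableT f2).
by rewrite e1 e2 !eqxx.
Qed.

Lemma cintegrableZ c f : cintegrable f -> cintegrable (fun x => c * f x).
Proof.
move=> [f1 f2].
have Z1 (k : R) : mu.-integrable setT (fun x => (k * re (f x))%:E).
  by under eq_fun do rewrite EFinM; exact: integrableZl.
have Z2 (k : R) : mu.-integrable setT (fun x => (k * im (f x))%:E).
  by under eq_fun do rewrite EFinM; exact: integrableZl.
split.
- by under eq_fun do rewrite ReM EFinB; exact: (integrableB _ (Z1 _) (Z2 _)).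
- by under eq_fun do rewrite ImM EFinD; exact: (integrableD _ (Z2 _) (Z1 _)).
Qed.

Lemma cintegral0 : cintegral (fun _ : E => 0) = 0.
Proof. by rewrite /cintegral !Rintegral_cst//= !mul0r. Qed.

Lemma cintegrable0 : cintegrable (fun _ : E => 0).
Proof. by split => /=; exact: integrable0. Qed.

Lemma cintegral_sum (I : Type) (r : seq I) (F : I -> E -> C) :
  (forall j, cintegrable (F j)) ->
  cintegral (fun x => \sum_(j <- r) F j x) = \sum_(j <- r) cintegral (F j) /\
  cintegrable (fun x => \sum_(j <- r) F j x).
Proof.
move=> h; elim: r => [|j r [IH1 IH2]].
  under eq_fun do rewrite big_nil; rewrite big_nil cintegral0; split => //.
  exact: cintegrable0.
under eq_fun do rewrite big_cons; rewrite big_cons cintegralD// IH1; split => //.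
exact: cintegrableD.
Qed.

(** The two parts are bounded separately; the factor 2 spares a rotation of the integral onto the
    real axis. *)
Lemma cabs_cintegral f : cintegrable f -> cmeas f ->
  ((cabs (cintegral f))%:E <= 2%:E * \int[mu]_x (cabs (f x))%:E)%E.
Proof.
move=> [f1 f2] mf.
have mc : measurable_fun setT (fun x => (cabs (f x))%:E).
  by apply/measurable_EFinP; exact: cmeas_cabs.
have key (p : E -> R) : mu.-integrable setT (fun x => (p x)%:E) ->
    (forall x, `|p x| <= cabs (f x)) ->
    (`|\int[mu]_x p x|%:E <= \int[mu]_x (cabs (f x))%:E)%E.
  move=> ip pc; rewrite EFin_normr_Rintegral//.
  apply: le_trans (le_abse_integral _ _ _) _ => //; first by case/integrableP: ip.
  apply: ge0_le_integral => //.
    by apply: measurableT_comp => //; case/integrableP: ip.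
  by move=> x _; rewrite lee_fin.
have h1 := key _ f1 (fun x => cabs_Re (f x)).
have h2 := key _ f2 (fun x => cabs_Im (f x)).
rewrite -[2%:E]/((1 + 1)%:E) EFinD ge0_muleDl// !mul1e.
apply: le_trans (leeD h1 h2); rewrite -EFinD lee_fin.
exact: cabs_ReIm.
Qed.

(* Bounded, measurable, of bounded support. *)
Definition bms h := cmeas h /\ exists B rho, [/\ 0 <= B, 0 <= rho,
  forall x, cabs (h x) <= B & zero_outside rho h].

(* Locally bounded and measurable. *)
Definition lbm g := cmeas g /\
  forall rho, exists2 B, 0 <= B & forall x, `|x| <= rho -> cabs (g x) <= B.

Lemma bounded_ball_integrable (p : E -> R) B rho : 0 <= B ->
  measurable_fun setT p -> (forall x, `|p x| <= B) ->
  (forall x, rho < `|x| -> p x = 0) -> mu.-integrable setT (fun x => (p x)%:E).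
Proof.
move=> B0 mp pB p0; pose Q := [set x : E | `|x| <= `|rho|].
have mQ : measurable Q by exact: measurable_ball_rV.
have iQ : mu.-integrable Q (EFin \o p).
  apply: measurable_bounded_integrable => //.
  - have muQ : (mu Q < +oo)%E by rewrite lebesgue_rV_ball ?ltry.
    exact: muQ.
  - exact: measurable_funTS.
  - exists B; split; first exact: num_real.
    by move=> M BM x _; apply: le_trans (pB x) (ltW BM).
have /integrable_mkcond := iQ; move=> /(_ mQ).
rewrite (_ : (EFin \o p) \_ Q = (fun x => (p x)%:E))//.
apply/funext => x; rewrite patchE; case: ifPn => // /negP xQ.
rewrite p0//; apply: le_lt_trans (ler_norm rho) _.
by rewrite ltNge; apply/negP => h; apply: xQ; rewrite inE.
Qed.

Lemma bms_cintegrable h : bms h -> cintegrable h.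
Proof.
move=> [[m1 m2] [B [rho [B0 r0 hB h0]]]]; split.
- apply: (bounded_ball_integrable (rho := rho) B0 m1) => [x|x xr].
    exact: le_trans (cabs_Re _) (hB x).
  by rewrite h0.
- apply: (bounded_ball_integrable (rho := rho) B0 m2) => [x|x xr].
    exact: le_trans (cabs_Im _) (hB x).
  by rewrite h0.
Qed.

Lemma smooth_lbm g : smooth g -> lbm g.
Proof.
move=> sg; split; first exact/ccont_cmeas/smooth_ccont.
by move=> rho; exact: smooth_bounded.
Qed.

Lemma test_bms g : test g -> bms g.
Proof.
move=> tg; have [B B0 HB] := test_bounded tg.
move/testP : tg => [sg [rho r0 Hr]]; split; first exact/ccont_cmeas/smooth_ccont.
by exists B, rho.
Qed.

Lemma bmsM h g : bms h -> lbm g -> bms (fun x => h x * g x).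
Proof.
move=> [mh [B [rho [B0 r0 hB h0]]]] [mg gB]; split; first exact: cmeasM.
have [B' B'0 HB'] := gB rho; exists (B * B'), rho; split => //.
- exact: mulr_ge0.
- move=> x; have [xr|xr] := leP `|x| rho.
    by rewrite cabsM; apply: ler_pM; rewrite ?cabs_ge0// HB'.
  by rewrite h0// mul0r cabs0 mulr_ge0.
- by move=> x xr; rewrite h0// mul0r.
Qed.

Lemma bmsZ c h : bms h -> bms (fun x => c * h x).
Proof.
move=> [mh [B [rho [B0 r0 hB h0]]]]; split.
  by apply: cmeasM => //; exact: cmeas_cst.
exists (cabs c * B), rho; split => //.
- by rewrite mulr_ge0// cabs_ge0.
- by move=> x; rewrite cabsM ler_wpM2l// cabs_ge0.
- by move=> x xr; rewrite h0// mulr0.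
Qed.

Lemma lbm_affine g (a : E) (t : R) : lbm g -> lbm (fun y => g (a + t *: y)).
Proof.
move=> [mg gB]; split; first exact: (cmeas_comp (measurable_affine_rV a t) mg).
move=> rho; have [B B0 HB] := gB (`|a| + `|t| * rho); exists B => // x xr.
apply: HB; apply: le_trans (ler_normD _ _) _; rewrite lerD2l normrZ.
by rewrite ler_wpM2l.
Qed.

Lemma bms_affine h (a : E) (t : R) : t != 0 -> bms h -> bms (fun y => h (a + t *: y)).
Proof.
move=> t0 [mh [B [rho [B0 r0 hB h0]]]]; split.
  exact: (cmeas_comp (measurable_affine_rV a t) mh).
exists B, ((`|a| + rho) / `|t|); split => //.
  by rewrite divr_ge0// addr_ge0.
move=> x; rewrite ltr_pdivrMr ?normr_gt0// => xr; apply: h0.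
have := lerB_normD (t *: x) a; rewrite normrZ (addrC a); apply: lt_le_trans.
by rewrite ltrBrDl mulrC.
Qed.

Lemma bms_lbm h : bms h -> lbm h.
Proof. by move=> [mh [B [rho [B0 _ hB _]]]]; split => // r; exists B. Qed.

Lemma cabs_cintegral_ball h B rho : 0 <= B -> 0 <= rho -> cmeas h ->
  (forall x, cabs (h x) <= B) -> zero_outside rho h ->
  cabs (cintegral h) <= 2 * B * (2 * rho) ^+ d.
Proof.
move=> B0 r0 mh hB h0.
have bh : bms h by split => //; exists B, rho.
rewrite -lee_fin; apply: le_trans (cabs_cintegral (bms_cintegrable bh) mh) _.
rewrite -mulrA [leRHS]EFinM; apply: lee_wpmul2l; first by rewrite lee_fin.
rewrite EFinM -lebesgue_rV_ball//.
have mQ : measurable [set x : E | `|x| <= rho] by exact: measurable_ball_rV.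
rewrite -(integral_cst mu mQ).
rewrite [X in (_ <= X)%E]integral_mkcond; apply: ge0_le_integral => //.
- by move=> x _; rewrite lee_fin cabs_ge0.
- by apply/measurable_EFinP; exact: cmeas_cabs.
- by apply/(measurable_restrictT _ mQ); exact: measurable_cst.
move=> x _; rewrite patchE; case: ifPn => [_|/negP xQ]; first by rewrite lee_fin.
rewrite h0 ?cabs0// ltNge; apply/negP => h1; apply: xQ.
by rewrite inE.
Qed.

Lemma Rintegral_affine (p : E -> R) (a : E) (c : R) : c != 0 ->
  mu.-integrable setT (fun x => (p x)%:E) ->
  \int[mu]_x p (a + c *: x) = `|c| ^- d * \int[mu]_x p x.
Proof.
move=> c0 ip; rewrite /Rintegral.
have [mp _] := integrableP _ _ _ ip.
pose P (x : E) := (p x)%:E.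
have e1 : (\int[mu]_x P^\+ (a + c *: x)%R = (`|c| ^- d)%:E * \int[mu]_x P^\+ x)%E.
  by apply: ge0_integral_affine => //; exact: measurable_funepos.
have e2 : (\int[mu]_x P^\- (a + c *: x)%R = (`|c| ^- d)%:E * \int[mu]_x P^\- x)%E.
  by apply: ge0_integral_affine => //; exact: measurable_funeneg.
have f1 : (\int[mu]_x P^\+ x)%E \is a fin_num := integrable_pos_fin_num measurableT ip.
have f2 : (\int[mu]_x P^\- x)%E \is a fin_num := integrable_neg_fin_num measurableT ip.
have -> : (\int[mu]_x (p (a + c *: x))%:E =
    \int[mu]_x P^\+ (a + c *: x)%R - \int[mu]_x P^\- (a + c *: x)%R)%E.
  by rewrite [LHS]integralE; congr (_ - _)%E; apply: eq_integral => x _; rewrite ?funeposE ?funenegE.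
have -> : (\int[mu]_x (p x)%:E = \int[mu]_x P^\+ x - \int[mu]_x P^\- x)%E.
  by rewrite [LHS]integralE; congr (_ - _)%E; apply: eq_integral => x _; rewrite ?funeposE ?funenegE.
rewrite e1 e2 -(fineK f1) -(fineK f2) -!EFinM -!EFinB /=.
by rewrite mulrBr.
Qed.

Lemma cintegral_affine f (a : E) (c : R) : c != 0 -> cintegrable f ->
  cintegral (fun x => f (a + c *: x)) = (`|c| ^- d)%:C * cintegral f.
Proof.
move=> c0 [f1 f2]; rewrite /cintegral (Rintegral_affine a c0 f1).
rewrite (Rintegral_affine a c0 f2).
by apply/eqP; rewrite eq_complex /= !mul0r subr0 addr0 !eqxx.
Qed.

Lemma cintegral_reflect f (a : E) : cintegrable f ->
  cintegral (fun x => f (a - x)) = cintegral f.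
Proof.
move=> fi; have := @cintegral_affine f a (-1).
rewrite oppr_eq0 oner_eq0 => /(_ isT fi).
rewrite normrN normr1 expr1n invr1 mul1r => <-.
by congr cintegral; apply/funext => x; rewrite scaleN1r.
Qed.

End complex_integral.

(** * Convolution and dilation *)

Section convolution.
Context {R : realType} {d : nat}.
Local Open Scope complex_scope.
Local Notation E := 'rV[R]_d.
Local Notation C := R[i].
Local Notation e_ i := (delta_mx ord0 i : E).
Local Notation D s F := (foldr partial F s).
Implicit Types (f g h : E -> C) (x : E) (c k : C).

Lemma lbmD f g : lbm f -> lbm g -> lbm (fun y => f y + g y).
Proof.
move=> [mf fB] [mg gB]; split; first exact: cmeasD.
move=> rho; have [B B0 HB] := fB rho; have [B' B'0 HB'] := gB rho.
exists (B + B'); first exact: addr_ge0.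
by move=> x xr; apply: le_trans (cabsD _ _) (lerD (HB _ xr) (HB' _ xr)).
Qed.

Lemma lbmM f g : lbm f -> lbm g -> lbm (fun y => f y * g y).
Proof.
move=> [mf fB] [mg gB]; split; first exact: cmeasM.
move=> rho; have [B B0 HB] := fB rho; have [B' B'0 HB'] := gB rho.
exists (B * B'); first exact: mulr_ge0.
by move=> x xr; rewrite cabsM; apply: ler_pM; rewrite ?cabs_ge0 ?HB ?HB'.
Qed.

Lemma lbm_cst c : lbm (fun _ : E => c).
Proof.
split; first exact: cmeas_cst.
by move=> rho; exists (cabs c) => //; exact: cabs_ge0.
Qed.

Lemma lbmZ c g : lbm g -> lbm (fun y => c * g y).
Proof. by move=> lg; apply: lbmM => //; exact: lbm_cst. Qed.

Lemma lbmB f g : lbm f -> lbm g -> lbm (fun y => f y - g y).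
Proof.
move=> lf lg; have -> : (fun y => f y - g y) = (fun y => f y + (-1) * g y).
  by apply/funext => y; rewrite mulN1r.
by apply: lbmD => //; exact: lbmZ.
Qed.

Lemma lbm_reflect g x : lbm g -> lbm (fun y => g (x - y)).
Proof.
move=> lg; have -> : (fun y => g (x - y)) = (fun y => g (x + (-1) *: y)).
  by apply/funext => y; rewrite scaleN1r.
exact: lbm_affine.
Qed.

Lemma cintegral_mul_linear h g1 g2 g3 c : bms h -> lbm g1 -> lbm g2 -> lbm g3 ->
  cintegral (fun y => h y * g1 y) - cintegral (fun y => h y * g2 y)
    - c * cintegral (fun y => h y * g3 y) =
  cintegral (fun y => h y * (g1 y - g2 y - c * g3 y)).
Proof.
move=> bh l1 l2 l3.
have i1 := bms_cintegrable (bmsM bh l1).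
have i2 := bms_cintegrable (bmsM bh l2).
have i3 := bms_cintegrable (bmsM bh l3).
rewrite -cintegralZ// -[X in _ + X - _]mulN1r -cintegralZ//.
rewrite -[X in _ + X]mulN1r -cintegralZ; last exact: cintegrableZ.
rewrite -cintegralD//; last exact: cintegrableZ.
rewrite -cintegralD; first by congr cintegral; apply/funext => y; ring.
- by apply: cintegrableD => //; exact: cintegrableZ.
- by apply: cintegrableZ; exact: cintegrableZ.
Qed.

Lemma cintegral_mul_le h g B rho M : 0 <= B -> 0 <= rho -> 0 <= M -> cmeas h ->
  (forall y, cabs (h y) <= B) -> zero_outside rho h -> lbm g ->
  (forall y, `|y| <= rho -> cabs (g y) <= M) ->
  cabs (cintegral (fun y => h y * g y)) <= 2 * (B * M) * (2 * rho) ^+ d.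
Proof.
move=> B0 r0 M0 mh hB h0 [mg _] gM; apply: cabs_cintegral_ball => //.
- exact: mulr_ge0.
- exact: cmeasM.
- move=> y; have [yr|yr] := leP `|y| rho.
    by rewrite cabsM; apply: ler_pM; rewrite ?cabs_ge0// gM.
  by rewrite h0// mul0r cabs0 mulr_ge0.
- by move=> y yr; rewrite h0// mul0r.
Qed.

Lemma conv_comm h g : bms h -> lbm g -> conv h g = conv g h.
Proof.
move=> bh lg; apply/funext => x; rewrite /conv.
rewrite -(@cintegral_reflect _ _ (fun y => h y * g (x - y)) x).
  by congr cintegral; apply/funext => y; rewrite subKr mulrC.
by apply: bms_cintegrable; apply: bmsM => //; exact: lbm_reflect.
Qed.

Lemma conv_sum_r (I : Type) (r : seq I) h (G : I -> E -> C) : bms h ->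
  (forall j, lbm (G j)) ->
  conv h (fun x => \sum_(j <- r) G j x) = (fun x => \sum_(j <- r) conv h (G j) x).
Proof.
move=> bh lG; apply/funext => x; rewrite /conv.
under eq_fun do rewrite mulr_sumr.
suff iG j : cintegrable (fun y => h y * G j (x - y)) by rewrite (cintegral_sum r iG).1.
by apply: bms_cintegrable; apply: bmsM => //; exact: lbm_reflect.
Qed.

Lemma conv_lip h g : bms h -> smooth g -> forall rho, exists2 B, 0 <= B &
  forall x v, `|x| <= rho -> `|v| <= 1 ->
  cabs (conv h g (x + v) - conv h g x) <= B * `|v|.
Proof.
move=> bh sg rho; have lg := smooth_lbm sg.
have [mh [B [r [B0 r0 hB h0]]]] := bh.
have [L L0 HL] := smooth_lip (rho + r) sg.
exists (2 * (B * L) * (2 * r) ^+ d); first by rewrite !mulr_ge0// exprn_ge0// mulr_ge0.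
move=> x v xr v1; rewrite /conv.
have := @cintegral_mul_linear h (fun y => g (x + v - y)) (fun y => g (x - y))
  (fun=> 0) 0 bh (lbm_reflect _ lg) (lbm_reflect _ lg) (lbm_cst _).
rewrite mul0r subr0 => ->.
have -> : 2 * (B * L) * (2 * r) ^+ d * `|v| = 2 * (B * (L * `|v|)) * (2 * r) ^+ d by ring.
apply: cintegral_mul_le => //; first exact: mulr_ge0.
  apply: lbmB; last by apply: lbmZ; exact: lbm_cst.
  by apply: lbmB; exact: lbm_reflect.
move=> y yr; rewrite mulr0 subr0 [x + v - y]addrAC; apply: HL => //.
by apply: le_trans (ler_normB _ _) _; exact: lerD.
Qed.

(** All derivatives fall on [g]. Its Taylor remainder is uniform over the bounded support of [h], so
    it integrates to a quadratic remainder of the convolution. *)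
Lemma conv_smooth h g : bms h -> smooth g -> smooth (conv h g) /\
  forall s, D s (conv h g) = conv h (D s g).
Proof.
move=> bh sg; apply: (@smooth_intro _ _ (fun s => conv h (D s g))).
  by move=> s; exact: (lip_ccont (conv_lip bh (smooth_D s sg))).
move=> s i x; have sgs := smooth_D s sg; have lg := smooth_lbm sgs.
have sgi := smooth_D (i :: s) sg; have lgi := smooth_lbm sgi.
have [mh [B [r [B0 r0 hB h0]]]] := bh.
have [L L0 HL] := smooth_taylor2 (`|x| + r) sgs.
apply: (@quadratic_cder _ _ _ _ _ _ (2 * (B * L) * (2 * r) ^+ d) 1) => // t t1.
rewrite /conv (@cintegral_mul_linear _ (fun y => D s g (x + t *: e_ i - y))
  (fun y => D s g (x - y)) (fun y => D (i :: s) g (x - y)) _ bh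
  (lbm_reflect _ lg) (lbm_reflect _ lg) (lbm_reflect _ lgi)).
have -> : 2 * (B * L) * (2 * r) ^+ d * t ^+ 2 =
  2 * (B * (L * `|t| ^+ 2)) * (2 * r) ^+ d by rewrite real_normK ?num_real//; ring.
apply: cintegral_mul_le => //.
- by rewrite mulr_ge0// sqr_ge0.
- apply: lbmB; last by apply: lbmZ; exact: lbm_reflect.
  by apply: lbmB; exact: lbm_reflect.
move=> y yr; rewrite [x + _ - y]addrAC.
have xy : `|x - y| <= `|x| + r by apply: le_trans (ler_normB _ _) _; exact: lerD.
have vt := norm_delta_le t i.
have := HL (x - y) (t *: e_ i) xy (le_trans vt t1).
rewrite sum_delta => /le_trans; apply; apply: ler_wpM2l => //.
by rewrite lerXn2r// nnegrE.
Qed.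

Definition trunc_ball (r : R) h x := if `|x| <= r then h x else 0.

Lemma trunc_ball_bms r h : 0 <= r -> lbm h -> bms (trunc_ball r h).
Proof.
move=> r0 [[m1 m2] hB]; have [B B0 HB] := hB r; split; last first.
  exists B, r; split => // x; rewrite /trunc_ball.
    by case: ifPn => [/HB//|_]; rewrite cabs0.
  by case: leP.
have mr : measurable_fun setT (fun x : E => `|x| <= r).
  by apply: measurable_fun_ler => //; apply: continuous_measurable_rV;
    exact: norm_continuous.
split.
- rewrite (_ : (fun x => _) = (fun x => if `|x| <= r then complex.Re (h x) else 0)).
    by apply: measurable_fun_ifT.
  by apply/funext => x; rewrite /trunc_ball; case: ifP.
- rewrite (_ : (fun x => _) = (fun x => if `|x| <= r then complex.Im (h x) else 0)).
    by apply: measurable_fun_ifT.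
  by apply/funext => x; rewrite /trunc_ball; case: ifP.
Qed.

Lemma conv_trunc h g rho r x : zero_outside r g -> `|x| <= rho ->
  conv h g x = conv (trunc_ball (rho + r) h) g x.
Proof.
move=> g0 xr; congr cintegral; apply/funext => y; rewrite /trunc_ball.
case: ifPn => //; rewrite -ltNge => yr; rewrite g0 ?mulr0//.
rewrite distrC; have := lerB_dist y x.
by apply: lt_le_trans; move: xr yr; lra.
Qed.

(** Here [h] need not have bounded support, but for [x] in a ball only the values of [h] on a larger
    ball are seen; with [h] truncated there, [conv_smooth] applies. *)
Lemma conv_test_smooth h g : lbm h -> test g -> smooth (conv h g) /\
  forall s, D s (conv h g) = conv h (D s g).
Proof.
move=> lh tg; have [sg [r r0 g0]] := (testP g).1 tg.
have key rho s : 0 <= rho -> forall x, `|x| <= rho ->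
    conv h (D s g) x = D s (conv (trunc_ball (rho + r) h) g) x.
  move=> rho0 x xr; have bt := trunc_ball_bms (addr_ge0 rho0 r0) lh.
  by rewrite (conv_smooth bt sg).2; apply: conv_trunc => //; exact: zero_outside_D.
have x1 x v : `|v| < 1 -> `|x + v| <= `|x| + 1.
  by move=> v1; apply: le_trans (ler_normD _ _) _; rewrite lerD2l ltW.
have xx x : `|x| <= `|x| + 1 by rewrite lerDl.
have x10 x : 0 <= `|x| + 1 by rewrite addr_ge0.
apply: (@smooth_intro _ _ (fun s => conv h (D s g))).
  move=> s x e e0.
  have bt := trunc_ball_bms (addr_ge0 (x10 x) r0) lh.
  have st := (conv_smooth bt sg).1.
  have [dl dl0 Hd] := smooth_ccont (smooth_D s st) x e0.
  exists (Num.min dl 1); first by rewrite lt_min dl0 ltr01.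
  move=> v; rewrite lt_min => /andP[vd v1].
  by rewrite !(key (`|x| + 1) s (x10 x)) ?x1//; exact: Hd.
move=> s i x e e0.
have bt := trunc_ball_bms (addr_ge0 (x10 x) r0) lh.
have st := (conv_smooth bt sg).1.
have [dl dl0 Hd] := smooth_cder i x (smooth_D s st) e0.
exists (Num.min dl 1); first by rewrite lt_min dl0 ltr01.
move=> t; rewrite lt_min => /andP[td t1].
rewrite (key (`|x| + 1) (i :: s) (x10 x))// !(key (`|x| + 1) s (x10 x))//.
  exact: Hd.
by apply: x1; apply: le_lt_trans (norm_delta_le _ _) t1.
Qed.

Lemma conv_zero_outside h g r1 r2 : zero_outside r1 h -> zero_outside r2 g ->
  zero_outside (r1 + r2) (conv h g).
Proof.
move=> h0 g0 x xr; rewrite /conv -[RHS](@cintegral0 R d).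
congr cintegral; apply/funext => y; have [yr|yr] := leP `|y| r1.
  rewrite g0 ?mulr0//; have := lerB_normD x (- y); rewrite normrN.
  by apply: lt_le_trans; move: xr yr; lra.
by rewrite h0// mul0r.
Qed.

Lemma conv_test h g : bms h -> test g -> test (conv h g).
Proof.
move=> bh tg; have [sg [r r0 g0]] := (testP g).1 tg.
have [_ [B [r1 [_ r10 _ h0]]]] := bh.
apply/testP; split; first exact: (conv_smooth bh sg).1.
by exists (r1 + r); [exact: addr_ge0|exact: conv_zero_outside].
Qed.

End convolution.

Section dilation.
Context {R : realType} {d : nat}.
Local Open Scope complex_scope.
Local Notation E := 'rV[R]_d.
Local Notation C := R[i].
Local Notation D s F := (foldr partial F s).
Implicit Types (f g h : E -> C) (x : E) (c k : C).

Lemma pow2_neq0 j : (2 ^ j)%:R != 0 :> R.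
Proof. by rewrite pnatr_eq0 expn_eq0. Qed.

Lemma dilate_affine j f :
  dilate j f = (fun x => (2 ^ (j * d))%:R * f (0 + (2 ^ j)%:R *: x)).
Proof. by apply/funext => x; rewrite add0r. Qed.

Lemma dilate_test j f : test f -> test (dilate j f).
Proof.
move=> tf; rewrite dilate_affine; apply: testZ; apply: test_affine => //; exact: pow2_neq0.
Qed.

Lemma dilate_bms j f : bms f -> bms (dilate j f).
Proof.
move=> bf; rewrite dilate_affine; apply: bmsZ; apply: bms_affine => //; exact: pow2_neq0.
Qed.

Lemma dilate_D j f s : smooth f ->
  D s (dilate j f) = (fun x => ((2 ^ j)%:R : C) ^+ size s * dilate j (D s f) x).
Proof.
move=> sf; have [sa Da] := smooth_affine 0 (2 ^ j)%:R sf.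
rewrite dilate_affine (smoothZ _ sa).2; apply/funext => x.
by rewrite Da /dilate add0r rmorph_nat; ring.
Qed.

Lemma dilate_zero_outside j f rho : 0 <= rho -> zero_outside rho f ->
  zero_outside rho (dilate j f).
Proof.
move=> r0 f0 x xr; rewrite /dilate f0 ?mulr0// normrZ normr_nat.
apply: lt_le_trans xr _; rewrite ler_peMl//.
by rewrite ler1n expn_gt0.
Qed.

Lemma cintegral_dilate (F : E -> C) j : cintegrable F ->
  cintegral (fun y => (2 ^ (j * d))%:R * F ((2 ^ j)%:R *: y)) = cintegral F.
Proof.
move=> iF.
have := @cintegral_affine _ _ (fun z => (2 ^ (j * d))%:R * F z) 0 (2 ^ j)%:R
  (pow2_neq0 j) (cintegrableZ _ iF).
under [X in cintegral X = _]eq_fun do rewrite add0r; move=> ->.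
rewrite cintegralZ// mulrA normr_nat -natrX -expnM -(rmorph_nat (real_complex R)).
by rewrite -rmorphM mulVf ?mul1r// pnatr_eq0 expn_eq0.
Qed.

(** The scaling is moved from the kernel to the argument of [g], where the small factor [2^-j] is
    available to Taylor expansions. *)
Lemma conv_dilate_l j h g x : bms h -> lbm g ->
  conv (dilate j h) g x = cintegral (fun y => h y * g (x - (2 ^ j)%:R^-1 *: y)).
Proof.
move=> bh lg.
rewrite -(@cintegral_dilate (fun y => h y * g (x - (2 ^ j)%:R^-1 *: y)) j); last first.
  apply: bms_cintegrable; apply: bmsM => //.
  have -> : (fun y => g (x - (2 ^ j)%:R^-1 *: y)) =
      (fun y => g (x + (- (2 ^ j)%:R^-1) *: y)).
    by apply/funext => y; rewrite scaleNr.
  exact: lbm_affine.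
congr cintegral; apply/funext => y.
by rewrite /dilate scalerA mulVf ?pow2_neq0// scale1r mulrA.
Qed.

Lemma conv_dilate j h g : bms h -> lbm g ->
  conv (dilate j h) (dilate j g) = dilate j (conv h g).
Proof.
move=> bh lg; apply/funext => x; rewrite conv_dilate_l//; last first.
  by rewrite dilate_affine; apply: lbmZ; exact: lbm_affine.
rewrite /dilate /conv -cintegralZ; last first.
  by apply: bms_cintegrable; apply: bmsM => //; exact: lbm_reflect.
congr cintegral; apply/funext => y.
by rewrite scalerBr scalerA divff ?pow2_neq0// scale1r mulrCA.
Qed.

End dilation.

(** * Convolution of distributions with test functions *)

Section distributions.
Context {R : realType} {d : nat}.
Local Open Scope complex_scope.
Local Notation E := 'rV[R]_d.
Local Notation C := R[i].
Local Notation e_ i := (delta_mx ord0 i : E).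
Local Notation D s F := (foldr partial F s).
Local Notation mu := (lebesgue_rV R d).
Implicit Types (f g h phi psi : E -> C) (x : E) (c k : C).

(** A distribution sees finitely many derivatives on each compact set, so constants found word by
    word must be merged over all words of length at most [N]. The constants belonging to the
    possible first letters are added up. *)
Lemma seq_uniform_bound (P : seq 'I_d -> R -> Prop) :
  (forall s B B', B <= B' -> P s B -> P s B') ->
  (forall s, exists2 B, 0 <= B & P s B) ->
  forall N, exists2 B, 0 <= B & forall s, (size s <= N)%N -> P s B.
Proof.
move=> mono ex N; elim: N P mono ex => [|N IH] P mono ex.
  have [B B0 HB] := ex [::]; exists B => // s.
  by rewrite leqn0 => /nilP ->.
have [B B0 HB] := ex [::].
have /choice[Bf Hf] : forall i, exists B, 0 <= B /\
    forall s, (size s <= N)%N -> P (i :: s) B.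
  move=> i; have [||B1 B10 HB1] := IH (fun s => P (i :: s)); last by exists B1.
    by move=> s; exact: mono.
  by move=> s; exact: ex.
have sB : 0 <= \sum_i Bf i by apply: sumr_ge0 => i _; case: (Hf i).
exists (B + \sum_i Bf i); first by rewrite addr_ge0.
case=> [_|i s /= sN]; first by apply: mono HB; rewrite lerDl.
have [Bi HBi] := Hf i; apply: mono (HBi s sN).
rewrite (bigD1 i)//= addrCA lerDl addr_ge0// sumr_ge0// => j _.
by case: (Hf j).
Qed.

Lemma test_lip_global f : test f -> exists2 B, 0 <= B &
  forall x v, cabs (f (x + v) - f x) <= B * `|v|.
Proof.
move=> tf; have [L L0 HL] := test_lip tf; have [B B0 HB] := test_bounded tf.
exists (L + 2 * B); first by rewrite addr_ge0// mulr_ge0.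
move=> x v; rewrite mulrDl; have [v1|v1] := leP `|v| 1.
  by apply: le_trans (HL x v v1) _; rewrite lerDl !mulr_ge0.
apply: (@le_trans _ _ (2 * B * `|v|)); last by rewrite lerDr mulr_ge0.
apply: (@le_trans _ _ (2 * B)).
  by apply: le_trans (cabsB _ _) _; rewrite mulr_natl mulr2n lerD.
by rewrite ler_peMr ?mulr_ge0// ltW.
Qed.

Section one_distribution.
Variable u : (E -> C) -> C.
Hypothesis Du : is_distribution u.

Lemma distr_lin c phi psi : test phi -> test psi ->
  u (fun x => c * phi x + psi x) = c * u phi + u psi.
Proof. exact: Du.1. Qed.

Lemma distr0 : u (fun=> 0) = 0.
Proof.
have := distr_lin 1 (@test_cst0 R d) (@test_cst0 R d).
have -> : (fun _ : E => 1 * 0 + 0 : C) = (fun=> 0).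
  by apply/funext => x; rewrite mulr0 addr0.
rewrite mul1r; by move/eqP; rewrite -subr_eq0 opprD addrA subrr sub0r oppr_eq0 => /eqP.
Qed.

Lemma distrD phi psi : test phi -> test psi ->
  u (fun x => phi x + psi x) = u phi + u psi.
Proof.
move=> t1 t2; have := distr_lin 1 t1 t2; rewrite mul1r => <-.
by congr u; apply/funext => x; rewrite mul1r.
Qed.

Lemma distrZ c phi : test phi -> u (fun x => c * phi x) = c * u phi.
Proof.
move=> t1; have := distr_lin c t1 (@test_cst0 R d); rewrite distr0 addr0 => <-.
by congr u; apply/funext => x; rewrite addr0.
Qed.

Lemma distrB phi psi : test phi -> test psi ->
  u (fun x => phi x - psi x) = u phi - u psi.
Proof.
move=> t1 t2; rewrite -mulN1r -(distrZ _ t2) -distrD//; last exact: testZ.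
by congr u; apply/funext => x; rewrite mulN1r.
Qed.

Lemma distr_sum (I : Type) (r : seq I) (F : I -> E -> C) : (forall j, test (F j)) ->
  u (fun x => \sum_(j <- r) F j x) = \sum_(j <- r) u (F j).
Proof.
move=> tF; elim: r => [|j r IH].
  by under eq_fun do rewrite big_nil; rewrite big_nil distr0.
under eq_fun do rewrite big_cons; rewrite big_cons -IH distrD//.
exact: test_sum.
Qed.

Lemma distr_bound rho : exists (c : R) (N : nat), 0 <= c /\ forall phi B,
  smooth phi -> zero_outside rho phi -> 0 <= B ->
  (forall s x, (size s <= N)%N -> cabs (D s phi x) <= B) -> cabs (u phi) <= c * B.
Proof.
have [c [N HN]] := Du.2 _ (@compact_norm_ball R d rho).
exists `|c|, N; split => // phi B sphi phi0 B0 HB.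
have := HN phi ((test_on_ballP rho phi).2 (conj sphi phi0)).
rewrite -lee_fin => /le_trans; apply.
have C0 : (0 <= CN_norm N phi)%E.
  apply: (@le_trans _ _ (cabs (mpartial (fun=> 0%N) phi 0))%:E).
    by rewrite lee_fin cabs_ge0.
  apply: ereal_sup_ubound; exists (fun=> 0%N), 0; split => //.
  by rewrite /morder big1.
have CB : (CN_norm N phi <= B%:E)%E.
  apply: ge_ereal_sup => _ [a [x [aN ->]]]; rewrite lee_fin mpartialE.
  by apply: HB; rewrite size_mseq.
apply: (@le_trans _ _ (`|c|%:E * CN_norm N phi)%E).
  by apply: lee_wpmul2r => //; rewrite lee_fin ler_norm.
by rewrite EFinM; apply: lee_wpmul2l.
Qed.

Lemma test_reflect phi x : test phi -> test (fun y => phi (x - y)).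
Proof.
move=> tp; rewrite (_ : (fun y => _) = (fun y => phi (x + (-1) *: y))).
  by apply: test_affine => //; rewrite oppr_eq0 oner_eq0.
by apply/funext => y; rewrite scaleN1r.
Qed.

Lemma D_reflect phi x s : smooth phi ->
  D s (fun y => phi (x - y)) = (fun y => ((-1)%:C) ^+ size s * D s phi (x - y)).
Proof.
move=> sp; rewrite (_ : (fun y => phi (x - y)) = (fun y => phi (x + (-1) *: y))).
  by rewrite (smooth_affine x (-1) sp).2; apply/funext => y; rewrite scaleN1r.
by apply/funext => y; rewrite scaleN1r.
Qed.

Lemma cabs_sign n : cabs ((-1)%:C ^+ n : C) = 1.
Proof.
elim: n => [|n IH]; first by rewrite expr0 (cabs_real 1) normr1.
by rewrite exprS cabsM IH mulr1 (cabs_real (-1)) normrN1.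
Qed.

Lemma zero_outside_reflect phi x r rho : zero_outside r phi -> `|x| <= rho ->
  zero_outside (rho + r) (fun y => phi (x - y)).
Proof.
move=> p0 xr y yr; apply: p0; rewrite distrC; have := lerB_dist y x.
by apply: lt_le_trans; move: xr yr; lra.
Qed.

(** For [x] in a fixed ball the reflected translates of [phi] live in one ball, so order and
    constant do not depend on [x]. *)
Lemma dconv_bound rho r : exists (c : R) (N : nat), 0 <= c /\ forall phi B x, `|x| <= rho ->
  smooth phi -> zero_outside r phi -> 0 <= B ->
  (forall s y, (size s <= N)%N -> cabs (D s phi y) <= B) ->
  cabs (dconv u phi x) <= c * B.
Proof.
have [c [N [c0 H]]] := distr_bound (rho + r); exists c, N; split => //.
move=> phi B x xr sp p0 B0 HB; apply: H; [| |exact: B0|].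
- rewrite (_ : (fun y => _) = (fun y => phi (x + (-1) *: y))).
    exact: (smooth_affine x (-1) sp).1.
  by apply/funext => y; rewrite scaleN1r.
- exact: zero_outside_reflect.
- by move=> s y sN; rewrite D_reflect// cabsM cabs_sign mul1r HB.
Qed.

Lemma dconvD phi psi x : test phi -> test psi ->
  dconv u (fun y => phi y + psi y) x = dconv u phi x + dconv u psi x.
Proof.
by move=> t1 t2; rewrite /dconv -distrD//; exact: test_reflect.
Qed.

Lemma dconvZ c phi x : test phi -> dconv u (fun y => c * phi y) x = c * dconv u phi x.
Proof. by move=> t1; rewrite /dconv -distrZ//; exact: test_reflect. Qed.

Lemma dconvB phi psi x : test phi -> test psi ->
  dconv u (fun y => phi y - psi y) x = dconv u phi x - dconv u psi x.
Proof. by move=> t1 t2; rewrite /dconv -distrB//; exact: test_reflect. Qed.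

Lemma dconv_sum (I : Type) (r : seq I) (F : I -> E -> C) x : (forall j, test (F j)) ->
  dconv u (fun y => \sum_(j <- r) F j y) x = \sum_(j <- r) dconv u (F j) x.
Proof.
move=> tF; rewrite /dconv (distr_sum r (F := fun j y => F j (x - y)))// => j.
exact: test_reflect.
Qed.

Lemma test_shift phi v : test phi -> test (fun y => phi (v + y)).
Proof.
move=> tp; rewrite (_ : (fun y => _) = (fun y => phi (v + 1 *: y))).
  by apply: test_affine => //; rewrite oner_eq0.
by apply/funext => y; rewrite scale1r.
Qed.

Lemma D_shift phi v s : smooth phi ->
  D s (fun y => phi (v + y)) = (fun y => D s phi (v + y)).
Proof.
move=> sp; rewrite (_ : (fun y => phi (v + y)) = (fun y => phi (v + 1 *: y))).
  rewrite (smooth_affine v 1 sp).2; apply/funext => y.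
  by rewrite scale1r expr1n mul1r.
by apply/funext => y; rewrite scale1r.
Qed.

Lemma dconv_shift phi x v : dconv u phi (x + v) = dconv u (fun y => phi (v + y)) x.
Proof.
by congr u; apply/funext => y; congr phi; rewrite addrCA addrA.
Qed.

Lemma zero_outside_shift phi v r : zero_outside r phi -> `|v| <= 1 ->
  zero_outside (r + 1) (fun y => phi (v + y)).
Proof.
move=> p0 v1 y yr; apply: p0; rewrite addrC; have := lerB_normD y v.
by apply: lt_le_trans; move: yr v1; lra.
Qed.

Lemma D_sub f g s : smooth f -> smooth g ->
  D s (fun y => f y - g y) = (fun y => D s f y - D s g y).
Proof.
move=> sf sg; rewrite (_ : (fun y => f y - g y) = (fun y => f y + (-1) * g y)).
  rewrite (smoothD sf (smoothZ (-1) sg).1).2 (smoothZ (-1) sg).2.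
  by apply/funext => y; rewrite mulN1r.
by apply/funext => y; rewrite mulN1r.
Qed.

Lemma testB f g : test f -> test g -> test (fun y => f y - g y).
Proof.
move=> tf tg; rewrite (_ : (fun y => f y - g y) = (fun y => f y + (-1) * g y)).
  by apply: testD => //; exact: testZ.
by apply/funext => y; rewrite mulN1r.
Qed.

Lemma dconv_lip phi rho : test phi -> exists2 B, 0 <= B &
  forall x v, `|x| <= rho -> `|v| <= 1 ->
  cabs (dconv u phi (x + v) - dconv u phi x) <= B * `|v|.
Proof.
move=> tp; have [sp [r r0 p0]] := (testP phi).1 tp.
have [c [N [c0 H]]] := dconv_bound rho (r + 1).
have [||B B0 HB] := @seq_uniform_bound (fun s B => forall x v,
  cabs (D s phi (x + v) - D s phi x) <= B * `|v|) _ _ N.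
- by move=> s B B' BB' + x v => /(_ x v)/le_trans; apply; exact: ler_wpM2r.
- by move=> s; exact: (test_lip_global (test_D s tp)).
exists (c * B); first exact: mulr_ge0.
move=> x v xr v1; rewrite dconv_shift -(dconvB _ (test_shift v tp) tp).
rewrite -mulrA; apply: (H _ _ _ xr).
- exact: test_smooth (testB (test_shift v tp) tp).
- move=> y yr; rewrite (zero_outside_shift p0 v1 yr) p0 ?subrr//.
  by apply: lt_trans yr; rewrite ltrDl.
- exact: mulr_ge0.
- move=> s y sN; rewrite (D_sub _ (test_smooth (test_shift v tp)) sp) (D_shift _ _ sp).
  by rewrite [v + y]addrC; exact: HB.
Qed.

(** The Taylor remainder of a translated test function is quadratic in every C^N norm and supported
    in a slightly larger ball; the continuity of [u] turns this into a quadratic remainder for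
    [dconv u phi]. *)
Lemma dconv_smooth phi : test phi -> smooth (dconv u phi) /\
  forall s, D s (dconv u phi) = dconv u (D s phi).
Proof.
move=> tp; apply: (@smooth_intro _ _ (fun s => dconv u (D s phi))).
  by move=> s; apply: lip_ccont => rho; exact: (dconv_lip rho (test_D s tp)).
move=> s i x; have tps := test_D s tp; have tpi := test_D (i :: s) tp.
have [sp [r r0 p0]] := (testP _).1 tps.
have [c [N [c0 H]]] := dconv_bound `|x| (r + 1).
have [||B B0 HB] := @seq_uniform_bound (fun s' B => forall y v, `|v| <= 1 ->
  cabs (D s' (D s phi) (y + v) - D s' (D s phi) y -
    \sum_j (v ord0 j)%:C * partial j (D s' (D s phi)) y) <= B * `|v| ^+ 2) _ _ N.
- move=> s' B B' BB' + y v v1 => /(_ y v v1)/le_trans; apply.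
  by apply: ler_wpM2r => //; exact: sqr_ge0.
- by move=> s'; exact: (test_taylor2 (test_D s' tps)).
apply: (@quadratic_cder _ _ _ _ _ _ (c * B) 1) => // t t1.
have vt := norm_delta_le t i; have v1 := le_trans vt t1.
have ts := test_shift (t *: e_ i) tps.
rewrite dconv_shift -(dconvB _ ts tps) -(dconvZ _ _ tpi).
rewrite -(dconvB _ (testB ts tps) (testZ _ tpi)).
rewrite -mulrA; apply: (H _ _ _ (lexx _)).
- exact: test_smooth (testB (testB ts tps) (testZ _ tpi)).
- move=> y yr; have yr' : r < `|y| by apply: lt_trans yr; rewrite ltrDl.
  have z : D (i :: s) phi y = 0 by exact: (@zero_outside_D _ _ _ r [:: i] sp p0 y yr').
  by rewrite (zero_outside_shift p0 v1 yr) (p0 _ yr') z mulr0 !subr0.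
- by rewrite mulr_ge0// sqr_ge0.
- move=> s' y sN.
  have sts := test_smooth ts.
  rewrite (D_sub _ (test_smooth (testB ts tps)) (test_smooth (testZ _ tpi))).
  rewrite (D_sub _ sts sp) (D_shift _ _ sp) (smoothZ _ (test_smooth tpi)).2.
  have -> : D s' (D (i :: s) phi) = partial i (D s' (D s phi)) by exact: (D_partial i s' sp).
  have := HB s' sN y _ v1; rewrite sum_delta [y + _]addrC => /le_trans; apply.
  apply: ler_wpM2l => //; rewrite -[leRHS]real_normK ?num_real//.
  by rewrite lerXn2r// nnegrE.
Qed.

Definition wnorm (w : E -> C) : R := \int[mu]_x cabs (w x).

Lemma bms_cabs_integrable w : bms w -> mu.-integrable setT (fun x => (cabs (w x))%:E).
Proof.
move=> [mw [B [rho [B0 r0 wB w0]]]].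
apply: (bounded_ball_integrable (rho := rho) B0 (cmeas_cabs mw)) => [x|x xr].
  by rewrite ger0_norm ?cabs_ge0.
by rewrite w0// cabs0.
Qed.

Lemma cintegral_wnorm w g M : bms w -> lbm g ->
  (forall y, w y != 0 -> cabs (g y) <= M) ->
  cabs (cintegral (fun y => w y * g y)) <= 2 * M * wnorm w.
Proof.
move=> bw lg gM; have bwg := bmsM bw lg.
rewrite -lee_fin; apply: le_trans (cabs_cintegral (bms_cintegrable bwg) bwg.1) _.
rewrite -mulrA [leRHS]EFinM; apply: lee_wpmul2l => //.
have iw := bms_cabs_integrable bw.
rewrite -RintegralZl// -(fineK (integrable_fin_num measurableT (bms_cabs_integrable bwg))).
rewrite lee_fin; apply: le_Rintegral => //.
- exact: bms_cabs_integrable.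
- exact: (integrableZl measurableT M iw).
move=> y _; rewrite cabsM mulrC; have [->|wy] := eqVneq (w y) 0.
  by rewrite cabs0 !mulr0.
by apply: ler_wpM2r; [exact: cabs_ge0|exact: gM].
Qed.

Lemma bms_if (b : E -> bool) w : measurable_fun setT b -> bms w ->
  bms (fun y => if b y then w y else 0).
Proof.
move=> mb [[m1 m2] [B [rho [B0 r0 wB w0]]]]; split; last first.
  exists B, rho; split => // x; first by case: ifP => // _; rewrite cabs0.
  by move=> xr; case: ifP => // _; exact: w0.
split.
- rewrite (_ : (fun x => _) = (fun x => if b x then complex.Re (w x) else 0)).
    by apply: measurable_fun_ifT.
  by apply/funext => x; case: ifP.
- rewrite (_ : (fun x => _) = (fun x => if b x then complex.Im (w x) else 0)).
    by apply: measurable_fun_ifT.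
  by apply/funext => x; case: ifP.
Qed.

Lemma conv_addl w1 w2 g : bms w1 -> bms w2 -> lbm g ->
  conv (fun y => w1 y + w2 y) g = (fun x => conv w1 g x + conv w2 g x).
Proof.
move=> b1 b2 lg; apply/funext => x; rewrite /conv -cintegralD.
- by congr cintegral; apply/funext => y; rewrite mulrDl.
- by apply: bms_cintegrable; apply: bmsM => //; exact: lbm_reflect.
- by apply: bms_cintegrable; apply: bmsM => //; exact: lbm_reflect.
Qed.

(** When [w] lives within [e] of [p], both sides are compared with the integral of [w] times the
    value at [p]. For [u (conv w eta)] the error is the Lipschitz constant [L] of the derivatives of
    [eta] seen through [u]; for the integral it is the Lipschitz constant [L'] of the
    convolution. *)
Lemma exchange_piece eta rho : test eta -> exists2 K : R, 0 <= K &
  forall w p (e : R), bms w -> zero_outside rho w -> `|p| <= rho -> 0 <= e <= 1 ->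
  (forall y, w y != 0 -> `|y - p| <= e) ->
  cabs (u (conv w eta) - cintegral (fun y => w y * dconv u (fun z => eta (0 - z)) y))
    <= K * e * wnorm w.
Proof.
move=> te; have [se [r r0 e0]] := (testP eta).1 te.
have [c [N [c0 H]]] := distr_bound (rho + r).
have [||L L0 HL] := @seq_uniform_bound (fun s B => forall x v,
  cabs (D s eta (x + v) - D s eta x) <= B * `|v|) _ _ N.
- by move=> s B B' BB' + x v => /(_ x v)/le_trans; apply; exact: ler_wpM2r.
- by move=> s; exact: (test_lip_global (test_D s te)).
have ter := test_reflect 0 te.
have [L' L'0 HL'] := dconv_lip rho ter.
exists (2 * c * L + 2 * L'); first by rewrite addr_ge0// !mulr_ge0.
move=> w p e bw w0 pr /andP[e0' e1] wp.
set F := dconv u _; have [sF _] := dconv_smooth ter.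
have lF : lbm F := smooth_lbm sF.
have tc := conv_test bw te.
have ts := test_shift (- p) te.
have FpE : F p = u (fun t => eta (- p + t)).
  by congr u; apply/funext => t; rewrite sub0r opprB addrC.
have wn0 : 0 <= wnorm w by apply: Rintegral_ge0 => y _; exact: cabs_ge0.
have iw := bms_cintegrable bw.
have mulC g : (fun y => cintegral w * g y) = (fun y : E => g y * cintegral w).
  by apply/funext => y; rewrite mulrC.
have diff g k : lbm g -> cintegral (fun y => w y * g y) - cintegral w * k =
    cintegral (fun y => w y * (g y - k)).
  move=> lg; rewrite -mulrN [_ * - k]mulrC -(cintegralZ _ iw).
  rewrite -cintegralD; [|exact: bms_cintegrable (bmsM bw lg)|exact: cintegrableZ].
  by congr cintegral; apply/funext => y; ring.
have h1 : cabs (u (conv w eta) - cintegral w * F p) <= c * (2 * (L * e) * wnorm w).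
  rewrite FpE -(distrZ _ ts) -(distrB tc (testZ _ ts)); apply: H.
  - exact: test_smooth (testB tc (testZ _ ts)).
  - move=> y yr; rewrite (conv_zero_outside w0 e0 yr) e0 ?mulr0 ?subrr//.
    rewrite addrC; have := lerB_normD y (- p); rewrite normrN.
    by apply: lt_le_trans; move: yr pr; lra.
  - by rewrite mulr_ge0// mulr_ge0// mulr_ge0.
  move=> s t sN.
  rewrite (D_sub _ (test_smooth tc) (test_smooth (testZ _ ts))).
  rewrite (smoothZ _ (test_smooth ts)).2 (conv_smooth bw se).2 (D_shift _ _ se).
  have les := smooth_lbm (smooth_D s se).
  rewrite /conv diff; last exact: lbm_reflect.
  apply: cintegral_wnorm => //.
    by apply: lbmB; [exact: lbm_reflect|exact: lbm_cst].
  move=> y wy; have -> : t - y = (- p + t) + (p - y).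
    by rewrite [- p + t]addrC addrA subrK.
  apply: le_trans (HL s sN _ _) _; apply: ler_wpM2l => //.
  by rewrite distrC wp.
have h2 : cabs (cintegral (fun y => w y * F y) - cintegral w * F p) <=
    2 * (L' * e) * wnorm w.
  rewrite diff//; apply: cintegral_wnorm => //.
    by apply: lbmB => //; exact: lbm_cst.
  move=> y wy; have yp := wp _ wy.
  have -> : y = p + (y - p) by rewrite addrC subrK.
  apply: le_trans (HL' _ _ pr (le_trans yp e1)) _.
  by apply: ler_wpM2l => //; rewrite [p + _]addrC subrK.
have Hr (a b k : C) : a - b = (a - k) - (b - k) by ring.
rewrite (Hr _ _ (cintegral w * F p)).
apply: le_trans (cabsB _ _) (le_trans (lerD h1 h2) _).
by rewrite le_eqVlt; apply/orP; left; apply/eqP; ring.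
Qed.

Lemma measurable_near (p : E) (e : R) : measurable_fun setT (fun y : E => `|y - p| < e).
Proof.
apply: measurable_fun_ltr => //; apply: continuous_measurable_rV.
apply/real_contP => x e0 e00; exists e0 => // v ve.
apply: le_trans (ler_dist_dist _ _) _.
by rewrite opprB addrA subrK addrAC subrr add0r ltW.
Qed.

(** The part of [w] near the first centre is split off and the rest is left to the other centres.
    The pieces are disjoint, so their L^1 norms add up and the error does not depend on the number
    of balls. *)
Lemma exchange_list eta rho : test eta -> exists2 K : R, 0 <= K &
  forall (P : seq E) w (e : R), bms w -> zero_outside rho w ->
  (forall p, p \in P -> `|p| <= rho) -> 0 <= e <= 1 ->
  (forall y, w y != 0 -> exists2 p, p \in P & `|y - p| < e) ->
  cabs (u (conv w eta) - cintegral (fun y => w y * dconv u (fun z => eta (0 - z)) y))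
    <= K * e * wnorm w.
Proof.
move=> te; have [K K0 HK] := exchange_piece rho te; exists K => // P.
set F := dconv u _; have [sF _] := dconv_smooth (test_reflect 0 te).
have lF : lbm F := smooth_lbm sF.
have le := smooth_lbm (test_smooth te).
elim: P => [|p P IH] w e bw w0 Pr e01 wP.
  have -> : w = (fun=> 0).
    apply/funext => y; apply/eqP/negPn/negP => /wP[p].
    by rewrite in_nil.
  rewrite [conv _ _](_ : _ = (fun=> 0)); last first.
    apply/funext => x; rewrite -[RHS](@cintegral0 R d); congr cintegral.
    by apply/funext => y; rewrite mul0r.
  rewrite distr0 [X in cintegral X](_ : _ = (fun=> 0)); last first.
    by apply/funext => y; rewrite mul0r.
  rewrite cintegral0 subrr cabs0 mulr_ge0//; last first.
    by apply: Rintegral_ge0 => y _; exact: cabs_ge0.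
  by rewrite mulr_ge0//; case/andP: e01.
pose w1 y := if `|y - p| < e then w y else 0.
pose w2 y := if ~~ (`|y - p| < e) then w y else 0.
have b1 : bms w1 by apply: (bms_if (measurable_near p e)).
have b2 : bms w2 by apply: (bms_if (measurable_neg (measurable_near p e))).
have w12 : w = (fun y => w1 y + w2 y).
  by apply/funext => y; rewrite /w1 /w2; case: ifP; rewrite ?addr0 ?add0r.
have cw12 y : cabs (w y) = cabs (w1 y) + cabs (w2 y).
  by rewrite /w1 /w2; case: ifP; rewrite cabs0 ?addr0 ?add0r.
have nw : wnorm w = wnorm w1 + wnorm w2.
  rewrite /wnorm -RintegralD//; [|exact: bms_cabs_integrable..].
  by apply: eq_Rintegral => y _; exact: cw12.
have i1 := bms_cintegrable (bmsM b1 lF); have i2 := bms_cintegrable (bmsM b2 lF).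
have h1 : cabs (u (conv w1 eta) - cintegral (fun y => w1 y * F y)) <= K * e * wnorm w1.
  apply: (HK w1 p) => //.
  - by move=> y yr; rewrite /w1; case: ifP => // _; exact: w0.
  - by apply: Pr; rewrite mem_head.
  - by move=> y; rewrite /w1; case: ifP => [/ltW//|_]; rewrite eqxx.
have h2 : cabs (u (conv w2 eta) - cintegral (fun y => w2 y * F y)) <= K * e * wnorm w2.
  apply: IH => //.
  - by move=> y yr; rewrite /w2; case: ifP => // _; exact: w0.
  - by move=> q qP; apply: Pr; rewrite in_cons qP orbT.
  - move=> y; rewrite /w2; case: ifPn => [yp /wP[q]|_]; last by rewrite eqxx.
    rewrite in_cons => /orP[/eqP -> yq|qP yq]; last by exists q.
    by rewrite yq in yp.
rewrite nw mulrDr {1}w12 (conv_addl b1 b2 le) (distrD (conv_test b1 te) (conv_test b2 te)).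
rewrite [X in cintegral X](_ : _ = (fun y => w1 y * F y + w2 y * F y)); last first.
  by apply/funext => y; rewrite [in LHS]w12 mulrDl.
rewrite (cintegralD i1 i2) opprD addrACA.
exact: le_trans (cabsD _ _) (lerD h1 h2).
Qed.

(* The weight [w] is cut along a finite cover by small balls; on each piece the
   integral is close, in every C^N norm, to a multiple of one translate. *)
Lemma distr_conv w eta : bms w -> test eta ->
  u (conv w eta) = cintegral (fun y => w y * dconv u (fun z => eta (0 - z)) y).
Proof.
move=> bw te; have [_ [B [rho [B0 r0 _ w0]]]] := bw.
have [K K0 HK] := exchange_list rho te.
apply/eqP; rewrite -subr_eq0; apply/eqP/cabs0_eq0/eqP.
rewrite eq_le cabs_ge0 andbT; apply: (@le_geo _ _ _ (K * wnorm w)) => J.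
rewrite add0r mulrAC.
have := @compact_norm_ball R d rho; rewrite compact_cover.
have q0 : 0 < (2^-1 : R) ^+ J by exact: geo_gt0.
move=> /(_ _ [set p : E | `|p| <= rho] (fun p => [set y | `|y - p| < 2^-1 ^+ J])).
move=> /(_ _)[].
- move=> p _; apply: (@open_comp _ _ (fun y : E => `|y - p|) [set t | t < 2^-1 ^+ J]).
    move=> y _; apply: (@continuous_comp _ _ _ (fun y : E => y - p) (fun z => `|z|)).
      by apply: (@cvgB _ _ _ (nbhs y)); [exact: cvg_id|exact: cvg_cst].
    exact: norm_continuous.
  exact: open_lt.
- by move=> y yr; exists y => //; rewrite /= subrr normr0.
move=> P PD Pcov; apply: (HK (finmap.enum_fset P)) => //.
- by move=> p /PD; rewrite inE.
- by rewrite ltW//= exprn_ile1// ?invf_le1// ler1n.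
move=> y wy; have : `|y| <= rho.
  by rewrite leNgt; apply: contra wy => /w0 ->.
by move=> /Pcov[p /= pP yp]; exists p.
Qed.

Lemma dconv_conv phi psi : test phi -> test psi ->
  dconv u (conv phi psi) = conv (dconv u phi) psi.
Proof.
move=> tp ts; apply/funext => x.
have lp := smooth_lbm (test_smooth tp); have ls := smooth_lbm (test_smooth ts).
have bp := test_bms tp; have bs := test_bms ts.
have tr := test_reflect 0 tp.
transitivity (u (conv (fun y => psi (x - y)) (fun t => phi (0 - t)))).
  rewrite /dconv; congr u; apply/funext => t.
  rewrite (conv_comm bp ls) /conv.
  rewrite -(@cintegral_reflect _ _ (fun y => psi y * phi (x - t - y)) x).
    congr cintegral; apply/funext => y; congr (_ * phi _).
    by rewrite sub0r !opprB addrC addrA subrK.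
  by apply: bms_cintegrable; apply: bmsM => //; exact: lbm_reflect.
rewrite distr_conv//; last exact: test_bms (test_reflect x ts).
congr cintegral; apply/funext => y; rewrite mulrC; congr (dconv u _ _ * _).
by apply/funext => z; rewrite !sub0r opprK.
Qed.

End one_distribution.

Lemma distr_of_distribution phi : test phi -> is_distribution (distr_of phi).
Proof.
move=> tp; have bp := test_bms tp; split.
  move=> c f g tf tg; rewrite /distr_of.
  have lf := smooth_lbm (test_smooth tf); have lg := smooth_lbm (test_smooth tg).
  rewrite -cintegralZ; last exact: bms_cintegrable (bmsM bp lf).
  rewrite -cintegralD; last exact: bms_cintegrable (bmsM bp lg).
    by congr cintegral; apply/funext => x; ring.
  by apply: cintegrableZ; exact: bms_cintegrable (bmsM bp lf).
move=> K cK; have [rho r0 Kr] := compact_sub_ball cK.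
have [mp [B [r [B0 r10 pB p0]]]] := bp.
(* The summand 1 keeps the constant positive, so that the bound also holds when [CN_norm 0 f] is
   [+oo], a case that is not excluded here. *)
exists (2 * B * (2 * r) ^+ d + 1), 0%N => f [sf _].
have V0 : 0 <= 2 * B * (2 * r) ^+ d by rewrite !mulr_ge0// exprn_ge0// mulr_ge0.
have fC x : ((cabs (f x))%:E <= CN_norm 0 f)%E.
  apply: ereal_sup_ubound; exists (fun=> 0%N), x; split.
    by rewrite /morder big1.
  rewrite mpartialE /mseq.
  by have -> : flatten [seq nseq 0 i | i <- enum 'I_d] = [::] by elim: (enum 'I_d).
case E0 : (CN_norm 0 f) fC => [M| |] fC; last by have := fC 0.
  have fM x : cabs (f x) <= M by rewrite -lee_fin.
  have M0 : 0 <= M := le_trans (cabs_ge0 _) (fM 0).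
  rewrite -EFinM lee_fin mulrDl mul1r ler_wpDr// mulrAC -(mulrA 2).
  by apply: cintegral_mul_le => //; exact: smooth_lbm.
by rewrite gt0_muley ?leey// lte_fin ltr_wpDl.
Qed.

(** Obtained without Fubini, as the case of [dconv_conv] in which the distribution is a test
    function. *)
Lemma conv_assoc f g h : test f -> test g -> test h ->
  conv f (conv g h) = conv (conv f g) h.
Proof. by move=> tf tg th; exact: (dconv_conv (distr_of_distribution tf) tg th). Qed.

(** As [phi] has integral one, the difference is the integral of [phi y] times an increment of
    [theta] over [2^-J y], which is Lipschitz small together with all its derivatives. *)
Lemma mollify phi theta : test phi -> cintegral phi = 1 -> test theta ->
  exists2 rho, 0 <= rho &
  (forall J, zero_outside rho (fun x => conv (dilate J phi) theta x - theta x)) /\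
  forall s, exists2 B, 0 <= B & forall J x,
    cabs (D s (fun x => conv (dilate J phi) theta x - theta x) x) <= B * 2^-1 ^+ J.
Proof.
move=> tp p1 tt; have [st [r r0 t0]] := (testP theta).1 tt.
have [sp [r' r'0 p0]] := (testP phi).1 tp.
have bp := test_bms tp.
exists (r' + r); first exact: addr_ge0.
split=> [J x xr|s].
  rewrite (conv_zero_outside (dilate_zero_outside J r'0 p0) t0 xr) t0 ?subrr//.
  by apply: le_lt_trans xr; rewrite lerDr.
have [B B0 pB] := test_bounded tp.
have [L L0 HL] := test_lip_global (test_D s tt).
exists (2 * (B * (L * r')) * (2 * r') ^+ d).
  by rewrite !mulr_ge0// exprn_ge0// mulr_ge0.
move=> J x; have bd := dilate_bms J bp.
have [sc Dc] := conv_smooth bd st.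
have lt := smooth_lbm (smooth_D s st).
rewrite D_sub// Dc conv_dilate_l//.
have -> : D s theta x = D s theta x * cintegral phi by rewrite p1 mulr1.
have lts : lbm (fun y => D s theta (x - (2 ^ J)%:R^-1 *: y)).
  have -> : (fun y => D s theta (x - (2 ^ J)%:R^-1 *: y)) =
      (fun y => D s theta (x + (- (2 ^ J)%:R^-1) *: y)).
    by apply/funext => y; rewrite scaleNr.
  exact: lbm_affine.
rewrite -mulNr -cintegralZ; last exact: bms_cintegrable.
rewrite -cintegralD; first last.
- by apply: cintegrableZ; exact: bms_cintegrable.
- exact: bms_cintegrable (bmsM bp lts).
rewrite (_ : (fun y => _) = (fun y => phi y *
    (D s theta (x - (2 ^ J)%:R^-1 *: y) - D s theta x))); last first.
  by apply/funext => y; ring.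
have -> : 2 * (B * (L * r')) * (2 * r') ^+ d * 2^-1 ^+ J =
    2 * (B * (L * (2^-1 ^+ J * r'))) * (2 * r') ^+ d by ring.
apply: cintegral_mul_le => //.
- by rewrite !mulr_ge0.
- by case: bp.
- by apply: lbmB => //; exact: lbm_cst.
move=> y yr; apply: le_trans (HL _ _) _; apply: ler_wpM2l => //.
rewrite normrN normrZ normfV normr_nat natrX exprVn.
by apply: ler_wpM2l.
Qed.

Lemma dconv_mollify u phi theta : is_distribution u -> test phi ->
  cintegral phi = 1 -> test theta -> forall rho, exists2 B, 0 <= B &
  forall J x, `|x| <= rho ->
    cabs (dconv u (conv (dilate J phi) theta) x - dconv u theta x) <= B * 2^-1 ^+ J.
Proof.
move=> Du tp p1 tt rho; have [r r0 [z0 HB]] := mollify tp p1 tt.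
have [c [N [c0 H]]] := dconv_bound Du rho r.
have [||B B0 HB'] := @seq_uniform_bound (fun s B => forall J x,
  cabs (D s (fun x => conv (dilate J phi) theta x - theta x) x) <= B * 2^-1 ^+ J) _ _ N.
- move=> s B B' BB' + J x => /(_ J x)/le_trans; apply; apply: ler_wpM2r => //.
- exact: HB.
exists (c * B); first exact: mulr_ge0.
move=> J x xr; have tc := conv_test (dilate_bms J (test_bms tp)) tt.
rewrite -(dconvB Du _ tc tt) -mulrA; apply: (H _ _ _ xr).
- exact: test_smooth (testB tc tt).
- exact: z0.
- by rewrite mulr_ge0// ltW// geo_gt0.
- by move=> s y sN; exact: HB'.
Qed.

End distributions.

(** * Bounds in Lebesgue norms *)

Section ereal_liminf.
Context {R : realType}.
Local Open Scope ereal_scope.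
Implicit Types (u : (\bar R)^nat) (a : \bar R).

Lemma limn_einf_ge u a N : (forall n, (N <= n)%N -> a <= u n) -> a <= limn_einf u.
Proof.
move=> H; rewrite limn_einf_lim; apply: lime_ge; first exact: is_cvg_einfs.
near=> n; apply: le_ereal_inf_tmp => _ [k /= nk <-]; apply: H.
by apply: leq_trans nk; near: n; exact: nbhs_infty_ge.
Unshelve. all: by end_near. Qed.

Lemma limn_einf_le u a : (forall n, u n <= a) -> limn_einf u <= a.
Proof.
move=> H; rewrite limn_einf_lim; apply: lime_le; first exact: is_cvg_einfs.
near=> n; apply: le_trans (H n); apply: ereal_inf_lbound.
by exists n => //=.
Unshelve. all: by end_near. Qed.

End ereal_liminf.

Section Lp_bounds.
Context {R : realType} {d : nat}.
Local Notation E := 'rV[R]_d.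
Local Notation C := R[i].
Local Notation mu := (lebesgue_rV R d).
Implicit Types (H G T : E -> R) (B : R).

Lemma ler_powR_base (r x y : R) : 1 <= r -> 0 <= x -> x <= y -> x `^ r <= y `^ r.
Proof.
move=> r1 x0 xy; apply: ge0_ler_powR; rewrite ?nnegrE//.
- exact: le_trans ler01 r1.
- exact: le_trans xy.
Qed.

(* For [H >= 0], the bound [||H||_p <= B] without taking roots; at [p = oo] it is
   a bound everywhere, which is the essential one when [H] is continuous. *)
Definition lp_le (p : \bar R) H B : Prop :=
  match p with
  | r%:E => (\int[mu]_x (H x `^ r)%:E <= (B `^ r)%:E)%E
  | +oo%E => forall x, H x <= B
  | -oo%E => False
  end.

Lemma mpowR H (r : R) : measurable_fun setT H ->
  measurable_fun setT (fun x => (H x `^ r)%:E).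
Proof.
move=> mH; apply/measurable_EFinP.
exact: (measurableT_comp (measurable_powR r) mH).
Qed.

Lemma lp_le_mono p H G B : (1 <= p)%E -> measurable_fun setT H ->
  measurable_fun setT G -> (forall x, 0 <= H x <= G x) -> lp_le p G B -> lp_le p H B.
Proof.
move=> p1 mH mG HG; case: p p1 => [r| |//] r1 GB; last first.
  by move=> x; apply: le_trans (GB x); case/andP: (HG x).
rewrite lee_fin in r1; apply: le_trans GB; apply: ge0_le_integral.
- exact: measurableT.
- by move=> x _; rewrite lee_fin powR_ge0.
- exact: mpowR.
- exact: mpowR.
move=> x _; rewrite lee_fin; have /andP[H0 HGx] := HG x.
exact: ler_powR_base.
Qed.

Lemma lp_le_weak p H B B' : (1 <= p)%E -> 0 <= B <= B' -> lp_le p H B -> lp_le p H B'.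
Proof.
move=> p1 /andP[B0 BB]; case: p p1 => [r| |//] r1 HB; last first.
  by move=> x; apply: le_trans (HB x) BB.
rewrite lee_fin in r1.
apply: le_trans HB _; rewrite lee_fin.
exact: ler_powR_base.
Qed.

Lemma lp_le_scale p H B k : (1 <= p)%E -> measurable_fun setT H ->
  (forall x, 0 <= H x) -> 0 <= k -> 0 <= B ->
  lp_le p H B -> lp_le p (fun x => k * H x) (k * B).
Proof.
move=> p1 mH H0 k0 B0; case: p p1 => [r| |//] r1 HB; last first.
  by move=> x; rewrite ler_wpM2l.
rewrite lee_fin in r1; rewrite /lp_le; under eq_integral do rewrite powRM// EFinM.
rewrite ge0_integralZl_EFin//; [|by move=> x _; rewrite lee_fin powR_ge0|
  exact: mpowR|exact: powR_ge0].
by rewrite powRM// EFinM lee_wpmul2l// lee_fin powR_ge0.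
Qed.

Lemma LpNorm_finite_le (r : R) H B : 1 <= r -> measurable_fun setT H ->
  (forall x, 0 <= H x) -> 0 <= B ->
  ('N[mu]_r%:E[EFin \o H] <= B%:E)%E <-> lp_le r%:E H B.
Proof.
move=> r1 mH H0 B0; have r0 : 0 < r by exact: lt_le_trans ltr01 r1.
rewrite unlock /=.
have -> : (\int[mu]_x `|(EFin \o H) x| `^ r = \int[mu]_x (H x `^ r)%:E)%E.
  by apply: eq_integral => x _; rewrite /= ger0_norm.
set I := (\int[mu]_x _)%E; have I0 : (0 <= I)%E.
  by apply: integral_ge0 => x _; rewrite lee_fin powR_ge0.
have mem (y : \bar R) : (0 <= y)%E -> y \in `[0%E, +oo%E].
  by move=> y0; rewrite in_itv/= leey y0.
split=> h.
- have -> : I = ((I `^ r^-1) `^ r)%E.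
    by rewrite -poweRrM mulVf ?gt_eqF// poweRe1.
  rewrite -poweR_EFin; apply: gt0_ler_poweR => //; rewrite ?ltW//.
    by apply: mem; exact: poweR_ge0.
  by apply: mem; rewrite lee_fin.
- have -> : B%:E = ((B `^ r)%:E `^ r^-1)%E.
    by rewrite -poweR_EFin -poweRrM mulfV ?gt_eqF// poweRe1.
  apply: gt0_ler_poweR => //; first by rewrite invr_ge0 ltW.
    exact: mem.
  by apply: mem; rewrite lee_fin powR_ge0.
Qed.

Lemma lp_le_add p H G B B' : (1 <= p)%E -> measurable_fun setT H ->
  measurable_fun setT G -> (forall x, 0 <= H x) -> (forall x, 0 <= G x) ->
  0 <= B -> 0 <= B' -> lp_le p H B -> lp_le p G B' ->
  lp_le p (fun x => H x + G x) (B + B').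
Proof.
move=> p1 mH mG H0 G0 B0 B'0; case: p p1 => [r| |//]; last first.
  by move=> _ h1 h2 x; exact: lerD.
move=> p1 h1 h2; have r1 : 1 <= r by rewrite -lee_fin.
apply/LpNorm_finite_le => //.
- exact: measurable_funD.
- by move=> x; rewrite addr_ge0.
- exact: addr_ge0.
apply: le_trans (eminkowski mu mH mG p1) _; rewrite EFinD; apply: leeD.
  by apply/LpNorm_finite_le.
by apply/LpNorm_finite_le.
Qed.

Lemma lp_le_zero p : (1 <= p)%E -> lp_le p (fun=> 0) 0.
Proof.
case: p => [r| |//] r1 //.
rewrite lee_fin in r1; rewrite /lp_le.
have r0 : r != 0 by rewrite gt_eqF// (lt_le_trans ltr01).
by rewrite powR0// integral0.
Qed.

Lemma lp_le_sum (I : Type) p (s : seq I) (H : I -> E -> R) (B : I -> R) : (1 <= p)%E ->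
  (forall i, measurable_fun setT (H i)) -> (forall i x, 0 <= H i x) ->
  (forall i, 0 <= B i) -> (forall i, lp_le p (H i) (B i)) ->
  lp_le p (fun x => \sum_(i <- s) H i x) (\sum_(i <- s) B i).
Proof.
move=> p1 mH H0 B0 HB; elim: s => [|i s IH].
  under eq_fun do rewrite big_nil; rewrite big_nil; exact: lp_le_zero.
under eq_fun do rewrite big_cons; rewrite big_cons; apply: lp_le_add => //.
- by apply: measurable_sum.
- by move=> x; apply: sumr_ge0.
- exact: sumr_ge0.
Qed.

(* Fatou's lemma with a lossy factor 2, which spares the continuity of powers. *)
Lemma lp_le_fatou p (F : nat -> E -> R) H B : (1 <= p)%E ->
  (forall J, measurable_fun setT (F J)) -> measurable_fun setT H ->
  (forall J x, 0 <= F J x) -> (forall x, 0 <= H x) -> 0 <= B ->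
  (forall x e, 0 < e -> exists N, forall J, (N <= J)%N -> H x <= F J x + e) ->
  (forall J, lp_le p (F J) B) -> lp_le p H (2 * B).
Proof.
move=> p1 mF mH F0 H0 B0 lim; case: p p1 => [r| |//] r1 FB; last first.
  move=> x; apply: (@le_trans _ _ B); last by rewrite ler_peMl// ler1n.
  apply/ler_addgt0Pr => e e0; have [N HN] := lim x e e0.
  by apply: le_trans (HN N (leqnn N)) _; rewrite lerD2r; exact: FB.
rewrite lee_fin in r1; rewrite /lp_le.
have r0 : 0 <= r by exact: le_trans ler01 r1.
suff : (\int[mu]_x ((2^-1 * H x) `^ r)%:E <= (B `^ r)%:E)%E.
  under eq_integral do rewrite powRM// EFinM.
  rewrite ge0_integralZl_EFin//; do ?[exact: mpowR|exact: powR_ge0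
    |by move=> x _; rewrite lee_fin powR_ge0].
  move=> h; have := lee_wpmul2l (x := (2 `^ r)%:E) _ h.
  rewrite lee_fin powR_ge0 => /(_ isT).
  rewrite muleA -!EFinM -!powRM// divff// powR1 mul1e.
  by [].
have := fatou mu measurableT (f := fun J x => (F J x `^ r)%:E) (fun J => mpowR r (mF J))
  (fun J x _ => ltac:(by rewrite lee_fin powR_ge0)).
move=> h; apply: le_trans (le_trans h _); last first.
  by apply: limn_einf_le => J; exact: FB.
apply: ge0_le_integral => //.
- by move=> x _; rewrite lee_fin powR_ge0.
- by apply: mpowR; exact: measurable_funM.
- under eq_fun do rewrite -[limn_einf _]oppeK -limn_esupN.
  apply: measurableT_comp => //; apply: measurable_fun_limn_esup => J.
  by apply: measurableT_comp => //; exact: mpowR.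
(* Where [H x > 0], the choice [e = H x / 2] gives [F J x >= H x / 2] for large [J]; where [H x = 0]
   the bound is trivial. Hence half of [H] lies below the lower limit, and no limit is taken inside
   the power. *)
move=> x _; have [Hx|Hx] := eqVneq (H x) 0.
  apply: (@limn_einf_ge _ _ _ 0) => n _.
  by rewrite Hx mulr0 lee_fin; exact: ler_powR_base.
have Hx0 : 0 < H x by rewrite lt_neqAle eq_sym Hx H0.
have [|N HN] := lim x (H x / 2); first by rewrite divr_gt0.
apply: (@limn_einf_ge _ _ _ N) => n nN; rewrite lee_fin.
apply: ler_powR_base => //; first by rewrite mulr_ge0.
by have := HN n nN; lra.
Qed.

(** Either [a <= l], or [a / l >= 1] lies below its own power of exponent [r >= 1]. *)
Lemma le_powR_split (a l r : R) : 0 <= a -> 0 < l -> 1 <= r ->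
  a <= l + l / (l `^ r) * a `^ r.
Proof.
move=> a0 l0 r1; have lr0 : 0 < l `^ r by exact: powR_gt0.
have k0 : 0 <= l / l `^ r * a `^ r.
  by rewrite mulr_ge0 ?powR_ge0// divr_ge0 ?ltW.
have [al|la] := leP a l; first by rewrite ler_wpDr.
have al1 : 1 <= a / l by rewrite ler_pdivlMr// mul1r ltW.
have H : a / l <= (a / l) `^ r.
  by rewrite -[leLHS](@powRr1 _ (a / l)) ?divr_ge0 ?(ltW l0)//; exact: ler_powR.
have E1 : a `^ r = (a / l) `^ r * l `^ r.
  by rewrite -powRM ?divr_ge0 ?(ltW l0)// divfK// gt_eqF.
rewrite E1 mulrCA divfK ?gt_eqF//; move: H; rewrite ler_pdivrMr// => H.
by apply: le_trans H _; rewrite lerDr ltW.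
Qed.

Definition ball0 (rho : R) : set E := [set y | `|y| <= rho].

(* Jensen without convexity: [a <= l + l^(1-r) a^r] is integrated and [l] is
   optimized at the end, at the price of a constant. *)
Lemma powR_average (rho r : R) (g : E -> R) (T : R) : 0 < rho -> 1 <= r ->
  measurable_fun setT g -> (forall y, 0 <= g y) -> 0 <= T ->
  (T%:E <= \int[mu]_(y in ball0 rho) (g y)%:E)%E ->
  ((T `^ r)%:E <= ((2 * (2 * rho) ^+ d) `^ r / (2 * rho) ^+ d)%:E *
     \int[mu]_(y in ball0 rho) (g y `^ r)%:E)%E.
Proof.
move=> rho0 r1 mg g0 T0 HT; set V := (2 * rho) ^+ d.
have V0 : 0 < V by rewrite exprn_gt0// mulr_gt0.
have r0 : 0 < r by exact: lt_le_trans ltr01 r1.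
have K0 : 0 < (2 * V) `^ r / V by rewrite divr_gt0// powR_gt0// mulr_gt0.
have mQ : measurable (ball0 rho) by exact: measurable_ball_rV.
have muQ : mu (ball0 rho) = V%:E by rewrite lebesgue_rV_ball// ltW.
have mgr : measurable_fun (ball0 rho) (fun y => (g y `^ r)%:E).
  by apply: measurable_funTS; exact: mpowR.
set I := (\int[mu]_(y in ball0 rho) (g y `^ r)%:E)%E.
have I0 : (0 <= I)%E by apply: integral_ge0 => y _; rewrite lee_fin powR_ge0.
case EI : I I0 => [i| |]// I0; last by rewrite gt0_muley ?leey// lte_fin.
have i0 : 0 <= i by rewrite -lee_fin.
have key l : 0 < l -> T <= l * V + l / (l `^ r) * i.
  move=> l0; have lr0 : 0 < l `^ r by exact: powR_gt0.
  have k0 : 0 <= l / l `^ r by rewrite divr_ge0 ?ltW.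
  rewrite -lee_fin; apply: le_trans HT _.
  apply: (@le_trans _ _ (\int[mu]_(y in ball0 rho)
     (l%:E + (l / (l `^ r))%:E * (g y `^ r)%:E))%E).
    apply: ge0_le_integral => //.
    - by move=> y _; rewrite lee_fin.
    - by apply: measurable_funTS; apply/measurable_EFinP.
    - by apply: emeasurable_funD => //; exact: emeasurable_funM.
    - by move=> y _; rewrite -EFinM -EFinD lee_fin le_powR_split.
  rewrite ge0_integralD//; first last.
  - exact: emeasurable_funM.
  - by move=> y _; rewrite -EFinM lee_fin mulr_ge0// powR_ge0.
  - by move=> y _; rewrite lee_fin ltW.
  rewrite ge0_integralZl_EFin//; last by move=> y _; rewrite lee_fin powR_ge0.
  have -> : (\int[mu]_(_ in ball0 rho) l%:E = l%:E * V%:E)%E.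
    by rewrite -muQ; exact: (integral_cst mu mQ l%:E).
  by rewrite -/I EI -!EFinM -EFinD.
rewrite -EFinM lee_fin.
have [iz|iz] := eqVneq i 0.
  have -> : T = 0.
    apply/eqP; rewrite eq_le T0 andbT; apply/ler_addgt0Pr => e e0.
    have := key (e / V); rewrite divr_gt0// => /(_ isT).
    by rewrite iz mulr0 addr0 divfK ?gt_eqF// add0r.
  by rewrite powR0 ?gt_eqF// mulr_ge0// ltW.
have ip : 0 < i by rewrite lt_neqAle eq_sym iz.
(* This value makes the two terms of [key] equal, each being [l V]; the factor 2 of the conclusion
   is their sum. *)
pose l := (i / V) `^ r^-1.
have iV0 : 0 < i / V by rewrite divr_gt0.
have l0 : 0 < l by exact: powR_gt0.
have lr : l `^ r = i / V by rewrite -powRrM mulVf ?gt_eqF// powRr1// ltW.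
have HTl : T <= 2 * V * l.
  apply: le_trans (key l l0) _; rewrite lr.
  rewrite le_eqVlt; apply/orP; left; apply/eqP; field.
  by rewrite gt_eqF//= gt_eqF.
apply: (@le_trans _ _ ((2 * V * l) `^ r)).
  exact: ler_powR_base.
by rewrite powRM ?lr ?mulr_ge0 ?(ltW V0) ?(ltW l0)// mulrA mulrAC.
Qed.

Lemma ge0_integral_reflect (F : E -> \bar R) (x : E) : measurable_fun setT F ->
  (forall y, (0 <= F y)%E) -> (\int[mu]_y F (x - y)%R = \int[mu]_y F y)%E.
Proof.
move=> mF F0; have := @ge0_integral_affine R d x (-1) F.
rewrite oppr_eq0 oner_eq0 => /(_ isT mF F0).
rewrite normrN normr1 expr1n invr1 mul1e => <-.
by apply: eq_integral => y _; rewrite scaleN1r.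
Qed.

Lemma ge0_integral_shift (F : E -> \bar R) (x : E) : measurable_fun setT F ->
  (forall y, (0 <= F y)%E) -> (\int[mu]_y F (y - x)%R = \int[mu]_y F y)%E.
Proof.
move=> mF F0; have := @ge0_integral_affine R d (- x) 1 F.
rewrite oner_eq0 => /(_ isT mF F0).
rewrite normr1 expr1n invr1 mul1e => <-.
by apply: eq_integral => y _; rewrite scale1r addrC.
Qed.

Lemma measurable_reflect (H : E -> R) (x : E) : measurable_fun setT H ->
  measurable_fun setT (fun y : E => H (x - y)).
Proof.
move=> mH; have := measurableT_comp mH (measurable_affine_rV x (-1)).
by rewrite (_ : H \o _ = (fun y => H (x - y)))//; apply/funext => y /=; rewrite scaleN1r.
Qed.

(* Pointwise domination by a local average is what survives both weights and
   Lebesgue norms. *)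
Definition avg_le (rho : R) T G := forall x,
  ((T x)%:E <= \int[mu]_(y in ball0 rho) (G (x - y))%:E)%E.

Lemma avg_le_sup rho T G B x : 0 <= rho -> measurable_fun setT G ->
  (forall y, 0 <= G y) -> avg_le rho T G ->
  (forall y, G y <= B) -> T x <= B * (2 * rho) ^+ d.
Proof.
move=> r0 mG G0 TG GB; rewrite -lee_fin; apply: le_trans (TG x) _.
rewrite EFinM -lebesgue_rV_ball// -(integral_cst mu (measurable_ball_rV rho)).
apply: ge0_le_integral => //; first exact: measurable_ball_rV.
- by move=> y _; rewrite lee_fin.
- by apply: measurable_funTS; apply/measurable_EFinP; exact: measurable_reflect.
- by move=> y _; rewrite lee_fin.
Qed.

(** [powR_average] is applied at each point and the order of integration exchanged: every translate
    of [G] has the norm of [G], and the ball has volume [V]. The constants combine as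
    [(2 V)^r / V * V = (2 V)^r]. *)
Lemma lp_le_avg p rho T G B : (1 <= p)%E -> 0 < rho -> measurable_fun setT T ->
  measurable_fun setT G -> (forall x, 0 <= T x) -> (forall x, 0 <= G x) -> 0 <= B ->
  avg_le rho T G -> lp_le p G B -> lp_le p T (2 * (2 * rho) ^+ d * B).
Proof.
move=> p1 rho0 mT mG T0 G0 B0 TG; set V := (2 * rho) ^+ d.
have V0 : 0 < V by rewrite exprn_gt0// mulr_gt0.
case: p p1 => [r| |//] r1 GB; last first.
  move=> x; have h := avg_le_sup x (ltW rho0) mG G0 TG GB; rewrite -/V in h.
  by apply: le_trans h _; rewrite mulrC -mulrA ler_peMl ?ler1n// mulr_ge0// ltW.
rewrite lee_fin in r1; rewrite /lp_le.
have K0 : 0 <= (2 * V) `^ r / V by rewrite divr_ge0 ?powR_ge0// ltW.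
have mQ : measurable (ball0 rho) by exact: measurable_ball_rV.
pose W (z : E * E) : \bar R := if `|z.2| <= rho then (G (z.1 - z.2) `^ r)%:E else 0%E.
have W0 z : (0 <= W z)%E by rewrite /W; case: ifP => // _; rewrite lee_fin powR_ge0.
have mW : measurable_fun setT W.
  apply: measurable_fun_ifT => //.
    apply: measurable_fun_ler => //.
    apply: (measurableT_comp (f := fun y : E => `|y|)) => //.
    by apply: continuous_measurable_rV; exact: norm_continuous.
  have msub : measurable_fun setT (fun z : E * E => z.1 - z.2).
    apply: measurable_fun_rV => i; under eq_fun do rewrite !mxE.
    by apply: measurable_funB; exact: (measurableT_comp (measurable_coordR i)).
  exact: (measurableT_comp (mpowR r mG) msub).
have WE x y : (W (x, y) = (fun y => (G (x - y) `^ r)%:E) \_ (ball0 rho) y).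
  rewrite patchE /W /=; case: ifPn => h; first by rewrite mem_set.
  by rewrite memNset//; exact/negP.
have -> : ((2 * V * B) `^ r)%:E = (((2 * V) `^ r / V)%:E * (V * B `^ r)%:E)%E.
  have V20 : 0 <= 2 * V by rewrite mulr_ge0// ltW.
  by rewrite -EFinM (powRM _ V20 B0) mulrA divfK// gt_eqF.
apply: (@le_trans _ _ (((2 * V) `^ r / V)%:E * \int[mu]_x \int[mu]_y W (x, y))%E).
  rewrite -ge0_integralZl_EFin//; first last.
  - by have := measurable_fun_fubini_tonelli_F (m2 := mu) W mW W0.
  - by move=> x _; apply: integral_ge0.
  apply: ge0_le_integral => //.
  - by move=> x _; rewrite lee_fin powR_ge0.
  - exact: mpowR.
  - apply: emeasurable_funM => //.
    by have := measurable_fun_fubini_tonelli_F (m2 := mu) W mW W0.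
  move=> x _; apply: le_trans (powR_average rho0 r1 (measurable_reflect x mG) _ _ (TG x)) _ => //.
  apply: lee_wpmul2l; first by rewrite lee_fin.
  by rewrite integral_mkcond; under [leRHS]eq_integral do rewrite WE.
apply: lee_wpmul2l; first by rewrite lee_fin.
have := fubini_tonelli (m1 := mu) (m2 := mu) W mW W0; rewrite /fubini_F /fubini_G => ->.
have -> : ((V * B `^ r)%:E = \int[mu]_y (cst (B `^ r)%:E \_ (ball0 rho)) y)%E.
  have muQ : mu (ball0 rho) = V%:E by rewrite lebesgue_rV_ball// ltW.
  rewrite -integral_mkcond; apply/esym; apply: etrans (integral_cst mu mQ (B `^ r)%:E) _.
  by rewrite [X in (_ * X)%E]muQ -EFinM mulrC.
apply: ge0_le_integral => //.
- by move=> y _; apply: integral_ge0.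
- by have := measurable_fun_fubini_tonelli_G (m1 := mu) W mW W0.
- by apply/(measurable_restrictT _ mQ); exact: measurable_cst.
move=> y _; rewrite patchE; case: ifPn => yQ; last first.
  rewrite integral0_eq// => x _; rewrite /W /=.
  by case: ifPn => // h; move: yQ; rewrite mem_set.
rewrite /cst; apply: le_trans GB.
rewrite -(ge0_integral_shift y (mpowR r mG)); last by move=> x; rewrite lee_fin powR_ge0.
apply: ge0_le_integral => //.
- by apply: (measurableT_comp mW); apply: measurable_fun_pair.
- have := measurableT_comp (mpowR r mG) (measurable_affine_rV (- y) 1).
  rewrite (_ : _ \o _ = (fun x => (G (x - y) `^ r)%:E))//.
  by apply/funext => x /=; rewrite scale1r addrC.
by move=> x _; rewrite /W /=; case: ifP => // _; rewrite lee_fin powR_ge0.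
Qed.

(** A Lebesgue bound on [G] controls a function dominated by its averages at every point. The
    telescoping series thereby converges locally uniformly, and not only in norm. *)
Lemma lp_le_local p rho : (1 <= p)%E -> 0 < rho -> exists2 K, 0 <= K &
  forall T G B x, measurable_fun setT G -> 0 <= T x -> (forall x, 0 <= G x) -> 0 <= B ->
  avg_le rho T G -> lp_le p G B -> T x <= K * B.
Proof.
move=> p1 rho0; set V := (2 * rho) ^+ d.
have V0 : 0 < V by rewrite exprn_gt0// mulr_gt0.
case: p p1 => [r| |//] r1; last first.
  exists V; first exact: ltW.
  move=> T G B x mG T0 G0 B0 TG GB; rewrite mulrC.
  by exact: (avg_le_sup x (ltW rho0) mG G0 TG GB).
rewrite lee_fin in r1.
have r0 : 0 < r by exact: lt_le_trans ltr01 r1.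
set K := (2 * V) `^ r / V.
have K0 : 0 <= K by rewrite divr_ge0 ?powR_ge0// ltW.
have mQ : measurable (ball0 rho) by exact: measurable_ball_rV.
exists (K `^ r^-1); first exact: powR_ge0.
move=> T G B x mG T0 G0 B0 TG GB.
have h : T x `^ r <= K * B `^ r.
  rewrite -lee_fin; apply: le_trans (powR_average rho0 r1 (measurable_reflect x mG) _ _ (TG x)) _ => //.
  rewrite -/V -/K (EFinM K); apply: lee_wpmul2l; first by rewrite lee_fin.
  apply: le_trans GB; rewrite -(ge0_integral_reflect x (mpowR r mG)); last first.
    by move=> y; rewrite lee_fin powR_ge0.
  apply: ge0_subset_integral => //.
  - by apply: mpowR; exact: measurable_reflect.
  - by move=> y _; rewrite lee_fin powR_ge0.
have inv a : 0 <= a -> a = (a `^ r) `^ r^-1.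
  by move=> a0; rewrite -powRrM mulfV ?gt_eqF// powRr1.
rewrite (inv _ T0) (inv _ B0) -powRM ?powR_ge0//.
apply: ge0_ler_powR => //; rewrite ?nnegrE ?powR_ge0 ?invr_ge0 ?(ltW r0)//.
by rewrite mulr_ge0// powR_ge0.
Qed.

Lemma mu_setT_gt0 : (0 < mu setT)%E.
Proof.
apply: (@lt_le_trans _ _ (mu (ball0 1))).
  by rewrite lebesgue_rV_ball// lte_fin exprn_gt0// mulr1.
by apply: le_measure; rewrite ?inE//; exact: measurable_ball_rV.
Qed.

(** By continuity a violation at one point persists on a ball, which has positive measure and cannot
    lie in a null set. *)
Lemma ae_le_continuous H B : continuous H -> (\forall x \ae mu, H x <= B) ->
  forall x, H x <= B.
Proof.
move=> /real_contP cH [A [mA A0 HA]] x; rewrite leNgt; apply/negP => Bx.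
have [|dl dl0 Hd] := cH x ((H x - B) / 2); first by rewrite divr_gt0// subr_gt0.
pose e := dl / 2; have e0 : 0 < e by rewrite divr_gt0.
have sub : (fun y => x - y) @` ball0 e `<=` A.
  move=> _ [y ye <-]; apply: HA => /= hy.
  have := Hd (- y); rewrite normrN => /(_ (le_lt_trans ye _)).
  have edl : e < dl by rewrite /e; move: dl0; lra.
  by move=> /(_ edl); rewrite ler_norml => /andP[]; move: Bx hy; lra.
have : (mu (ball0 e) <= mu A)%E.
  rewrite -[mu A]mul1e -[mu (ball0 e)]mul1e.
  have mB : measurable (ball0 e) by exact: measurable_ball_rV.
  rewrite -!integral_cst// [X in (X <= _)%E]integral_mkcond [X in (_ <= X)%E]integral_mkcond.
  rewrite -[X in (_ <= X)%E](ge0_integral_reflect x); first last.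
  - by move=> y; rewrite patchE; case: ifP.
  - by apply/(measurable_restrictT _ mA); exact: measurable_cst.
  apply: ge0_le_integral => //.
  - by move=> y _; rewrite patchE; case: ifP.
  - by apply/(measurable_restrictT _ mB); exact: measurable_cst.
  - have := measurableT_comp (proj1 (measurable_restrictT (cst 1%E : E -> \bar R) mA)
      (measurable_cst _)) (measurable_affine_rV x (-1)).
    by rewrite (_ : _ \o _ = (fun y => (cst 1%E \_ A) (x - y)))//;
      apply/funext => y /=; rewrite scaleN1r.
  move=> y _; rewrite !patchE; case: ifPn => [|_]; last by case: ifP.
  by rewrite inE => yQ; rewrite mem_set//; apply: sub; exists y.
have muQ : mu (ball0 e) = ((2 * e) ^+ d)%:E by rewrite lebesgue_rV_ball// ltW.
rewrite A0 [X in (X <= _)%E]muQ => h; have : (((2 * e) ^+ d)%:E <= 0%:E)%E by [].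
by rewrite lee_fin leNgt exprn_gt0// mulr_gt0.
Qed.

Lemma LpNormP p (F : E -> C) B : (1 <= p)%E -> ccont F -> 0 <= B ->
  (LpNorm p F <= B%:E)%E <-> lp_le p (fun x => cabs (F x)) B.
Proof.
move=> p1 cF B0; have mF := cmeas_cabs (ccont_cmeas cF).
rewrite /LpNorm; case: p p1 => [r| |]// p1.
  by apply: LpNorm_finite_le => // x; exact: cabs_ge0.
rewrite unlock mu_setT_gt0.
have cc : continuous (fun x => cabs (F x)).
  apply/real_contP => x e e0; have [dl dl0 Hd] := cF x e e0.
  exists dl => // v vd; apply: le_trans (Hd v vd); rewrite ler_norml.
  have := cabsD (F (x + v) - F x) (F x); have := cabsD (F x - F (x + v)) (F (x + v)).
  by rewrite !subrK (cabsBC (F x)); lra.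
split=> [/ess_sup_inf.ess_supP h|/= h].
  apply: ae_le_continuous => //; apply: filterS h => x /=.
  by rewrite lee_fin ger0_norm ?cabs_ge0.
apply/ess_sup_inf.ess_supP; apply: nearW => x /=.
by rewrite lee_fin ger0_norm ?cabs_ge0.
Qed.

Lemma LpNorm_finiteP p (F : E -> C) : (1 <= p)%E -> ccont F ->
  (LpNorm p F < +oo)%E <-> exists2 B, 0 <= B & lp_le p (fun x => cabs (F x)) B.
Proof.
move=> p1 cF; have N0 : (0 <= LpNorm p F)%E by exact: Lnorm_ge0.
split=> [|[B B0 /(LpNormP p1 cF B0) h]]; last exact: le_lt_trans h (ltry _).
case E0 : (LpNorm p F) N0 => [B| |]// B0 _; exists B => //.
by apply/LpNormP => //; rewrite E0.
Qed.

End Lp_bounds.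

(** * A Sobolev inequality *)

Section sobolev.
Context {R : realType}.
Local Notation lambda := (@lebesgue_measure R).
Local Notation mu n := (lebesgue_rV R n).

(** The fundamental theorem on [[0, t]], with the domain enlarged to [[0, 1]] so that the integral
    no longer depends on [t]. *)
Lemma ftc_le (k k' : R -> R) (t : R) : 0 <= t <= 1 ->
  (forall s : R, is_derive s 1 k (k' s)) -> continuous k' ->
  ((`|k 0|)%:E <= (`|k t|)%:E + \int[lambda]_(s in `[0%R, 1%R]) (`|k' s|)%:E)%E.
Proof.
move=> /andP[t0 t1] dk ck'.
have mk' := continuous_measurable_fun ck'.
have [->|tn0] := eqVneq t 0.
  by apply: leeDl; apply: integral_ge0 => s _; rewrite lee_fin.
have tp : 0 < t by rewrite lt_neqAle eq_sym tn0.
have ck : continuous k.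
  by move=> s; apply/differentiable_continuous/derivable1_diffP; case: (dk s).
have := @continuous_FTC2 R k' k 0 t tp (continuous_subspaceT ck').
have dkb : derivable_oo_LRcontinuous k 0 t.
  split.
  - by move=> s _; case: (dk s).
  - exact: cvg_at_right_filter (ck 0).
  - exact: cvg_at_left_filter (ck t).
move=> /(_ dkb) H.
have {}H : (\int[lambda]_(s in `[0%R, t]) (k' s)%:E = (k t - k 0)%:E)%E.
  by apply: H => s _; rewrite derive1E; exact: derive_val.
apply: (@le_trans _ _ ((`|k t|)%:E + (`|k t - k 0|)%:E)%E).
  by rewrite -EFinD lee_fin; have := ler_distD (k t) (k 0) 0; rewrite !subr0 distrC addrC.
apply: leeD => //; rewrite -abse_EFin -H.
apply: (@le_trans _ _ (\int[lambda]_(s in `[0%R, t]) (`|k' s|)%:E)%E).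
  apply: le_abse_integral => //.
  by apply: measurable_funTS; apply/measurable_EFinP.
apply: ge0_subset_integral => //.
- apply: measurable_funTS; apply/measurable_EFinP.
  exact: (measurableT_comp (@normr_measurable _ _)).
- by apply: subset_itv; rewrite bnd_simp.
Qed.

(** The inequality [ftc_le] is averaged over [t] in the unit interval. *)
Lemma sobolev1 (k k' : R -> R) :
  (forall s : R, is_derive s 1 k (k' s)) -> continuous k' ->
  ((`|k 0|)%:E <= \int[lambda]_(s in `[0%R, 1%R]) (`|k s| + `|k' s|)%:E)%E.
Proof.
move=> dk ck'.
have mk' := continuous_measurable_fun ck'.
have mk : measurable_fun setT k.
  apply: continuous_measurable_fun => s.
  by apply/differentiable_continuous/derivable1_diffP; case: (dk s).
have mI (h : R -> R) : measurable_fun setT h ->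
    measurable_fun (`[(0 : R), 1]%classic : set (measurableTypeR R)) (fun s => (`|h s|)%:E).
  move=> mh; apply: measurable_funTS; apply/measurable_EFinP.
  exact: (measurableT_comp (@normr_measurable _ _)).
have mI01 : measurable (`[(0 : R), 1]%classic : set (measurableTypeR R)) by [].
have l1 (a : \bar R) : (\int[lambda]_(s in `[0%R, 1%R]) a = a)%E.
  apply: etrans (integral_cst lambda mI01 a) _.
  have L1 : lambda `[(0 : R), 1]%classic = 1%E.
    by rewrite lebesgue_measure_itv/= lte_fin ltr01 oppr0 adde0.
  by rewrite [X in (_ * X)%E]L1 mule1.
under eq_integral do rewrite EFinD.
rewrite ge0_integralD//; [|exact: mI..].
set M := (\int[lambda]_(s in _) (`|k' s|)%:E)%E.
have M0 : (0 <= M)%E by apply: integral_ge0 => ? _; rewrite lee_fin.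
have -> : (\int[lambda]_(s in `[0%R, 1%R]) (`|k s|)%:E + M =
    \int[lambda]_(s in `[0%R, 1%R]) ((`|k s|)%:E + M))%E.
  by rewrite ge0_integralD//; [rewrite l1|exact: mI].
rewrite -[leLHS]l1; apply: ge0_le_integral => //.

- by apply: emeasurable_funD => //; exact: mI.
by move=> s; rewrite /= in_itv/= => /ftc_le; apply.
Qed.

Lemma rV_cons_shift n (t s : R) (v w : 'rV[R]_n) :
  rV_cons (t + s, v + w) = rV_cons (t, v) + rV_cons (s, w).
Proof.
apply/rowP => i; rewrite /rV_cons !mxE.
by case: (unliftP ord0 i) => [j _|_]; rewrite ?mxE.
Qed.

Lemma rV_cons_norm n (t : R) (v : 'rV[R]_n) (B : R) : 0 <= B ->
  (`|rV_cons (t, v) : 'rV[R]_n.+1| <= B) = (`|t| <= B) && (`|v| <= B).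
Proof.
move=> B0; apply/idP/andP => [h|[ht hv]].
  split.
    by have := le_trans (coord_le_norm (rV_cons (t, v)) ord0) h; rewrite mxE unlift_none.
  apply: norm_le_coord => // i.
  by have := le_trans (coord_le_norm (rV_cons (t, v)) (lift ord0 i)) h; rewrite mxE liftK.
apply: norm_le_coord => // i; rewrite mxE.
case: (unliftP ord0 i) => [j _|_]//=.
exact: le_trans (coord_le_norm v j) hv.
Qed.

Lemma rV_cons_delta_lift n (s : R) (j : 'I_n) :
  rV_cons (0, s *: delta_mx ord0 j) = s *: delta_mx ord0 (lift ord0 j) :> 'rV[R]_n.+1.
Proof.
apply/rowP => i; rewrite /rV_cons !mxE.
case: (unliftP ord0 i) => [l ->|->]; rewrite ?liftK ?unlift_none ?mxE /=.
  by rewrite (inj_eq (@lift_inj _ ord0)).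
by rewrite ?(negbTE (neq_lift _ _)) ?mulr0.
Qed.

Lemma rV_cons_delta0 n (s : R) :
  rV_cons (s, 0) = s *: delta_mx ord0 ord0 :> 'rV[R]_n.+1.
Proof.
apply/rowP => i; rewrite /rV_cons !mxE.
case: (unliftP ord0 i) => [l ->|->]; rewrite ?liftK ?unlift_none ?mxE /=.
  by rewrite ?[_ == ord0]eq_sym ?(negbTE (neq_lift _ _)) ?mulr0.
by rewrite mulr1.
Qed.

Lemma continuous_rV_cons n (h : 'rV[R]_n.+1 -> R) (t : R) : continuous h ->
  continuous (fun v : 'rV[R]_n => h (rV_cons (t, v))).
Proof.
move=> /real_contP ch; apply/real_contP => x e e0.
have [dl dl0 K] := ch (rV_cons (t, x)) e e0.
exists (dl / 2); first by rewrite divr_gt0.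
move=> v vd; have := K (rV_cons (0, v)); rewrite -rV_cons_shift addr0; apply.
have : `|rV_cons (0, v) : 'rV[R]_n.+1| <= dl / 2.
  by rewrite rV_cons_norm ?normr0 ?(ltW vd) ?andbT// ltW// divr_gt0.
by move=> /le_lt_trans; apply; rewrite gtr_pMr// invf_lt1// ltr1n.
Qed.

(* For an abstract family of derivatives rather than for the derivatives of one
   function, so that the induction can restrict it to hyperplanes. *)
Lemma sobolev_family n : exists Bs : seq (seq 'I_n),
  forall H : seq 'I_n -> 'rV[R]_n -> R, (forall b, continuous (H b)) ->
  (forall b i x, is_derive x (delta_mx ord0 i) (H b) (H (i :: b) x)) ->
  ((`|H [::] 0|)%:E <= \int[mu n]_(y in ball0 1) (\sum_(b <- Bs) `|H b y|)%:E)%E.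
Proof.
elim: n => [|n [Bs IH]].
  exists [:: [::]] => H cH _.
  have mB : measurable (ball0 1 : set 'rV[R]_0) by exact: measurable_ball_rV.
  rewrite [leRHS](integral_dirac _ mB); last first.
    apply: measurable_funTS; apply/measurable_EFinP.
    under eq_fun do rewrite big_seq1.
    exact: continuous_measurable_rV (cont_normr (cH _)).
  rewrite big_seq1 diracE mem_set ?mul1e//= /ball0 /= normr0//.
pose lf (b : seq 'I_n) := map (lift ord0) b.
(* The one-variable inequality in the first coordinate costs at most one derivative there. It comes
   last in the word, that is, it is taken first; the derivatives along the hyperplane are put on top
   of it. *)
exists ([seq lf b | b <- Bs] ++ [seq lf b ++ [:: ord0] | b <- Bs]) => H cH dH.
set Cs := _ ++ _.
have mB : measurable (ball0 1 : set 'rV[R]_n.+1) by exact: measurable_ball_rV.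
have mBn : measurable (ball0 1 : set 'rV[R]_n) by exact: measurable_ball_rV.
have mS (I : Type) m (r : seq I) (F : I -> 'rV[R]_m -> R) : (forall b, continuous (F b)) ->
    measurable_fun setT (fun y => (\sum_(b <- r) `|F b y|)%:E).
  move=> cF; apply/measurable_EFinP; apply: measurable_sum => b.
  exact: continuous_measurable_rV (cont_normr (cF b)).
have S0 (I : Type) m (r : seq I) (F : I -> 'rV[R]_m -> R) y :
    (0 <= (\sum_(b <- r) `|F b y|)%:E)%E.
  by rewrite lee_fin sumr_ge0.
pose W := (fun y => (\sum_(b <- Cs) `|H b y|)%:E) \_ (ball0 1 : set 'rV[R]_n.+1).
have mW : measurable_fun setT W.
  by apply/(measurable_restrictT _ mB); apply: measurable_funTS; exact: mS.
have W0 x : (0 <= W x)%E by rewrite /W patchE; case: ifP.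
rewrite integral_mkcond (integral_rV_succ mW W0).
pose k t := H [::] (rV_cons (t, 0 : 'rV[R]_n)).
pose k' t := H [:: ord0] (rV_cons (t, 0 : 'rV[R]_n)).
have dk (s : R) : is_derive s 1 k (k' s).
  apply/is_deriveP => e e0.
  have /is_deriveP/(_ e e0)[dl dl0 K] := dH [::] ord0 (rV_cons (s, 0 : 'rV[R]_n)).
  exists dl => // t td; have := K t td.
  by rewrite -rV_cons_delta0 -rV_cons_shift addr0 /k /k' -[t *: 1]/(t * 1) mulr1.
have ck' : continuous k'.
  move=> t; apply/cvgrPdist_le => /= e e0.
  have [dl dl0 K] := (real_contP _).1 (cH [:: ord0]) (rV_cons (t, 0 : 'rV[R]_n)) e e0.
  apply/nbhs_ballP; exists (dl / 2); first by rewrite /= divr_gt0.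
  move=> s /= ts; have := K (rV_cons (s - t, 0)).
  rewrite -rV_cons_shift addr0 [t + _]addrC subrK => hs; rewrite distrC; apply: hs.
  have : `|rV_cons (s - t, 0) : 'rV[R]_n.+1| <= dl / 2.
    rewrite rV_cons_norm ?normr0 ?(ltW (divr_gt0 dl0 _))//.
    by rewrite andbT distrC; exact: ltW ts.
  by move=> /le_lt_trans; apply; rewrite gtr_pMr// invf_lt1// ltr1n.
have H0 : H [::] 0 = k 0.
  rewrite /k; congr (H _ _); apply/rowP => i; rewrite /rV_cons !mxE.
  by case: unliftP => //= ? _; rewrite mxE.
rewrite H0; apply: le_trans (sobolev1 dk ck') _.
have mF : measurable_fun setT (fun t : R => (\int[mu n]_v W (rV_cons (t, v)))%E).
  have mWc := measurableT_comp mW (@measurable_rV_cons R n).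
  have := measurable_fun_fubini_tonelli_F (m2 := mu n) (W \o @rV_cons R n) mWc (fun x => W0 _).
  by [].
apply: (@le_trans _ _ (\int[lambda]_(t in `[0%R, 1%R]) \int[mu n]_v W (rV_cons (t, v)))%E);
  last first.
  by apply: ge0_subset_integral => // t _; apply: integral_ge0.
apply: ge0_le_integral => //.
- apply: measurable_funTS; apply/measurable_EFinP; apply: measurable_funD.
    apply: (measurableT_comp (@normr_measurable _ _)); apply: continuous_measurable_fun => s.
    by apply/differentiable_continuous/derivable1_diffP; case: (dk s).
  by apply: (measurableT_comp (@normr_measurable _ _)); exact: continuous_measurable_fun.
- exact: measurable_funTS.
move=> t; rewrite /= in_itv/= => /andP[t0 t1].
(* The induction hypothesis on the hyperplane at height [t], needed for the function itself ([suf]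
   empty) and for its derivative in the first coordinate. *)
have IHt (suf : seq 'I_n.+1) :
  ((`|H suf (rV_cons (t, 0))|)%:E <=
   \int[mu n]_(v in ball0 1) (\sum_(b <- Bs) `|H (lf b ++ suf) (rV_cons (t, v))|)%:E)%E.
  apply: (IH (fun b v => H (lf b ++ suf) (rV_cons (t, v)))).
    by move=> b; exact: continuous_rV_cons.
  move=> b i x; apply/is_deriveP => e e0.
  have /is_deriveP/(_ e e0)[dl dl0 K] := dH (lf b ++ suf) (lift ord0 i) (rV_cons (t, x)).
  exists dl => // s sd; have := K s sd.
  by rewrite -rV_cons_delta_lift -rV_cons_shift addr0.
rewrite EFinD; apply: le_trans (leeD (IHt [::]) (IHt [:: ord0])) _.
have mSb suf : measurable_fun (ball0 1 : set 'rV[R]_n)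
    (fun v => (\sum_(b <- Bs) `|H (lf b ++ suf) (rV_cons (t, v))|)%:E).
  by apply: measurable_funTS; apply: mS => b; exact: continuous_rV_cons.
have S0b suf v : ball0 1 v ->
    (0 <= (\sum_(b <- Bs) `|H (lf b ++ suf) (rV_cons (t, v))|)%:E)%E.
  by rewrite lee_fin sumr_ge0.
rewrite -(ge0_integralD (mu n) mBn (S0b [::]) (mSb [::]) (S0b [:: ord0]) (mSb [:: ord0])).
rewrite integral_mkcond; apply: ge0_le_integral => //.
- move=> v _; rewrite patchE; case: ifPn => // vB.
  by move: vB; rewrite inE => vB; apply: adde_ge0; exact: (S0b _ _ vB).
- by apply/(measurable_restrictT _ mBn); apply: emeasurable_funD; exact: mSb.
- exact: (measurableT_comp (measurableT_comp mW (@measurable_rV_cons R n)) (measurable_pair1 t)).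
move=> v _; rewrite patchE; case: ifPn => // vB.
rewrite /W patchE mem_set; last first.
  by rewrite /ball0 /= rV_cons_norm// ger0_norm// t1; move: vB; rewrite inE.
rewrite -EFinD lee_fin /Cs big_cat/= !big_map.
by under eq_bigr do rewrite cats0.
Qed.

End sobolev.

(** * Kernels with vanishing moments *)

Section moments.
Context {R : realType} {d : nat}.
Local Open Scope complex_scope.
Local Notation E := 'rV[R]_d.
Local Notation C := R[i].
Local Notation re := (@complex.Re R).
Local Notation im := (@complex.Im R).
Local Notation D s F := (foldr partial F s).
Local Notation mu := (lebesgue_rV R d).
Implicit Types (g h : E -> C) (psi : E -> C).

Definition cabs_sum_D (Bs : seq (seq 'I_d)) h : E -> R :=
  fun x => \sum_(b <- Bs) cabs (D b h x).

Lemma cabs_sum_D_ge0 Bs h x : 0 <= cabs_sum_D Bs h x.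
Proof. by rewrite sumr_ge0// => b _; exact: cabs_ge0. Qed.

Lemma measurable_cabs_sum_D Bs h : smooth h -> measurable_fun setT (cabs_sum_D Bs h).
Proof.
move=> sh; apply: measurable_sum => b.
exact: cmeas_cabs (ccont_cmeas (smooth_ccont (smooth_D b sh))).
Qed.

Lemma cabs_sum_D_bounded Bs h rho : smooth h ->
  exists2 B, 0 <= B & forall x, `|x| <= rho -> cabs_sum_D Bs h x <= B.
Proof.
move=> sh; elim: Bs => [|b Bs [B B0 IH]].
  by exists 0 => // x _; rewrite /cabs_sum_D big_nil.
have [B' B'0 K] := smooth_bounded rho (smooth_D b sh).
exists (B' + B); first exact: addr_ge0.
by move=> x xr; rewrite /cabs_sum_D big_cons lerD// ?K ?IH.
Qed.

(** The inequality at the origin is applied to both parts of [y |-> h (x - y)], whose derivatives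
    differ from those of [h] only by signs; the factor 2 counts the parts. *)
Lemma smooth_sobolev : exists Bs : seq (seq 'I_d), forall h x, smooth h ->
  ((cabs (h x))%:E <= \int[mu]_(y in ball0 1) (2 * cabs_sum_D Bs h (x - y))%:E)%E.
Proof.
have [Bs HB] := @sobolev_family R d; exists Bs => h x sh.
have mB : measurable (ball0 1 : set E) by exact: measurable_ball_rV.
have [sq Dq] := smooth_affine x (-1) sh.
set q := fun y => h (x + _) in sq Dq.
have Dabs b y : cabs (D b q y) = cabs (D b h (x - y)).
  by rewrite Dq cabsM cabs_sign mul1r scaleN1r.
have mS (F : seq 'I_d -> E -> R) : (forall b, continuous (F b)) ->
    measurable_fun (ball0 1) (fun y => (\sum_(b <- Bs) `|F b y|)%:E).
  move=> cF; apply: measurable_funTS; apply/measurable_EFinP; apply: measurable_sum => b.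
  exact: continuous_measurable_rV (cont_normr (cF b)).
have c1 b : continuous (fun y => re (D b q y)).
  by have [] := (ccontP _).1 (smooth_ccont (smooth_D b sq)).
have c2 b : continuous (fun y => im (D b q y)).
  by have [] := (ccontP _).1 (smooth_ccont (smooth_D b sq)).
have h1 := HB (fun b y => re (D b q y)) c1
  (fun b i y => ((cderP _ _ _ _).1 (smooth_cder i y (smooth_D b sq))).1).
have h2 := HB (fun b y => im (D b q y)) c2
  (fun b i y => ((cderP _ _ _ _).1 (smooth_cder i y (smooth_D b sq))).2).
have q0 : q 0 = h x by rewrite /q scaler0 addr0.
rewrite /= q0 in h1 h2.
apply: (@le_trans _ _ ((`|re (h x)|)%:E + (`|im (h x)|)%:E)%E).
  by rewrite -EFinD lee_fin; exact: cabs_ReIm.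
apply: le_trans (leeD h1 h2) _.
have p0 (F : seq 'I_d -> E -> R) y : ball0 1 y -> (0 <= (\sum_(b <- Bs) `|F b y|)%:E)%E.
  by rewrite lee_fin sumr_ge0.
rewrite -(ge0_integralD mu mB (p0 _) (mS _ c1) (p0 _) (mS _ c2)).
apply: ge0_le_integral => //.
- by move=> y yB; apply: adde_ge0; rewrite lee_fin sumr_ge0.
- by apply: emeasurable_funD; exact: mS.
- apply: measurable_funTS; apply/measurable_EFinP.
  apply: measurable_funM; first exact: measurable_cst.
  exact: measurable_reflect (measurable_cabs_sum_D Bs sh).
move=> y _; rewrite -EFinD lee_fin mulr_natl mulr2n /cabs_sum_D.
by apply: lerD; apply: ler_sum => b _; rewrite -Dabs ?cabs_Re ?cabs_Im.
Qed.

(** Enlarging the ball makes the right-hand side independent of [z]. It can then serve as the bound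
    [M] for all the intermediate points of a Taylor expansion around [x]. *)
Lemma sobolev_ball : exists Bs : seq (seq 'I_d), forall h x z rho, smooth h -> `|z| <= rho ->
  ((cabs (h (x - z)))%:E <=
   \int[mu]_(y in ball0 (rho + 1)) (2 * cabs_sum_D Bs h (x - y))%:E)%E.
Proof.
have [Bs HB] := smooth_sobolev; exists Bs => h x z rho sh zr.
have mb r : measurable (ball0 r : set E) by exact: measurable_ball_rV.
apply: le_trans (HB h (x - z) sh) _.
have G0 a y : (0 <= (2 * cabs_sum_D Bs h (a - y))%:E)%E.
  by rewrite lee_fin mulr_ge0// cabs_sum_D_ge0.
have mG a r : measurable_fun setT ((fun y => (2 * cabs_sum_D Bs h (a - y))%:E) \_ (ball0 r)).
  apply/(measurable_restrictT _ (mb r)); apply: measurable_funTS; apply/measurable_EFinP.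
  apply: measurable_funM; first exact: measurable_cst.
  exact: measurable_reflect (measurable_cabs_sum_D Bs sh).
rewrite integral_mkcond -(ge0_integral_shift z (mG _ _)); last first.
  by move=> y; rewrite patchE; case: ifP.
rewrite [leRHS]integral_mkcond; apply: ge0_le_integral => //.
- by move=> y _; rewrite patchE; case: ifP.
- rewrite [X in measurable_fun _ X](_ : _ =
    ((fun y => (2 * cabs_sum_D Bs h (x - z - y))%:E) \_ (ball0 1)) \o (fun v => - z + 1 *: v)).
    exact: measurableT_comp (mG (x - z) 1) (measurable_affine_rV (- z) 1).
  by apply/funext => y; rewrite compE scale1r [- z + y]addrC.
move=> y _; rewrite !patchE; case: ifPn => [|_]; last by case: ifP.
rewrite inE /ball0 /= => h1; rewrite mem_set.
  by rewrite (_ : x - z - (y - z) = x - y)// opprB addrA subrK.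
by rewrite /= -[y](subrK z) addrC (le_trans (ler_normD _ _))// lerD.
Qed.

Lemma monomial_mulX (a : 'I_d -> nat) (i : 'I_d) (y : E) :
  monomial (fun j => (a j + (j == i))%N) y = monomial a y * y ord0 i.
Proof.
rewrite /monomial; under eq_bigr do rewrite exprD.
rewrite big_split/=; congr (_ * _).
rewrite (bigD1 i)//= eqxx expr1 big1 ?mulr1// => j /negbTE ->; exact: expr0.
Qed.

(* [G t = int psi(y) g(x - t y) dy] satisfies [G 0 = 0], and its derivative is minus
   the sum over [i] of the same integrals for [y_i psi] and the [i]-th derivative of
   [g]; the kernel [y_i psi] has vanishing moments of one order less. *)
Lemma moment_bound L psi rho : bms psi -> 0 <= rho -> zero_outside rho psi ->
  (forall a, (morder a < L)%N -> cintegral (fun x => (monomial a x)%:C * psi x) = 0) ->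
  exists2 K, 0 <= K & forall g x M, smooth g -> 0 <= M ->
    (forall s z, size s = L -> `|z| <= rho -> cabs (D s g (x - z)) <= M) ->
    forall t, 0 <= t <= 1 ->
    cabs (cintegral (fun y => psi y * g (x + (- t) *: y))) <= K * M * t ^+ L.
Proof.
elim: L psi => [|L IH] psi bpsi rho0 zpsi mom.
  have [cpsi [B [r [B0 _ Bp _]]]] := bpsi.
  exists (2 * B * (2 * rho) ^+ d); first by rewrite !mulr_ge0// exprn_ge0// mulr_ge0.
  move=> g x M sg M0 gM t /andP[t0 t1]; rewrite expr0 mulr1.
  apply: (@le_trans _ _ (2 * (B * M) * (2 * rho) ^+ d)).
    apply: cintegral_mul_le => //; first exact: lbm_affine (smooth_lbm sg).
    move=> y yr; rewrite scaleNr; apply: (gM [::]) => //.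
    by rewrite normrZ ger0_norm// (le_trans _ yr)// ler_piMl.
  by rewrite le_eqVlt; apply/orP; left; apply/eqP; ring.
pose psi_ i := fun y : E => psi y * (y ord0 i)%:C.
have bpsi_ i : bms (psi_ i) by exact: bmsM bpsi (smooth_lbm (smooth_coord i)).
have zpsi_ i : zero_outside rho (psi_ i) by move=> y yr; rewrite /psi_ zpsi ?mul0r.
have mom_ i a : (morder a < L)%N -> cintegral (fun x => (monomial a x)%:C * psi_ i x) = 0.
  move=> aL; rewrite -(mom (fun j => (a j + (j == i))%N)).
    congr cintegral; apply/funext => y; rewrite monomial_mulX /psi_ rmorphM /=.
    have Hr (m p z : C) : m * (p * z) = m * z * p by ring.
    exact: Hr.
  rewrite /morder big_split/= [X in (_ + X)%N](_ : _ = 1%N) ?addn1 ?ltnS//.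
  by rewrite (bigD1 i)//= eqxx big1// => j /negbTE ->.
have /choice[Ks HK] : forall i, exists K : R, 0 <= K /\ forall g x M, smooth g -> 0 <= M ->
    (forall s z, size s = L -> `|z| <= rho -> cabs (D s g (x - z)) <= M) ->
    forall t, 0 <= t <= 1 ->
    cabs (cintegral (fun y => psi_ i y * g (x + (- t) *: y))) <= K * M * t ^+ L.
  by move=> i; have [K K0 hK] := IH (psi_ i) (bpsi_ i) rho0 (zpsi_ i) (mom_ i); exists K.
have SK0 : 0 <= \sum_i Ks i by apply: sumr_ge0 => i _; case: (HK i).
exists (2 * \sum_i Ks i); first by rewrite mulr_ge0.
move=> g x M sg M0 gM t /andP[t0 t1].
have sa (h : E -> C) s : smooth h -> smooth (fun y => h (x + (- s) *: y)).
  by move=> sh; case: (smooth_affine x (- s) sh).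
pose G s := cintegral (fun y => psi y * g (x + (- s) *: y)).
pose g3 s := fun y : E => \sum_i ((-1)%:C * (y ord0 i)%:C) * partial i g (x + (- s) *: y).
have sg3 s : smooth (g3 s).
  have sF i : smooth (fun y => ((-1)%:C * (y ord0 i)%:C) * partial i g (x + (- s) *: y)).
    have [sm _] := smoothZ (-1)%:C (@smooth_coord R d i).
    by have [] := smoothM sm (sa _ s (smooth_partial i sg)).
  by have [] := smooth_sum (index_enum 'I_d) sF.
pose G' s := cintegral (fun y => psi y * g3 s y).
(* The induction hypothesis for the kernels [psi_ i]: [L] derivatives of [partial i g] are [L + 1]
   derivatives of [g]. The bound has order [t^L], and one more power of [t] comes from the mean
   value theorem on [[0, t]]. *)
have G'b s : 0 <= s <= t -> cabs (G' s) <= (\sum_i Ks i) * M * t ^+ L.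
  move=> /andP[s0 st].
  have -> : G' s = \sum_i cintegral (fun y => (-1)%:C *
      (psi_ i y * partial i g (x + (- s) *: y))).
    have lb i := lbm_affine x (- s) (smooth_lbm (smooth_partial i sg)).
    have bi i := bms_cintegrable (bmsZ (-1)%:C (bmsM (bpsi_ i) (lb i))).
    have [<- _] := cintegral_sum (index_enum 'I_d) bi.
    congr cintegral; apply/funext => y; rewrite /g3 mulr_sumr.
    apply: eq_bigr => i _; rewrite /psi_.
    have Hr (a b c e : C) : a * (b * c * e) = b * (a * c * e) by ring.
    exact: Hr.
  apply: le_trans (cabs_sum _ _) _; rewrite !mulr_suml; apply: ler_sum => i _.
  have lb := lbm_affine x (- s) (smooth_lbm (smooth_partial i sg)).
  rewrite (cintegralZ _ (bms_cintegrable (bmsM (bpsi_ i) lb))) cabsM.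
  have -> : cabs ((-1)%:C : C) = 1 by have := @cabs_sign R 1; rewrite expr1.
  rewrite mul1r; have [Ki0 HKi] := HK i.
  have s1 : 0 <= s <= 1 by rewrite s0 (le_trans st).
  apply: le_trans (HKi _ x M (smooth_partial i sg) M0 _ s s1) _; last first.
    by rewrite ler_wpM2l ?mulr_ge0// lerXn2r// ?nnegrE// (le_trans s0).
  move=> w z sw zr; rewrite -[partial i g]/(D [:: i] g) -foldr_cat.
  by apply: gM => //; rewrite size_cat sw addn1.
have [B B0 taylor] := smooth_taylor2 (`|x| + rho) sg.
have [cpsi [Bp [r [Bp0 _ Hp _]]]] := bpsi.
pose A := 2 * (Bp * (B * rho ^+ 2)) * (2 * rho) ^+ d.
have A0 : 0 <= A by rewrite !mulr_ge0// exprn_ge0// mulr_ge0.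
have quad s u : 0 <= s <= 1 -> `|u| * rho <= 1 ->
    cabs (G (s + u) - G s - u%:C * G' s) <= A * `|u| ^+ 2.
  move=> /andP[s0 s1] ur; rewrite /G /G' cintegral_mul_linear//; first last.
  - exact: smooth_lbm (sg3 s).
  - exact: smooth_lbm (sa _ s sg).
  - exact: smooth_lbm (sa _ (s + u) sg).
  have -> : A * `|u| ^+ 2 = 2 * (Bp * (B * (`|u| * rho) ^+ 2)) * (2 * rho) ^+ d.
    by rewrite /A exprMn; ring.
  apply: cintegral_mul_le => //.
  - by rewrite mulr_ge0// exprn_ge0// mulr_ge0.
  - apply: lbmB; last exact: lbmZ (smooth_lbm (sg3 s)).
    by apply: lbmB; exact: smooth_lbm (sa _ _ sg).
  move=> y yr; have := taylor (x + (- s) *: y) ((- u) *: y).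
  have -> : x + - s *: y + - u *: y = x + - (s + u) *: y by rewrite opprD scalerDl addrA.
  have -> : \sum_i (((- u) *: y) ord0 i)%:C * partial i g (x + (- s) *: y) = u%:C * g3 s y.
    rewrite /g3 mulr_sumr; apply: eq_bigr => i _; rewrite mxE mulNr -mulN1r !rmorphM /=.
    have Hr (a b c e : C) : a * (b * c) * e = b * (a * c * e) by ring.
    exact: Hr.
  have nu : `|(- u) *: y| <= `|u| * rho by rewrite normrZ normrN ler_wpM2l.
  move=> H; apply: le_trans (H _ (le_trans nu ur)) _; last first.
    by rewrite ler_wpM2l// lerXn2r ?nnegrE// mulr_ge0.
  apply: le_trans (ler_normD _ _) _; rewrite lerD2l normrZ normrN ger0_norm//.
  by rewrite (le_trans _ yr)// ler_piMl.
(* Here [pr] stands for the real or the imaginary part, so that the real mean value theorem is set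
   up once for both. *)
have der (pr : C -> R) : (forall z w, pr (z - w) = pr z - pr w) ->
    (forall (u : R) z, pr (u%:C * z) = u * pr z) -> (forall z, `|pr z| <= cabs z) ->
    forall s : R, 0 <= s <= t -> is_derive s 1 (fun s => pr (G s)) (pr (G' s)).
  move=> prB prZ prle s /andP[s0 st]; apply/is_deriveP => e e0.
  exists (Num.min (rho + 1)^-1 (e / (A + 1))).
    by rewrite lt_min invr_gt0 ltr_wpDl// divr_gt0// ltr_wpDl.
  move=> u; rewrite lt_min => /andP[u1 u2]; rewrite -[u *: 1]/(u * 1) mulr1 -!prB -prZ -prB.
  apply: le_trans (prle _) _; apply: le_trans (quad s u _ _) _.
  - by rewrite s0 (le_trans st).
  - apply: le_trans (_ : `|u| * (rho + 1) <= 1); first by rewrite ler_wpM2l// lerDl.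
    by rewrite -ler_pdivlMr ?ltr_wpDl// div1r ltW.
  rewrite expr2 mulrA ler_wpM2r//.
  apply: le_trans (_ : (A + 1) * `|u| <= e); first by rewrite ler_wpM2r// lerDl.
  by rewrite mulrC -ler_pdivlMr ?ltr_wpDl// ltW.
have G0 : G 0 = 0.
  rewrite /G; under eq_fun do rewrite oppr0 scale0r addr0 mulrC.
  rewrite (cintegralZ _ (bms_cintegrable bpsi)) (_ : cintegral psi = 0) ?mulr0//.
  rewrite -(mom (fun=> 0%N)); last by rewrite /morder big1.
  by congr cintegral; apply/funext => y; rewrite /monomial big1 ?mul1r// => i _; rewrite expr0.
have mv (pr : C -> R) : (forall z w, pr (z - w) = pr z - pr w) ->
    (forall (u : R) z, pr (u%:C * z) = u * pr z) -> (forall z, `|pr z| <= cabs z) ->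
    `|pr (G t)| <= (\sum_i Ks i) * M * t ^+ L * t.
  move=> prB prZ prle; have pr0 : pr 0 = 0 by have := prB 0 0; rewrite !subrr.
  have := @mean_value_bound R (fun s => pr (G s)) (fun s => pr (G' s)) 0 t 0
    ((\sum_i Ks i) * M * t ^+ L) t0 (der pr prB prZ prle).
  rewrite G0 pr0 mulr0 !subr0; apply => s st; rewrite subr0.
  exact: le_trans (prle _) (G'b s st).
rewrite -/(G t); apply: le_trans (cabs_ReIm _) _; rewrite exprSr.
have h1 := mv re (fun z w => raddfB _ z w) (@Re_realM R) (@cabs_Re R).
have h2 := mv im (fun z w => raddfB _ z w) (@Im_realM R) (@cabs_Im R).
apply: le_trans (lerD h1 h2) _.
by rewrite le_eqVlt; apply/orP; left; apply/eqP; ring.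
Qed.

Lemma sum_le_mem (T : eqType) (s : seq T) (F : T -> R) x : x \in s ->
  (forall y, 0 <= F y) -> F x <= \sum_(y <- s) F y.
Proof. by move=> xs F0; rewrite (big_rem x)//= lerDl sumr_ge0. Qed.

(** At [t = 2^-j] the factor [t^L] of [moment_bound] is [2^(-jL)]. The supremum [M] of the
    derivatives of order [L] is replaced, by [sobolev_ball], with an average that depends on [x]
    alone. *)
Lemma conv_dilate_avg psi L : test psi ->
  (forall a, (morder a < L)%N -> cintegral (fun x => (monomial a x)%:C * psi x) = 0) ->
  exists (K rho : R) (Bs : seq (seq 'I_d)), [/\ 0 <= K, 0 < rho &
   forall j g, smooth g -> avg_le rho (fun x => cabs (conv (dilate j psi) g x))
     (fun x => K * (2^-1) ^+ (j * L) * cabs_sum_D Bs g x)].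
Proof.
move=> tpsi mom; have [spsi [rho rho0 zpsi]] := (testP _).1 tpsi.
have [K K0 HK] := moment_bound (test_bms tpsi) rho0 zpsi mom.
have [Bs HB] := sobolev_ball.
pose Ss := [seq tval s | s <- enum {: L.-tuple 'I_d}].
(* All words of length [L], from the Taylor expansion, with the Sobolev derivatives taken on top of
   them. *)
pose Cs := [seq b ++ s | s <- Ss, b <- Bs].
have r1 : 0 < rho + 1 by rewrite ltr_wpDl.
exists (2 * K), (rho + 1), Cs; split; [by rewrite mulr_ge0|by []|].
move=> j g sg x; set I := (\int[mu]_(y in _) _)%E.
have mb : measurable (ball0 (rho + 1) : set E) by exact: measurable_ball_rV.
pose J := (\int[mu]_(y in ball0 (rho + 1)) (2 * cabs_sum_D Cs g (x - y))%:E)%E.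
have mG As : measurable_fun (ball0 (rho + 1)) (fun y => (2 * cabs_sum_D As g (x - y))%:E).
  apply: measurable_funTS; apply/measurable_EFinP.
  apply: measurable_funM; first exact: measurable_cst.
  exact: measurable_reflect (measurable_cabs_sum_D As sg).
have G0 As y : ball0 (rho + 1) y -> (0 <= (2 * cabs_sum_D As g (x - y))%:E)%E.
  by rewrite lee_fin mulr_ge0// cabs_sum_D_ge0.
have J0 : (0 <= J)%E by apply: integral_ge0 => y; exact: G0.
have IJ : I = ((K * (2^-1) ^+ (j * L))%:E * J)%E.
  rewrite /I /J -(ge0_integralZl_EFin mu mb (G0 Cs) (mG Cs)).
    by apply: eq_integral => y _; rewrite -EFinM; congr EFin; ring.
  by rewrite mulr_ge0// exprn_ge0.
(* The average must be a real number to play the role of [M]; it is finite because smooth functions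
   are locally bounded. *)
have Joo : (J < +oo)%E.
  have [B B0 hB] := cabs_sum_D_bounded Cs (`|x| + (rho + 1)) sg.
  apply: (@le_lt_trans _ _ (\int[mu]_(y in ball0 (rho + 1)) (2 * B)%:E)%E).
    apply: ge0_le_integral => //; first exact: G0.
    move=> y yr; rewrite lee_fin ler_wpM2l//; apply: hB.
    by apply: le_trans (ler_normB _ _) _; rewrite lerD2l.
  have -> : (\int[mu]_(y in ball0 (rho + 1)) (2 * B)%:E =
      (2 * B)%:E * ((2 * (rho + 1)) ^+ d)%:E)%E.
    by rewrite -lebesgue_rV_ball ?ltW//; exact: (integral_cst mu mb (2 * B)%:E).
  by rewrite -EFinM ltry.
have JE : J = (fine J)%:E by rewrite fineK// ge0_fin_numE.
rewrite IJ JE -EFinM lee_fin (conv_dilate_l _ _ (test_bms tpsi) (smooth_lbm sg)).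
have t01 : 0 <= ((2 ^ j)%:R^-1 : R) <= 1.
  by rewrite invr_ge0 ler0n/= invf_le1// ?ler1n ?ltr0n expn_gt0.
have tL : ((2 ^ j)%:R^-1 : R) ^+ L = 2^-1 ^+ (j * L).
  by rewrite exprM natrX -exprVn.
have := HK g x (fine J) sg (fine_ge0 J0) _ _ t01; rewrite tL mulrAC.
under eq_fun do rewrite scaleNr.
apply => s z sL zr; rewrite -lee_fin -JE.
apply: le_trans (HB (D s g) x z rho (smooth_D s sg) zr) _.
apply: ge0_le_integral => //.
- by move=> y _; rewrite lee_fin mulr_ge0// cabs_sum_D_ge0.
- apply: measurable_funTS; apply/measurable_EFinP.
  apply: measurable_funM; first exact: measurable_cst.
  exact: measurable_reflect (measurable_cabs_sum_D Bs (smooth_D s sg)).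
move=> y _; rewrite lee_fin ler_wpM2l// /cabs_sum_D /Cs big_allpairs_dep /=.
have sS : s \in Ss.
  by apply/mapP; exists (Tuple (introT eqP sL)) => //; rewrite mem_enum.
apply: le_trans (sum_le_mem (F := fun s => \sum_(b <- Bs) cabs (D (b ++ s) g (x - y))) sS _).
  by apply: ler_sum => b _; rewrite foldr_cat.
by move=> w; apply: sumr_ge0 => b _; exact: cabs_ge0.
Qed.

End moments.

(** * Moderate weights *)

Section weights.
Context {R : realType} {d : nat}.
Local Open Scope complex_scope.
Local Notation E := 'rV[R]_d.
Local Notation C := R[i].
Local Notation D s F := (foldr partial F s).
Variable omega : E -> R.
Hypotheses (omega_ge0 : forall x, 0 <= omega x) (omega_cont : continuous omega).
Hypothesis omega_moderate : moderate omega.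

Definition wt (t : R) (x : E) : R := expR (t * omega x).

Lemma wt_ge0 t x : 0 <= wt t x.
Proof. exact: expR_ge0. Qed.

Lemma wt_cont t : continuous (wt t).
Proof.
apply: (@cont_comp R E (@expR R)); last exact: continuous_expR.
have ct : continuous (fun _ : E => t) by move=> x; exact: cst_continuous.
exact: (cont_mulr ct omega_cont).
Qed.

Lemma wt_measurable t : measurable_fun setT (wt t).
Proof. exact: continuous_measurable_rV (@wt_cont t). Qed.

Lemma wt_le t t' x : t <= t' -> wt t x <= wt t' x.
Proof. by move=> tt; rewrite /wt ler_expR ler_wpM2r. Qed.

Lemma wtD t t' x : wt (t + t') x = wt t x * wt t' x.
Proof. by rewrite /wt mulrDl expRD. Qed.

Lemma ccont_weight t (F : E -> C) : ccont F -> ccont (weight omega t F).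
Proof.
move=> cF; apply: ccontM => //; apply/ccontP; split.
  exact: (@wt_cont t).
by move=> x; exact: cst_continuous.
Qed.

Lemma cabs_weight t (F : E -> C) x : cabs (weight omega t F x) = cabs (F x) * wt t x.
Proof. by rewrite /weight cabsM cabs_real ger0_norm// expR_ge0. Qed.

Lemma eucl_norm_le (y : E) : eucl_norm y <= d%:R * `|y|.
Proof.
apply: le_trans (sum_coord_le y).
have S0 : 0 <= \sum_i `|y ord0 i| by apply: sumr_ge0.
rewrite /eucl_norm -[leRHS](ger0_norm S0) -sqrtr_sqr ler_wsqrtr//.
have : forall r : seq 'I_d, \sum_(i <- r) y ord0 i ^+ 2 <= (\sum_(i <- r) `|y ord0 i|) ^+ 2.
  elim=> [|i r IH]; first by rewrite !big_nil expr0n.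
  rewrite !big_cons sqrrD -normrX ger0_norm ?sqr_ge0//.
  have h0 : 0 <= \sum_(j <- r) `|y ord0 j| by apply: sumr_ge0.
  have h1 : 0 <= `|y ord0 i| * (\sum_(j <- r) `|y ord0 j|) by rewrite mulr_ge0.
  have Hr (p q m u : R) : q <= u -> 0 <= m -> p + q <= p + m *+ 2 + u by clear; lra.
  exact: Hr.
exact.
Qed.

(** Moderateness concerns Euclidean shifts of length at most 1; a longer shift is cut into [N] equal
    steps with [N > d rho], the factor [d] comparing the Euclidean with the sup norm. Adding 1 to
    the constant makes it at least 1. *)
Lemma omega_shift (rho : R) : exists2 A : R, 1 <= A &
  forall x y, `|y| <= rho -> omega (x + y) <= A * omega x.
Proof.
have [A0 A00 HA] := omega_moderate; pose A := A0 + 1.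
have A1 : 1 <= A by rewrite /A lerDr ltW.
have HA' x y : eucl_norm y <= 1 -> omega (x + y) <= A * omega x.
  by move=> /(HA x) h; apply: le_trans h _; rewrite ler_wpM2r// lerDl.
pose N := (Num.bound (d%:R * rho)).+1.
exists (A ^+ N); first by rewrite exprn_ege1.
move=> x y yr.
have N0 : 0 < N%:R :> R by rewrite ltr0n.
have step n : omega (x + (n%:R / N%:R) *: y) <= A ^+ n * omega x.
  elim: n => [|n IH]; first by rewrite mul0r scale0r addr0 expr0 mul1r.
  rewrite -natr1 mulrDl scalerDl addrA; apply: le_trans (HA' _ _ _) _.
    apply: le_trans (eucl_norm_le _) _; rewrite normrZ ger0_norm ?divr_ge0//.
    rewrite div1r mulrCA mulrC ler_pdivrMr// mul1r.
    apply: le_trans (_ : d%:R * rho <= _); first by rewrite ler_wpM2l.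
    have [h|h] := leP 0 (d%:R * rho); last by rewrite ltW// (lt_le_trans h)// ler0n.
    by rewrite ltW// (lt_le_trans (archi_boundP h))// ler_nat.
  by rewrite exprS -mulrA ler_wpM2l// (le_trans _ A1).
by have := step N; rewrite divff ?gt_eqF// scale1r.
Qed.

(** Shifting multiplies [omega] by a constant; under the exponential this changes the exponent of
    the weight and not its size. For growing weights the new exponent is the one on the right, for
    decaying ones the one on the left, as the quantifiers over [n] in (i) and (iii) require. *)
Definition wcomp (rho t t' : R) := forall x y, `|y| <= rho -> wt t x <= wt t' (x - y).

Lemma wcomp_up rho (n : nat) : exists m : nat, wcomp rho n%:R m%:R.
Proof.
have [A A1 HA] := omega_shift rho.
have A0 : 0 <= n%:R * A by rewrite mulr_ge0// (le_trans _ A1).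
exists (Num.bound (n%:R * A)) => x y yr; rewrite /wt ler_expR.
have := HA (x - y) y yr; rewrite subrK => h.
apply: le_trans (ler_wpM2l (ler0n _ n) h) _; rewrite mulrA ler_wpM2r// ltW//.
exact: archi_boundP.
Qed.

Lemma wcomp_down rho (n : nat) : exists m : nat, wcomp rho (- m%:R) (- n%:R).
Proof.
have [A A1 HA] := omega_shift rho.
have A0 : 0 <= n%:R * A by rewrite mulr_ge0// (le_trans _ A1).
exists (Num.bound (n%:R * A)) => x y yr; rewrite /wt ler_expR !mulNr lerN2.
have := HA x (- y); rewrite normrN => /(_ yr) h.
apply: le_trans (ler_wpM2l (ler0n _ n) h) _; rewrite mulrA ler_wpM2r// ltW//.
exact: archi_boundP.
Qed.

Lemma sup_norm_bound p r (k : nat) (g : nat -> 'I_2 -> E -> C) : (1 <= p)%E ->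
  (forall j l, ccont (g j l)) -> r <= k%:R -> (sup_norm p r g < +oo)%E ->
  exists2 B, 0 <= B & forall j l, lp_le p (fun x => cabs (g j l x)) (B * 2 ^+ (k * j)).
Proof.
move=> p1 cg rk.
have ub j l : ((2 `^ (- r * j%:R))%:E * LpNorm p (g j l) <= sup_norm p r g)%E.
  by apply: ereal_sup_ubound; exists (j, l).
have S0 : (0 <= sup_norm p r g)%E.
  apply: le_trans (ub 0%N ord0); apply: mule_ge0; last exact: Lnorm_ge0.
  by rewrite lee_fin powR_ge0.
case ES : (sup_norm p r g) S0 => [S| |]// S0 _; rewrite lee_fin in S0.
exists S => // j l; apply/LpNormP => //; first by rewrite mulr_ge0// exprn_ge0.
have := ub j l; rewrite ES.
have -> : 2 `^ (- r * j%:R) = (2 `^ (r * j%:R))^-1 :> R by rewrite mulNr powRN.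
have p0 : 0 < 2 `^ (r * j%:R) :> R by exact: powR_gt0.
move=> h; apply: (@le_trans _ _ ((2 `^ (r * j%:R))%:E * S%:E)%E).
  by rewrite -lee_pdivrMl.
rewrite -EFinM lee_fin mulrC ler_wpM2l// -powR_mulrn ?ler0n// natrM.
by apply: ler_powR; rewrite ?ler1n ?ler_wpM2r.
Qed.

Lemma sup_norm_finite p (k : nat) (g : nat -> 'I_2 -> E -> C) B : (1 <= p)%E ->
  (forall j l, ccont (g j l)) -> 0 <= B ->
  (forall j l, lp_le p (fun x => cabs (g j l x)) (B * 2 ^+ (k * j))) ->
  (sup_norm p k%:R g < +oo)%E.
Proof.
move=> p1 cg B0 H; apply: (@le_lt_trans _ _ B%:E); last exact: ltry.
apply: ge_ereal_sup => _ [[j l] _ <-] /=.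
have p0 : 0 < 2 ^+ (k * j) :> R by exact: exprn_gt0.
have -> : 2 `^ (- k%:R * j%:R) = (2 ^+ (k * j))^-1 :> R.
  by rewrite mulNr powRN -natrM powR_mulrn.
rewrite lee_pdivrMl// -EFinM mulrC; apply/LpNormP => //.
by rewrite mulr_ge0// ltW.
Qed.

End weights.

(** * Telescoping *)

Section averages.
Context {R : realType} {d : nat}.
Local Notation E := 'rV[R]_d.
Local Notation mu := (lebesgue_rV R d).
Implicit Types (T G : E -> R).

Lemma avg_le_mono rho rho' T T' G G' : rho <= rho' -> measurable_fun setT G ->
  measurable_fun setT G' -> (forall x, T' x <= T x) ->
  (forall x, 0 <= G x <= G' x) -> avg_le rho T G -> avg_le rho' T' G'.
Proof.
move=> rr mG mG' TT GG h x.
have mb r : measurable (ball0 r : set E) by exact: measurable_ball_rV.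
have mI r (H : E -> R) : measurable_fun setT H ->
    measurable_fun (ball0 r) (fun y => (H (x - y))%:E).
  by move=> mH; apply: measurable_funTS; apply/measurable_EFinP; exact: measurable_reflect.
apply: (@le_trans _ _ (T x)%:E); first by rewrite lee_fin.
apply: le_trans (h x) _.
apply: (@le_trans _ _ (\int[mu]_(y in ball0 rho') (G (x - y))%:E)%E).
  apply: ge0_subset_integral => //; first exact: mI.
    by move=> y _; rewrite lee_fin; case/andP: (GG (x - y)).
  by move=> y /= h1; exact: le_trans h1 rr.
apply: ge0_le_integral => //.
- by move=> y _; rewrite lee_fin; case/andP: (GG (x - y)).
- exact: mI.
- exact: mI.
- by move=> y _; rewrite lee_fin; case/andP: (GG (x - y)).
Qed.

Lemma avg_le_sum (I : Type) (r : seq I) rho (T G : I -> E -> R) :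
  (forall i, measurable_fun setT (G i)) -> (forall i x, 0 <= G i x) ->
  (forall i, avg_le rho (T i) (G i)) ->
  avg_le rho (fun x => \sum_(i <- r) T i x) (fun x => \sum_(i <- r) G i x).
Proof.
move=> mG G0 h x; have mb : measurable (ball0 rho : set E) by exact: measurable_ball_rV.
have mI (H : E -> R) : measurable_fun setT H ->
    measurable_fun (ball0 rho) (fun y => (H (x - y))%:E).
  by move=> mH; apply: measurable_funTS; apply/measurable_EFinP; exact: measurable_reflect.
elim: r => [|i r IH].
  by rewrite big_nil; apply: integral_ge0 => y _; rewrite big_nil.
under eq_integral do rewrite big_cons EFinD.
rewrite big_cons EFinD ge0_integralD//.
- exact: leeD (h i x) IH.
- by move=> y _; rewrite lee_fin.
- exact: mI.
- by move=> y _; rewrite lee_fin sumr_ge0.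
- by apply: (mI (fun y => \sum_(i <- r) G i y)); exact: measurable_sum.
Qed.

(** The weight at [x] lies below the new weight at every point over which [G] is averaged, so it may
    be taken under the integral. *)
Lemma avg_le_weight rho T G (w w' : E -> R) : measurable_fun setT G ->
  measurable_fun setT w' -> (forall x, 0 <= G x) -> (forall x, 0 <= w x) ->
  (forall x y, `|y| <= rho -> w x <= w' (x - y)) -> avg_le rho T G ->
  avg_le rho (fun x => T x * w x) (fun x => G x * w' x).
Proof.
move=> mG mw' G0 w0 ww h x.
have mb : measurable (ball0 rho : set E) by exact: measurable_ball_rV.
have mI (H : E -> R) : measurable_fun setT H ->
    measurable_fun (ball0 rho) (fun y => (H (x - y))%:E).
  by move=> mH; apply: measurable_funTS; apply/measurable_EFinP; exact: measurable_reflect.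
rewrite mulrC EFinM; apply: le_trans (lee_wpmul2l _ (h x)) _; first by rewrite lee_fin.
have G0' y : ball0 rho y -> (0 <= (G (x - y))%:E)%E by rewrite lee_fin.
rewrite -(ge0_integralZl_EFin mu mb G0' (mI _ mG) (w0 x)).
apply: ge0_le_integral => //.
- by move=> y _; rewrite -EFinM lee_fin mulr_ge0.
- by apply: emeasurable_funM; [exact: measurable_cst|exact: mI].
- by apply: (mI (fun y => G y * w' y)); exact: measurable_funM.
- by move=> y yr; rewrite -EFinM lee_fin mulrC ler_wpM2l//; exact: ww.
Qed.

End averages.

Section telescoping.
Context {R : realType} {d : nat}.
Local Open Scope complex_scope.
Local Notation E := 'rV[R]_d.
Local Notation C := R[i].
Local Notation D s F := (foldr partial F s).
Implicit Types (g h phi psi : E -> C).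

Lemma dilate_S j phi : dilate j (dilate 1 phi) = dilate j.+1 phi.
Proof.
apply/funext => x; rewrite /dilate mulrA -natrM -expnD -mulnDl addn1 scalerA -natrM.
by rewrite -expnD add1n.
Qed.

Lemma conv_D_swap h g s : test h -> smooth g -> conv (D s h) g = conv h (D s g).
Proof.
move=> th sg; have sh := test_smooth th.
rewrite (conv_comm (test_bms (test_D s th)) (smooth_lbm sg)).
have [_ <-] := conv_test_smooth (smooth_lbm sg) th.
rewrite -(conv_comm (test_bms th) (smooth_lbm sg)).
by have [_ ->] := conv_smooth (test_bms th) sg.
Qed.

(** Moving derivatives from the dilated kernel to [g] gains [2^(-j |s|)]. The gain is discarded, for
    the vanishing moments already supply all the decay needed. *)
Lemma cabs_conv_dilate_D j psi g s x : test psi -> smooth g ->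
  cabs (conv (dilate j (D s psi)) g x) <= cabs (conv (dilate j psi) (D s g) x).
Proof.
move=> tp sg; rewrite -(conv_D_swap s (dilate_test j tp) sg).
rewrite dilate_D; last exact: test_smooth.
have bD := test_bms (dilate_test j (test_D s tp)).
have -> : conv (fun x => ((2 ^ j)%:R : C) ^+ size s * dilate j (D s psi) x) g x =
    ((2 ^ j)%:R : C) ^+ size s * conv (dilate j (D s psi)) g x.
  rewrite /conv -cintegralZ; last exact: bms_cintegrable (bmsM bD (lbm_reflect x (smooth_lbm sg))).
  by congr cintegral; apply/funext => y; rewrite mulrA.
rewrite cabsM ler_peMl ?cabs_ge0//.
have -> : ((2 ^ j)%:R : C) ^+ size s = ((2 ^ j)%:R ^+ size s : R)%:C by rewrite rmorphXn rmorph_nat.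
by rewrite cabs_real ger0_norm ?exprn_ge0// exprn_ege1// ler1n expn_gt0.
Qed.

Section mdfp_family.
Variables (chi psi : 'I_2 -> E -> C) (phi0 psi0 : E -> C).
Hypotheses (tchi : forall l, test (chi l)) (tpsi : forall l, test (psi l)).
Hypothesis tphi0 : test phi0.
Hypothesis phi_diff : forall x, dilate 1 phi0 x - phi0 x = laplacian psi0 x.
Hypothesis psi_dec : forall x, psi0 x = \sum_l conv (chi l) (psi l) x.

(** One second derivative in the Laplacian of psi^l, dilated. *)
Definition dil_lap (j : nat) (il : 'I_d * 'I_2) : E -> C :=
  dilate j (D [:: il.1; il.1] (psi il.2)).

Lemma dil_lap_test j il : test (dil_lap j il).
Proof. by apply: dilate_test; exact: test_D. Qed.

Lemma telescoping j : dilate j.+1 phi0 = fun x => dilate j phi0 x +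
  \sum_(il : 'I_d * 'I_2) conv (dilate j (chi il.2)) (dil_lap j il) x.
Proof.
have E1 : dilate 1 phi0 = fun x => phi0 x + \sum_(il : 'I_d * 'I_2)
    conv (chi il.2) (D [:: il.1; il.1] (psi il.2)) x.
  apply/funext => x; rewrite -[LHS](subrK (phi0 x)) phi_diff addrC; congr (_ + _).
  have -> : psi0 = fun x => \sum_l conv (chi l) (psi l) x by exact/funext.
  rewrite /laplacian.
  have cs l := conv_smooth (test_bms (tchi l)) (test_smooth (tpsi l)).
  transitivity (\sum_(i < d) \sum_(l < 2) conv (chi l) (D [:: i; i] (psi l)) x).
    apply: eq_bigr => i _.
    have [_ SD] := smooth_sum (index_enum 'I_2) (fun l => proj1 (cs l)).
    rewrite -[LHS]/(D [:: i; i] (fun y => \sum_l conv (chi l) (psi l) y) x) SD.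
    by apply: eq_bigr => l _; rewrite (cs l).2.
  by rewrite pair_big.
rewrite -dilate_S E1; apply/funext => x; rewrite {1 2}/dilate mulrDr mulr_sumr.
congr (_ + _); apply: eq_bigr => il _.
have tD := test_D [:: il.1; il.1] (tpsi il.2).
by rewrite /dil_lap (conv_dilate j (test_bms (tchi il.2)) (smooth_lbm (test_smooth tD))).
Qed.

Variable u : (E -> C) -> C.
Hypothesis Du : is_distribution u.

Lemma dconv_telescoping j (theta : E -> C) x : test theta ->
  dconv u (conv (dilate j.+1 phi0) theta) x = dconv u (conv (dilate j phi0) theta) x +
  \sum_(il : 'I_d * 'I_2)
    conv (dconv u (dilate j (chi il.2))) (conv (dil_lap j il) theta) x.
Proof.
move=> tt; have td l := dilate_test j (tchi l).
have tc il : test (conv (dilate j (chi il.2)) (dil_lap j il)).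
  exact: conv_test (test_bms (td il.2)) (dil_lap_test j il).
have ls := smooth_lbm (test_smooth tt).
have tS := test_sum (index_enum ('I_d * 'I_2)%type) tc.
have -> : conv (dilate j.+1 phi0) theta = fun x => conv (dilate j phi0) theta x +
    \sum_(il : 'I_d * 'I_2) conv (dilate j (chi il.2)) (conv (dil_lap j il) theta) x.
  rewrite telescoping (conv_addl (test_bms (dilate_test j tphi0)) (test_bms tS) ls).
  apply/funext => z; congr (_ + _).
  rewrite (conv_comm (test_bms tS) ls) (conv_sum_r _ (test_bms tt)).
    apply: eq_bigr => il _; rewrite (conv_assoc (td il.2) (dil_lap_test j il) tt).
    by rewrite (conv_comm (test_bms (tc il)) ls).
  by move=> il; exact: bms_lbm (test_bms (tc il)).
have tc2 il : test (conv (dil_lap j il) theta).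
  exact: conv_test (test_bms (dil_lap_test j il)) tt.
have tc3 il : test (conv (dilate j (chi il.2)) (conv (dil_lap j il) theta)).
  exact: conv_test (test_bms (td il.2)) (tc2 il).
rewrite (dconvD Du _ (conv_test (test_bms (dilate_test j tphi0)) tt)
  (test_sum (index_enum ('I_d * 'I_2)%type) tc3)).
congr (_ + _); rewrite (dconv_sum Du _ _ tc3); apply: eq_bigr => il _.
by rewrite (dconv_conv Du (td il.2) (tc2 il)).
Qed.

(** Here the Laplacian is moved onto the convolutions with the dilates of [chi], in contrast with
    [dconv_telescoping], where it stays on the kernel and is absorbed by [theta]. *)
Lemma cabs_step j s x :
  cabs (D s (dconv u (dilate j.+1 phi0)) x - D s (dconv u (dilate j phi0)) x) <=
  \sum_(il : 'I_d * 'I_2) cabs (conv (dilate j (psi il.2))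
     (D ([:: il.1; il.1] ++ s) (dconv u (dilate j (chi il.2)))) x).
Proof.
have td l := dilate_test j (tchi l).
have tc il : test (conv (dilate j (chi il.2)) (dil_lap j il)).
  exact: conv_test (test_bms (td il.2)) (dil_lap_test j il).
have sF l : smooth (dconv u (dilate j (chi l))) by have [] := dconv_smooth Du (td l).
have cs il := conv_smooth (test_bms (dil_lap_test j il)) (sF il.2).
have -> : dconv u (dilate j.+1 phi0) = fun x => dconv u (dilate j phi0) x +
    \sum_(il : 'I_d * 'I_2) conv (dil_lap j il) (dconv u (dilate j (chi il.2))) x.
  apply/funext => z; rewrite telescoping.
  rewrite (dconvD Du _ (dilate_test j tphi0) (test_sum (index_enum ('I_d * 'I_2)%type) tc)).
  congr (_ + _); rewrite (dconv_sum Du _ _ tc); apply: eq_bigr => il _.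
  rewrite (dconv_conv Du (td il.2) (dil_lap_test j il)).
  by rewrite (conv_comm (test_bms (dil_lap_test j il)) (smooth_lbm (sF il.2))).
have [sE _] := dconv_smooth Du (dilate_test j tphi0).
have [sS DS] := smooth_sum (index_enum ('I_d * 'I_2)%type) (fun il => proj1 (cs il)).
have [_ ->] := smoothD sE sS; rewrite DS addrC addKr.
apply: le_trans (cabs_sum _ _) _; apply: ler_sum => il _; rewrite (cs il).2.
rewrite foldr_cat; exact: cabs_conv_dilate_D (smooth_D s (sF il.2)).
Qed.

End mdfp_family.

Lemma conv_dilate_avg_family L (psi : 'I_2 -> E -> C) : (forall l, test (psi l)) ->
  (forall l a, (morder a < L)%N ->
    cintegral (fun x => (monomial a x)%:C * psi l x) = 0) ->
  exists (K rho : R) (Bs : seq (seq 'I_d)), [/\ 0 <= K, 0 < rho &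
   forall l j g, smooth g -> avg_le rho (fun x => cabs (conv (dilate j (psi l)) g x))
     (fun x => K * (2^-1) ^+ (j * L) * cabs_sum_D Bs g x)].
Proof.
move=> tp mom.
have /choice[P HP] : forall l, exists P : R * R * seq (seq 'I_d), [/\ 0 <= P.1.1, 0 < P.1.2 &
   forall j g, smooth g -> avg_le P.1.2 (fun x => cabs (conv (dilate j (psi l)) g x))
     (fun x => P.1.1 * (2^-1) ^+ (j * L) * cabs_sum_D P.2 g x)].
  move=> l; have [K [rho [Bs [K0 r0 H]]]] := conv_dilate_avg (tp l) (mom l).
  by exists (K, rho, Bs).
exists (\sum_l (P l).1.1), (\sum_l (P l).1.2), (flatten [seq (P l).2 | l <- enum 'I_2]).
have S1 (F : 'I_2 -> R) l : (forall l, 0 <= F l) -> F l <= \sum_l F l.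
  by move=> F0; rewrite (bigD1 l)//= lerDl sumr_ge0.
have K0 l : 0 <= (P l).1.1 by case: (HP l).
have r0 l : 0 <= (P l).1.2 by case: (HP l) => _ /ltW.
split; first by apply: sumr_ge0.
  by apply: lt_le_trans (S1 _ ord0 r0); case: (HP ord0).
move=> l j g sg; have [_ _ H] := HP l.
have mc k Bs : measurable_fun setT (fun x => k * cabs_sum_D Bs g x).
  by apply: measurable_funM; [exact: measurable_cst|exact: measurable_cabs_sum_D].
apply: (avg_le_mono (S1 _ l r0) (mc _ _) (mc _ _) (fun=> lexx _) _ (H j g sg)).
move=> x; have e0 : 0 <= (2^-1 : R) ^+ (j * L) by rewrite exprn_ge0.
rewrite mulr_ge0 ?cabs_sum_D_ge0 ?mulr_ge0//=.
apply: ler_pM; rewrite ?cabs_sum_D_ge0 ?mulr_ge0//; first by rewrite ler_wpM2r// S1.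
rewrite /cabs_sum_D big_flatten/= big_map big_enum/=.
apply: (S1 (fun l => \sum_(b <- (P l).2) cabs (D b g x))) => l'.
by apply: sumr_ge0 => b _; exact: cabs_ge0.
Qed.

End telescoping.

(** * Sufficiency of the bounds *)

Section core.
Context {R : realType} {d : nat}.
Local Open Scope complex_scope.
Local Notation E := 'rV[R]_d.
Local Notation C := R[i].
Local Notation D s F := (foldr partial F s).
Variable omega : E -> R.
Hypotheses (omega_ge0 : forall x, 0 <= omega x) (omega_cont : continuous omega).
Hypothesis omega_moderate : moderate omega.
Variable p : \bar R.
Hypothesis p_ge1 : (1 <= p)%E.
Local Notation wt := (wt omega).
Local Notation wcomp := (wcomp omega).

Definition wD (t : R) (s : seq 'I_d) (g : E -> C) : E -> R :=
  fun x => cabs (D s g x) * wt t x.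

Lemma wD_ge0 t s g x : 0 <= wD t s g x.
Proof. by rewrite mulr_ge0 ?cabs_ge0 ?wt_ge0. Qed.

Lemma measurable_wD t s g : smooth g -> measurable_fun setT (wD t s g).
Proof.
move=> sg; apply: measurable_funM; last exact: wt_measurable.
exact: cmeas_cabs (ccont_cmeas (smooth_ccont (smooth_D s sg))).
Qed.

Lemma wD_le t t' s g B : smooth g -> t <= t' -> lp_le p (wD t' s g) B ->
  lp_le p (wD t s g) B.
Proof.
move=> sg tt; apply: lp_le_mono => //; [exact: measurable_wD|exact: measurable_wD|].
by move=> x; rewrite wD_ge0 /wD ler_wpM2l ?cabs_ge0 ?wt_le.
Qed.

Lemma lp_le_avg_wt rho (T G : E -> R) t t' B : 0 < rho -> wcomp rho t t' -> measurable_fun setT T ->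
  measurable_fun setT G -> (forall x, 0 <= T x) -> (forall x, 0 <= G x) -> 0 <= B ->
  avg_le rho T G -> lp_le p (fun x => G x * wt t' x) B ->
  lp_le p (fun x => T x * wt t x) (2 * (2 * rho) ^+ d * B).
Proof.
move=> r0 wc mT mG T0 G0 B0 TG GB.
have mw t0 : measurable_fun setT (wt t0) by exact: wt_measurable.
apply: (@lp_le_avg _ _ p rho (fun x => T x * wt t x) (fun x => G x * wt t' x)) => //.
- exact: measurable_funM.
- exact: measurable_funM.
- by move=> x; rewrite mulr_ge0 ?wt_ge0.
- by move=> x; rewrite mulr_ge0 ?wt_ge0.
- by apply: avg_le_weight => // x; exact: wt_ge0.
Qed.

(** The growth exponent is a natural number, to be compared with a number of moments; a real [r] is
    rounded up. *)
Definition Dbound (F : nat -> 'I_2 -> E -> C) (k : nat) (t : R) (s : seq 'I_d) :=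
  exists2 B, 0 <= B & forall j l, lp_le p (wD t s (F j l)) (B * 2 ^+ (k * j)).

Lemma Dbound_list F k t s (Bs : seq (seq 'I_d)) : (forall j l, smooth (F j l)) ->
  (forall b, b \in Bs -> Dbound F k t (b ++ s)) ->
  exists2 B, 0 <= B & forall j,
    lp_le p (fun x => (\sum_l cabs_sum_D Bs (D s (F j l)) x) * wt t x) (B * 2 ^+ (k * j)).
Proof.
move=> sF h.
have [B B0 HB] : exists2 B, 0 <= B & forall j l,
    lp_le p (fun x => cabs_sum_D Bs (D s (F j l)) x * wt t x) (B * 2 ^+ (k * j)).
  elim: Bs h => [|b Bs IH] h.
    exists 0 => // j l; rewrite mul0r; have := lp_le_zero (d := d) p_ge1.
    by congr lp_le; apply/funext => x; rewrite /cabs_sum_D big_nil mul0r.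
  have [|B B0 HB] := IH; first by move=> b' hb; apply: h; rewrite inE hb orbT.
  have [B' B'0 HB'] := h b (mem_head _ _).
  exists (B' + B); first exact: addr_ge0.
  move=> j l; have e0 : 0 <= (2 : R) ^+ (k * j) by rewrite exprn_ge0.
  rewrite mulrDl; have := lp_le_add p_ge1 _ _ _ _ _ _ (HB' j l) (HB j l).
  rewrite (_ : (fun x => wD t (b ++ s) (F j l) x + cabs_sum_D Bs (D s (F j l)) x * wt t x) =
     (fun x => cabs_sum_D (b :: Bs) (D s (F j l)) x * wt t x)); last first.
    by apply/funext => x; rewrite /cabs_sum_D big_cons mulrDl /wD foldr_cat.
  apply.
  - exact: measurable_wD.
  - apply: measurable_funM; last exact: wt_measurable.
    exact: measurable_cabs_sum_D (smooth_D s (sF j l)).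
  - by move=> x; exact: wD_ge0.
  - by move=> x; rewrite mulr_ge0 ?wt_ge0 ?cabs_sum_D_ge0.
  - by rewrite mulr_ge0.
  - by rewrite mulr_ge0.
exists (B * 2); first by rewrite mulr_ge0.
move=> j; have e0 : 0 <= (2 : R) ^+ (k * j) by rewrite exprn_ge0.
have -> : B * 2 * 2 ^+ (k * j) = \sum_(l : 'I_2) B * 2 ^+ (k * j).
  by rewrite sumr_const card_ord mulrAC mulr_natr.
have -> : (fun x => (\sum_l cabs_sum_D Bs (D s (F j l)) x) * wt t x) =
    (fun x => \sum_l (cabs_sum_D Bs (D s (F j l)) x * wt t x)).
  by apply/funext => x; rewrite mulr_suml.
apply: (@lp_le_sum _ _ _ p (index_enum 'I_2)
  (fun l x => cabs_sum_D Bs (D s (F j l)) x * wt t x) (fun=> B * 2 ^+ (k * j))) => //.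
- move=> l; apply: measurable_funM; last exact: wt_measurable.
  exact: measurable_cabs_sum_D (smooth_D s (sF j l)).
- by move=> l x; rewrite mulr_ge0 ?wt_ge0 ?cabs_sum_D_ge0.
- by move=> _; rewrite mulr_ge0.
Qed.

Lemma omega_ball rho : exists2 M, 0 <= M & forall x, `|x| <= rho -> omega x <= M.
Proof.
have [A A1 HA] := omega_shift omega_ge0 omega_moderate rho.
exists (A * omega 0); first by rewrite mulr_ge0// (le_trans _ A1).
by move=> x xr; rewrite -[x]add0r; exact: HA.
Qed.

Variables (chi : 'I_2 -> E -> C) (u : (E -> C) -> C).
Hypotheses (tchi : forall l, test (chi l)) (chi_MDFP : MDFP chi).
Hypothesis Du : is_distribution u.
Local Notation F j l := (dconv u (dilate j (chi l))).

(** The radius is fixed before [L]. In (ii) it determines the weight exponent in use, this one the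
    growth exponent, and only the latter determines [L]; a support growing with [L] would close a
    circle. *)
Lemma MDFP_split : exists2 r : R, 0 <= r & forall L, exists (phi psi : 'I_2 -> E -> C),
  [/\ forall l, test (phi l), forall l, test (psi l),
      forall l a, (morder a < L)%N ->
        cintegral (fun x => (monomial a x)%:C * psi l x) = 0, cintegral (phi 0) = 1 &
  [/\ forall x, dilate 1 (phi 0) x - phi 0 x = laplacian (psi 0) x,
      forall x, phi 0 x = \sum_l conv (chi l) (phi l) x,
      forall x, psi 0 x = \sum_l conv (chi l) (psi l) x &
      forall l, zero_outside r (phi l) /\ zero_outside r (psi l)]].
Proof.
have [K [cK [phi [psi [H1 H2]]]]] := chi_MDFP.
have [rho rho0 Ksub] := compact_sub_ball cK.
have tK g : test_on K g -> test g.
  by move=> /(test_on_zero_outside Ksub)[sg zg]; apply/testP; split=> //; exists rho.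
exists rho => // L; have [h1 h2 h3 h4] := H2 L.
have s2 (g h : 'I_2 -> E -> C) x :
    \sum_l conv (g l) (h l) x = conv (g 0) (h 0) x + conv (g 1) (h 1) x.
  rewrite big_ord_recl big_ord1; have -> : lift ord0 ord0 = 1 :> 'I_2 by exact/val_inj.
  by [].
exists (fun l => phi l L), (fun l => psi l L); split => //.
- by move=> l; have [hl _ _ _] := H1 l L; exact: tK.
- by move=> l; have [_ [hl _] _ _] := H1 l L; exact: tK.
- by move=> l a aL; have [_ [_ hl] _ _] := H1 l L; exact: hl.
split; [exact: h1|by move=> x; rewrite s2|by move=> x; rewrite s2|move=> l].
have [hp [hs _] _ _] := H1 l L.
by split; [case: (test_on_zero_outside Ksub hp)|case: (test_on_zero_outside Ksub hs)].
Qed.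

Lemma dconv_dilate_smooth j l : smooth (F j l).
Proof. by have [] := dconv_smooth Du (dilate_test j (tchi l)). Qed.

(** The constants do not depend on the word [s], so the same radius and the same finite set of
    additional derivatives serve all derivatives of the limit. *)
Lemma step_avg (phi psi : 'I_2 -> E -> C) L : (forall l, test (phi l)) ->
  (forall l, test (psi l)) ->
  (forall l a, (morder a < L)%N -> cintegral (fun x => (monomial a x)%:C * psi l x) = 0) ->
  (forall x, dilate 1 (phi 0) x - phi 0 x = laplacian (psi 0) x) ->
  (forall x, phi 0 x = \sum_l conv (chi l) (phi l) x) ->
  (forall x, psi 0 x = \sum_l conv (chi l) (psi l) x) ->
  exists (K rho : R) (Bs : seq (seq 'I_d)), [/\ 0 <= K, 0 < rho &
  forall s,
  (forall j, avg_le rho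
    (fun x => cabs (D s (dconv u (dilate j.+1 (phi 0))) x - D s (dconv u (dilate j (phi 0))) x))
    (fun x => K * 2^-1 ^+ (j * L) * \sum_l cabs_sum_D Bs (D s (F j l)) x)) /\
  avg_le rho (fun x => cabs (D s (dconv u (dilate 0 (phi 0))) x))
    (fun x => K * 2^-1 ^+ (0 * L) * \sum_l cabs_sum_D Bs (D s (F 0%N l)) x)].
Proof.
move=> tphi tpsi mom pd phid psid.
have [K1 [r1 [Bs1 [K10 r10 H1]]]] := conv_dilate_avg_family tpsi mom.
(* The kernels [phi] have no vanishing moments, so [L = 0] is used and the moment condition is
   vacuous. They enter only in the initial term of the telescoping sum. *)
have [K2 [r2 [Bs2 [K20 r20 H2]]]] := conv_dilate_avg_family (L := 0) tphi (fun l a h => False_ind _ (Bool.diff_false_true h)).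
(* The additional derivatives for the increments, taken after the two of the Laplacian, and those
   for the initial term. *)
pose Cs := [seq b ++ [:: i; i] | i <- enum 'I_d, b <- Bs1] ++ Bs2.
exists (K1 + K2), (r1 + r2), Cs; split.
- exact: addr_ge0.
- exact: addr_gt0.
have mc (k : R) Bs (g : E -> C) : smooth g ->
    measurable_fun setT (fun x => k * cabs_sum_D Bs g x).
  move=> sg; apply: measurable_funM; [exact: measurable_cst|].
  exact: measurable_cabs_sum_D sg.
have mS (k : R) Bs j s : measurable_fun setT (fun x => k * \sum_l cabs_sum_D Bs (D s (F j l)) x).
  apply: measurable_funM; [exact: measurable_cst|apply: measurable_sum => l].
  exact: measurable_cabs_sum_D (smooth_D s (dconv_dilate_smooth j l)).
move=> s; split=> [j|].
  have e0 : 0 <= (2^-1 : R) ^+ (j * L) by rewrite exprn_ge0.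
  have hil (il : 'I_d * 'I_2) := H1 il.2 j _ (smooth_D ([:: il.1; il.1] ++ s) (dconv_dilate_smooth j il.2)).
  have := avg_le_sum (index_enum ('I_d * 'I_2)%type) _ _ hil.
  have mil (il : 'I_d * 'I_2) :=
    mc (K1 * 2^-1 ^+ (j * L)) Bs1 _ (smooth_D ([:: il.1; il.1] ++ s) (dconv_dilate_smooth j il.2)).
  have pil (il : 'I_d * 'I_2) x : 0 <= K1 * 2^-1 ^+ (j * L) *
      cabs_sum_D Bs1 (D ([:: il.1; il.1] ++ s) (F j il.2)) x.
    by rewrite !mulr_ge0 ?cabs_sum_D_ge0.
  move=> /(_ mil pil); apply: avg_le_mono.
  - by rewrite lerDl ltW.
  - exact: measurable_sum.
  - exact: mS.
  - by move=> x; exact: (cabs_step tchi tpsi (tphi 0) pd psid Du).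
  move=> x; rewrite sumr_ge0/=; last by move=> il _; exact: pil.
  rewrite -(pair_big predT predT (fun i l => K1 * 2^-1 ^+ (j * L) *
     cabs_sum_D Bs1 (D ([:: i; i] ++ s) (F j l)) x))/= exchange_big/= mulr_sumr.
  apply: ler_sum => l _; rewrite -mulr_sumr.
  have h1 : \sum_i cabs_sum_D Bs1 (D [:: i, i & s] (F j l)) x <= cabs_sum_D Cs (D s (F j l)) x.
    rewrite /cabs_sum_D big_cat/= big_allpairs_dep /= big_enum/=.
    under [X in X + _]eq_bigr do under eq_bigr do rewrite foldr_cat /=.
    by rewrite lerDl sumr_ge0// => b _; exact: cabs_ge0.
  apply: ler_pM => //; first by rewrite mulr_ge0.
    by apply: sumr_ge0 => i _; exact: cabs_sum_D_ge0.
  by rewrite ler_wpM2r// lerDl.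
have hl l := H2 l 0%N _ (smooth_D s (dconv_dilate_smooth 0 l)).
have := avg_le_sum (index_enum 'I_2) _ _ hl.
have ml l := mc (K2 * 2^-1 ^+ (0 * 0)) Bs2 _ (smooth_D s (dconv_dilate_smooth 0 l)).
have pl l x : 0 <= K2 * 2^-1 ^+ (0 * 0) * cabs_sum_D Bs2 (D s (F 0%N l)) x.
  by rewrite !mulr_ge0 ?cabs_sum_D_ge0 ?exprn_ge0.
move=> /(_ ml pl); apply: avg_le_mono.
- by rewrite lerDr ltW.
- exact: measurable_sum.
- exact: mS.
- move=> x; have td l := dilate_test 0 (tchi l); have tp l := dilate_test 0 (tphi l).
  have tc l : test (conv (dilate 0 (chi l)) (dilate 0 (phi l))).
    exact: conv_test (test_bms (td l)) (tp l).
  have cs l := conv_smooth (test_bms (tp l)) (dconv_dilate_smooth 0 l).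
  have -> : dconv u (dilate 0 (phi 0)) =
      fun x => \sum_l conv (dilate 0 (phi l)) (F 0%N l) x.
    have -> : dilate 0 (phi 0) = fun x => \sum_l conv (dilate 0 (chi l)) (dilate 0 (phi l)) x.
      apply/funext => z; rewrite {1}/dilate phid mulr_sumr; apply: eq_bigr => l _.
      by rewrite (conv_dilate 0 (test_bms (tchi l)) (smooth_lbm (test_smooth (tphi l)))).
    apply/funext => z; rewrite (dconv_sum Du _ _ tc); apply: eq_bigr => l _.
    rewrite (dconv_conv Du (td l) (tp l)).
    by rewrite (conv_comm (test_bms (tp l)) (smooth_lbm (dconv_dilate_smooth 0 l))).
  have [_ ->] := smooth_sum (index_enum 'I_2) (fun l => proj1 (cs l)).
  apply: le_trans (cabs_sum _ _) _; apply: ler_sum => l _.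
  by rewrite (cs l).2.
move=> x; rewrite sumr_ge0/=; last by move=> l _; exact: pl.
rewrite -mulr_sumr mul0n expr0 !mulr1.
apply: ler_pM => //; first by apply: sumr_ge0 => i _; exact: cabs_sum_D_ge0.
  by rewrite lerDr.
apply: ler_sum => l _; rewrite [leRHS]/cabs_sum_D big_cat/= lerDr.
by rewrite sumr_ge0// => b _; exact: cabs_ge0.
Qed.

End core.

(** * Summing the telescoping series *)

Section reconstruction.
Context {R : realType} {d : nat}.
Local Open Scope complex_scope.
Local Notation E := 'rV[R]_d.
Local Notation C := R[i].
Local Notation D s F := (foldr partial F s).
Variable omega : E -> R.
Hypotheses (omega_ge0 : forall x, 0 <= omega x) (omega_cont : continuous omega).
Hypothesis omega_moderate : moderate omega.
Variable p : \bar R.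
Hypothesis p_ge1 : (1 <= p)%E.
Local Notation wt := (wt omega).
Local Notation wcomp := (wcomp omega).
Local Notation wD := (wD omega).
Local Notation Dbound := (Dbound omega p).

Lemma Dbound_le F k t t' s : (forall j l, smooth (F j l)) -> t <= t' ->
  Dbound F k t' s -> Dbound F k t s.
Proof.
move=> sF tt [B B0 h]; exists B => // j l.
exact: (wD_le omega_ge0 omega_cont p_ge1 (sF j l) tt (h j l)).
Qed.

Lemma Dbound_uniform F k s (Bs : seq (seq 'I_d)) : (forall j l, smooth (F j l)) ->
  (forall s, exists m : nat, Dbound F k (- m%:R) s) ->
  exists m : nat, forall b, b \in Bs -> Dbound F k (- m%:R) (b ++ s).
Proof.
move=> sF H; elim: Bs => [|b Bs [m IH]]; first by exists 0%N.
have [m' hm'] := H (b ++ s).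
have le1 (n : nat) : (n <= m + m')%N -> - (m + m')%:R <= - n%:R :> R.
  by move=> nm; rewrite lerN2 ler_nat.
exists (m + m')%N => b'; rewrite inE => /orP[/eqP ->|hb].
  by apply: Dbound_le hm' => //; exact: le1 (leq_addl _ _).
by apply: Dbound_le (IH _ hb) => //; exact: le1 (leq_addr _ _).
Qed.

(* [k + 1] vanishing moments beat the growth [2^(kj)] of the bounds. *)
Lemma avg_geometric (k : nat) (rho K B0 t t' : R) (T G : nat -> E -> R) :
  0 < rho -> 0 <= K -> 0 <= B0 -> wcomp rho t t' ->
  (forall j, measurable_fun setT (T j)) -> (forall j, measurable_fun setT (G j)) ->
  (forall j x, 0 <= T j x) -> (forall j x, 0 <= G j x) ->
  (forall j, avg_le rho (T j) (fun x => K * 2^-1 ^+ (j * k.+1) * G j x)) ->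
  (forall j, lp_le p (fun x => G j x * wt t' x) (B0 * 2 ^+ (k * j))) ->
  exists2 B, 0 <= B & forall j, lp_le p (fun x => T j x * wt t x) (B * 2^-1 ^+ j) /\
    forall x, T j x * wt t x <= B * 2^-1 ^+ j.
Proof.
move=> r0 K0 B00 wc mT mG T0 G0 TG GB.
have [Kl Kl0 HKl] := lp_le_local (d := d) p_ge1 r0.
pose A := 2 * (2 * rho) ^+ d.
have A0 : 0 <= A by rewrite mulr_ge0// exprn_ge0// mulr_ge0// ltW.
have KB0 : 0 <= K * B0 by rewrite mulr_ge0.
exists ((A + Kl) * (K * B0)); first by rewrite mulr_ge0// addr_ge0.
move=> j; pose c := K * 2^-1 ^+ (j * k.+1).
have e0 : 0 <= (2^-1 : R) ^+ j by rewrite exprn_ge0.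
have c0 : 0 <= c by rewrite mulr_ge0// exprn_ge0.
have mw t0 : measurable_fun setT (wt t0) by exact: wt_measurable.
have w0 t0 x : 0 <= wt t0 x by exact: wt_ge0.
have b0 : 0 <= B0 * 2 ^+ (k * j) by rewrite mulr_ge0// exprn_ge0.
have cB : c * (B0 * 2 ^+ (k * j)) = K * B0 * 2^-1 ^+ j.
  rewrite /c mulnS mulnC exprD.
  have h : (2^-1 : R) ^+ (k * j) * 2 ^+ (k * j) = 1 by rewrite -exprMn mulVf// expr1n.
  have Hr (a b e f g : R) : e * g = 1 -> a * (b * e) * (f * g) = a * f * b.
    by move=> eg; rewrite -[RHS]mulr1 -eg; ring.
  exact: Hr.
have mGw : measurable_fun setT (fun x => G j x * wt t' x) by exact: measurable_funM.
have Gw0 x : 0 <= G j x * wt t' x by rewrite mulr_ge0.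
have GB' : lp_le p (fun x => c * G j x * wt t' x) (K * B0 * 2^-1 ^+ j).
  have := lp_le_scale p_ge1 mGw Gw0 c0 b0 (GB j); rewrite cB.
  by congr lp_le; apply/funext => x; rewrite mulrA.
have mcG : measurable_fun setT (fun x => c * G j x).
  by apply: measurable_funM; [exact: measurable_cst|].
have cG0 x : 0 <= c * G j x by rewrite mulr_ge0.
have KBe0 : 0 <= K * B0 * 2^-1 ^+ j by rewrite mulr_ge0.
split.
  apply: lp_le_weak (p_ge1) _ (lp_le_avg_wt omega_cont p_ge1 r0 wc (mT j) mcG (T0 j) cG0 KBe0 (TG j) GB').
  by rewrite -/A (mulr_ge0 A0 KBe0) (mulrA A) ler_wpM2r// ler_wpM2r// lerDl.
have hKl : Kl * (K * B0 * 2^-1 ^+ j) <= (A + Kl) * (K * B0) * 2^-1 ^+ j.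
  by rewrite (mulrA Kl) ler_wpM2r// ler_wpM2r// lerDr.
move=> x; apply: le_trans hKl.
have aw := avg_le_weight mcG (mw t') cG0 (w0 t) wc (TG j).
have mcGw : measurable_fun setT (fun x => c * G j x * wt t' x) by exact: measurable_funM.
apply: (HKl (fun x => T j x * wt t x) _ _ x mcGw _ _ KBe0 aw GB').
  by rewrite mulr_ge0.
by move=> z; rewrite mulr_ge0.
Qed.

Lemma avg_geometric_start (k : nat) (rho K B0 t t' : R) (T G : nat -> E -> R) (T' : E -> R) :
  0 < rho -> 0 <= K -> 0 <= B0 -> wcomp rho t t' ->
  (forall j, measurable_fun setT (T j)) -> (forall j, measurable_fun setT (G j)) ->
  measurable_fun setT T' -> (forall j x, 0 <= T j x) -> (forall j x, 0 <= G j x) ->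
  (forall x, 0 <= T' x) ->
  (forall j, avg_le rho (T j) (fun x => K * 2^-1 ^+ (j * k.+1) * G j x)) ->
  avg_le rho T' (fun x => K * G 0%N x) ->
  (forall j, lp_le p (fun x => G j x * wt t' x) (B0 * 2 ^+ (k * j))) ->
  exists2 B, 0 <= B & (forall j, lp_le p (fun x => T j x * wt t x) (B * 2^-1 ^+ j) /\
    forall x, T j x * wt t x <= B * 2^-1 ^+ j) /\ lp_le p (fun x => T' x * wt t x) B.
Proof.
move=> r0 K0 B00 wc mT mG mT' T0 G0 T'0 TG TG' GB.
have [B B0' HB] := avg_geometric r0 K0 B00 wc mT mG T0 G0 TG GB.
(* The initial term is treated as a sequence supported at [j = 0], to which [avg_geometric] applies
   again. *)
pose T2 j : E -> R := if j is 0%N then T' else fun=> 0.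
have [B2 B20 HB2] : exists2 B, 0 <= B & forall j, lp_le p (fun x => T2 j x * wt t x) (B * 2^-1 ^+ j) /\
    forall x, T2 j x * wt t x <= B * 2^-1 ^+ j.
  apply: (avg_geometric r0 K0 B00 wc _ mG _ G0 _ GB).
  - by case=> [|j]; [exact: mT'|exact: measurable_cst].
  - by case=> [|j] x; [exact: T'0|].
  - case=> [|j]; first by under eq_fun do rewrite mul0n expr0 mulr1.
    by move=> x; apply: integral_ge0 => y _; rewrite lee_fin !mulr_ge0 ?exprn_ge0.
exists (B + B2); first exact: addr_ge0.
have le1 j : B * 2^-1 ^+ j <= (B + B2) * 2^-1 ^+ j.
  by rewrite ler_wpM2r ?exprn_ge0// lerDl.
split; last first.
  have [h _] := HB2 0%N; rewrite expr0 mulr1 in h.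
  by apply: lp_le_weak p_ge1 _ h; rewrite B20 lerDr.
move=> j; have [h1 h2] := HB j; split; last by move=> x; exact: le_trans (h2 x) (le1 j).
by apply: lp_le_weak p_ge1 _ h1; rewrite le1 andbT mulr_ge0// exprn_ge0.
Qed.

(** The modulus of [e j] lies below the modulus of [e 0] plus those of the increments. By Minkowski
    this majorant has norm at most [B + 2 B], the geometric series summing to 2, and the Fatou bound
    for the limit doubles it. *)
Lemma lp_le_telescope (e : nat -> E -> C) (g : E -> C) (t B : R) :
  (forall j, ccont (e j)) -> ccont g -> 0 <= B ->
  (forall x, exists2 B', 0 <= B' & forall j, cabs (e j x - g x) <= B' * 2^-1 ^+ j) ->
  lp_le p (fun x => cabs (e 0%N x) * wt t x) B ->
  (forall j, lp_le p (fun x => cabs (e j.+1 x - e j x) * wt t x) (B * 2^-1 ^+ j)) ->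
  lp_le p (fun x => cabs (g x) * wt t x) (2 * (B + B * 2)).
Proof.
move=> ce cg B0 Hg HE0 HB.
have mce h : ccont h -> measurable_fun setT (fun x => cabs (h x) * wt t x).
  move=> ch; apply: measurable_funM; last exact: wt_measurable.
  exact: cmeas_cabs (ccont_cmeas ch).
pose dw j := fun x => cabs (e j.+1 x - e j x) * wt t x.
pose Fj j x := cabs (e 0%N x) * wt t x + \sum_(i < j) dw i x.
have c0 h x : 0 <= cabs (h x : C) * wt t x by rewrite mulr_ge0 ?cabs_ge0 ?wt_ge0.
have d0 j x : 0 <= dw j x by rewrite mulr_ge0 ?cabs_ge0 ?wt_ge0.
have md j : measurable_fun setT (dw j).
  apply: mce; have := ccontD (ce j.+1) (ccontZ (-1) (ce j)).
  by congr ccont; apply/funext => x; rewrite mulN1r.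
have mS j : measurable_fun setT (fun x => \sum_(i < j) dw i x).
  by apply: measurable_sum => i.
have S0 j x : 0 <= \sum_(i < j) dw i x by rewrite sumr_ge0.
have geo j : \sum_(i < j) B * 2^-1 ^+ i <= B * 2.
  have -> : \sum_(i < j) B * 2^-1 ^+ i = B * 2 - B * 2 * 2^-1 ^+ j.
    elim: j => [|j IH]; first by rewrite big_ord0 expr0 mulr1 subrr.
    by rewrite big_ord_recr/= IH exprS; field.
  by rewrite lerBlDr lerDl mulr_ge0 ?mulr_ge0// exprn_ge0.
have BB : 0 <= B + B * 2 by rewrite addr_ge0// mulr_ge0.
apply: (@lp_le_fatou _ _ p Fj _ _ p_ge1).
- by move=> j; apply: measurable_funD => //; exact: mce.
- exact: mce.
- by move=> j x; apply: addr_ge0; [exact: c0|exact: S0].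
- by move=> x; exact: c0.
- exact: BB.
- move=> x eps eps0; have [B' B'0 HB'] := Hg x.
  have [N HN] := geo_small (B' * wt t x) eps0.
  exists N => j Nj; apply: le_trans (_ : _ <= Fj j x + (B' * wt t x) * 2^-1 ^+ j) _; last first.
    by rewrite lerD2l HN.
  have h1 : cabs (e j x) <= cabs (e 0%N x) + \sum_(i < j) cabs (e i.+1 x - e i x).
    elim: j {Nj} => [|j IH]; first by rewrite big_ord0 addr0.
    rewrite big_ord_recr/= addrA.
    have h := cabsD (e j.+1 x - e j x) (e j x); rewrite subrK in h.
    by apply: le_trans h _; rewrite [leLHS]addrC lerD2r.
  have h2 : cabs (g x) <= cabs (e j x) + B' * 2^-1 ^+ j.
    rewrite -[g x](subrK (e j x)) addrC; apply: le_trans (cabsD _ _) _.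
    by rewrite lerD2l cabsBC; exact: HB'.
  rewrite /Fj /dw -mulr_suml mulrAC -!mulrDl ler_wpM2r ?wt_ge0//.
  by apply: le_trans h2 _; rewrite lerD2r.
have Sg j : 0 <= \sum_(i < j) B * 2^-1 ^+ i.
  by apply: sumr_ge0 => i _; rewrite mulr_ge0// exprn_ge0.
move=> j; apply: lp_le_weak p_ge1 _ (_ : lp_le p (Fj j) (B + \sum_(i < j) B * 2^-1 ^+ i)).
  by rewrite lerD2l geo andbT addr_ge0.
apply: (lp_le_add p_ge1 (mce _ (ce 0%N)) (mS j) (c0 _) (S0 j) B0 (Sg j) HE0).
apply: (@lp_le_sum _ _ _ p (index_enum 'I_j) dw (fun i => B * 2^-1 ^+ i) p_ge1).
- by move=> i.
- by move=> i x.
- by move=> i; rewrite mulr_ge0// exprn_ge0.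
- by move=> i; exact: HB.
Qed.

Variables (chi : 'I_2 -> E -> C) (u : (E -> C) -> C).
Hypotheses (tchi : forall l, test (chi l)) (chi_MDFP : MDFP chi).
Hypothesis Du : is_distribution u.
Local Notation F := (fun j l => dconv u (dilate j (chi l))).

(** The value [u theta] is the convolution of [u] with the reflected [theta] at 0. Mollified by
    [phi] it becomes the integral of [theta] against [dconv u (dilate j phi)], which tends to the
    integral against [g]. *)
Lemma distr_of_limit phi g : test phi -> cintegral phi = 1 -> smooth g ->
  (forall rho, exists2 B, 0 <= B & forall j x, `|x| <= rho ->
     cabs (dconv u (dilate j phi) x - g x) <= B * 2^-1 ^+ j) ->
  forall theta, test theta -> u theta = distr_of g theta.
Proof.
move=> tphi iphi sg Hg theta tth.
pose tr := fun y => theta (0 - y); have ttr : test tr by exact: test_reflect.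
have [B B0 HB] := dconv_mollify Du tphi iphi ttr 0.
have [sth [rho rho0 zth]] := (testP _).1 tth.
have [M M0 HM] := test_bounded tth.
have [B' B'0 HB'] := Hg rho.
have utr : dconv u tr 0 = u theta.
  by rewrite /dconv /tr; congr u; apply/funext => y; rewrite !sub0r opprK.
have sE j : smooth (dconv u (dilate j phi)) by have [] := dconv_smooth Du (dilate_test j tphi).
have cE j : dconv u (conv (dilate j phi) tr) 0 =
    cintegral (fun y => theta y * dconv u (dilate j phi) y).
  rewrite (dconv_conv Du (dilate_test j tphi) ttr) /conv; congr cintegral.
  by apply/funext => y; rewrite /tr mulrC !sub0r opprK.
apply/subr0_eq/cabs0_eq0/eqP; rewrite eq_le cabs_ge0 andbT.
apply: (@le_geo _ _ _ (B + 2 * (M * B') * (2 * rho) ^+ d)) => j; rewrite add0r mulrDl.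
pose I := cintegral (fun y => theta y * dconv u (dilate j phi) y).
have -> : u theta - distr_of g theta = (u theta - I) + (I - distr_of g theta).
  by rewrite addrA subrK.
apply: le_trans (cabsD _ _) _; apply: lerD.
  by rewrite cabsBC -utr /I -cE HB// normr0.
have -> : I - distr_of g theta =
    cintegral (fun y => theta y * (dconv u (dilate j phi) y - g y)).
  have h1 := bms_cintegrable (bmsM (test_bms tth) (smooth_lbm (sE j))).
  have h2 := bms_cintegrable (bmsM (test_bms tth) (smooth_lbm sg)).
  rewrite /I /distr_of -mulN1r -[in LHS](_ : (fun y => theta y * g y) = fun y => g y * theta y);
    last by apply/funext => y; rewrite mulrC.
  rewrite -(cintegralZ _ h2) -(cintegralD h1 (cintegrableZ _ h2)).
  by congr cintegral; apply/funext => y; ring.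
have e0 : 0 <= B' * (2^-1 : R) ^+ j by rewrite mulr_ge0// exprn_ge0.
have := cintegral_mul_le M0 rho0 e0 (test_bms tth).1 HM zth
  (lbmB (smooth_lbm (sE j)) (smooth_lbm sg)) (HB' j).
by move=> h; apply: le_trans h _; rewrite le_eqVlt; apply/orP; left; apply/eqP; ring.
Qed.

(** The hypothesis asks for some decaying weight per derivative, just enough for locally uniform
    convergence. The conclusion then transfers any weighted bound, which serves (i) with growing
    weights and (iii) with decaying ones. *)
Lemma reconstruction k : (forall s, exists m : nat, Dbound F k (- m%:R) s) ->
  exists2 g, smooth g & (forall theta, test theta -> u theta = distr_of g theta) /\
  exists (rho : R) (Bs : seq (seq 'I_d)), forall s t t', wcomp rho t t' ->
    (forall b, b \in Bs -> Dbound F k t' (b ++ s)) ->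
    exists2 B, 0 <= B & lp_le p (wD t s g) B.
Proof.
move=> HD; have sF := dconv_dilate_smooth tchi Du.
have [r0 _ /(_ k.+1)[phi [psi [tphi tpsi mom iphi [pd phid psid _]]]]] := MDFP_split chi_MDFP.
have [K [rho [Bs [K0 rho0 H]]]] := step_avg tchi Du tphi tpsi mom pd phid psid.
pose e j := dconv u (dilate j (phi 0)).
have se j : smooth (e j) by have [] := dconv_smooth Du (dilate_test j (tphi 0)).
pose df s j := fun x => cabs (D s (e j.+1) x - D s (e j) x).
have mdf s j : measurable_fun setT (df s j).
  apply: cmeas_cabs; apply: ccont_cmeas.
  have := ccontD (smooth_ccont (smooth_D s (se j.+1))) (ccontZ (-1) (smooth_ccont (smooth_D s (se j)))).
  by congr ccont; apply/funext => x; rewrite mulN1r.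
have step s t t' : wcomp rho t t' -> (forall b, b \in Bs -> Dbound F k t' (b ++ s)) ->
    exists2 B, 0 <= B & (forall j, lp_le p (fun x => df s j x * wt t x) (B * 2^-1 ^+ j) /\
      forall x, df s j x * wt t x <= B * 2^-1 ^+ j) /\ lp_le p (wD t s (e 0%N)) B.
  move=> wc hb; have [B0 B00 HB0] := Dbound_list omega_cont p_ge1 sF hb.
  pose G j := fun x => \sum_l cabs_sum_D Bs (D s (dconv u (dilate j (chi l)))) x.
  have mG j : measurable_fun setT (G j).
    by apply: measurable_sum => l; exact: measurable_cabs_sum_D (smooth_D s (sF j l)).
  have G0 j x : 0 <= G j x by apply: sumr_ge0 => l _; exact: cabs_sum_D_ge0.
  have [H1 H2] := H s.
  have me : measurable_fun setT (fun x => cabs (D s (e 0%N) x)).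
    exact: cmeas_cabs (ccont_cmeas (smooth_ccont (smooth_D s (se 0%N)))).
  have H2' : avg_le rho (fun x => cabs (D s (e 0%N) x)) (fun x => K * G 0%N x).
    by move: H2; under [X in avg_le _ _ X]eq_fun do rewrite mul0n expr0 mulr1.
  exact: (avg_geometric_start rho0 K0 B00 wc (mdf s) mG me (fun _ _ => cabs_ge0 _) G0
    (fun _ => cabs_ge0 _) H1 H2' HB0).
have [|g sg Hg] := smooth_limit se.
  move=> s r; have [m hm] := Dbound_uniform s Bs sF HD.
  have [m' wc] := wcomp_down omega_ge0 omega_moderate rho m.
  have [B B0 [HB _]] := step s _ _ wc hm.
  (* On a ball [omega] is bounded, so the decaying weight is bounded below and can be divided out of
     the pointwise estimate. *)
  have [M M0 HM] := omega_ball omega_ge0 omega_moderate r.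
  exists (B * expR (m'%:R * M)); first by rewrite mulr_ge0// expR_ge0.
  move=> j x xr; have [_ h] := HB j.
  have := h x; rewrite /df mulrAC => h1.
  rewrite -ler_pdivrMr ?expR_gt0// -expRN; apply: le_trans h1.
  rewrite ler_wpM2l ?cabs_ge0// ler_expR mulNr lerN2 ler_wpM2l//; exact: HM.
exists g => //; split.
  by apply: (distr_of_limit (tphi 0) iphi sg) => r; exact: (Hg [::] r).
exists rho, Bs => s t t' wc hb; have [B B0 [HB HE0]] := step s t t' wc hb.
exists (2 * (B + B * 2)); first by rewrite mulr_ge0// addr_ge0// mulr_ge0.
apply: (lp_le_telescope (fun j => smooth_ccont (smooth_D s (se j)))
  (smooth_ccont (smooth_D s sg)) B0 _ HE0).
- by move=> x; have [B' B'0 HB'] := Hg s `|x|; exists B' => // j; exact: HB'.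
- by move=> j; case: (HB j).
Qed.

End reconstruction.

(** * Weighted bounds for convolutions with a test function *)

Section convolution_bounds.
Context {R : realType} {d : nat}.
Local Open Scope complex_scope.
Local Notation E := 'rV[R]_d.
Local Notation C := R[i].
Local Notation D s F := (foldr partial F s).
Local Notation mu := (lebesgue_rV R d).

Lemma conv_avg (k g : E -> C) (S rho : R) : bms k -> zero_outside rho k -> lbm g ->
  0 <= S -> (forall x, cabs (k x) <= S) ->
  avg_le rho (fun x => cabs (conv k g x)) (fun x => 2 * S * cabs (g x)).
Proof.
move=> bk zk lg S0 kS x.
have mb : measurable (ball0 rho : set E) by exact: measurable_ball_rV.
have bkg := bmsM bk (lbm_reflect x lg).
apply: le_trans (cabs_cintegral (bms_cintegrable bkg) bkg.1) _.
have m1 : measurable_fun setT (fun y : E => cabs (k y * g (x - y))) := cmeas_cabs bkg.1.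
have mg : measurable_fun setT (fun y : E => cabs (g (x - y))) := cmeas_cabs (lbm_reflect x lg).1.
have m2 : measurable_fun setT (fun y : E => (2 * S * cabs (g (x - y)))%:E).
  by apply/measurable_EFinP; apply: measurable_funM; [exact: measurable_cst|].
rewrite -ge0_integralZl_EFin//; first last.
- exact/measurable_EFinP.
- by move=> y _; rewrite lee_fin cabs_ge0.
rewrite [leRHS]integral_mkcond; apply: ge0_le_integral => //.
- by move=> y _; rewrite -EFinM lee_fin mulr_ge0// cabs_ge0.
- by apply: emeasurable_funM; [exact: measurable_cst|exact/measurable_EFinP].
- by apply/(measurable_restrictT _ mb); exact: measurable_funTS.
move=> y _; rewrite patchE; case: ifPn => yr.
  by rewrite -EFinM lee_fin cabsM mulrA !ler_wpM2r ?cabs_ge0// ler_wpM2l.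
rewrite zk ?mul0r ?cabs0 ?mule0//.
by rewrite ltNge; apply: contra yr => yr; rewrite inE.
Qed.

Variable omega : E -> R.
Hypotheses (omega_ge0 : forall x, 0 <= omega x) (omega_cont : continuous omega).
Hypothesis omega_moderate : moderate omega.
Variable p : \bar R.
Hypothesis p_ge1 : (1 <= p)%E.
Local Notation wt := (wt omega).
Local Notation wD := (wD omega).
Local Notation Dbound := (Dbound omega p).
Variables (chi : 'I_2 -> E -> C) (u : (E -> C) -> C).
Hypotheses (tchi : forall l, test (chi l)) (chi_MDFP : MDFP chi).
Hypothesis Du : is_distribution u.
Local Notation F := (fun j l => dconv u (dilate j (chi l))).

(** Every derivative of [theta] is bounded on the whole space, so the domination by averages becomes
    a bound uniform in [x]. *)
Lemma dil_lap_conv_small (psi : 'I_2 -> E -> C) L (theta : E -> C) :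
  (forall l, test (psi l)) ->
  (forall l a, (morder a < L)%N -> cintegral (fun x => (monomial a x)%:C * psi l x) = 0) ->
  test theta -> exists2 S, 0 <= S & forall j il x,
    cabs (conv (dil_lap psi j il) theta x) <= S * 2^-1 ^+ (j * L).
Proof.
move=> tpsi mom tth; have sth := test_smooth tth.
have [K [rho [Bs [K0 r0 H]]]] := conv_dilate_avg_family tpsi mom.
have [M M0 HM] : exists2 M, 0 <= M & forall (i : 'I_d) x,
    cabs_sum_D Bs (D [:: i; i] theta) x <= M.
  have /choice[Ms HMs] : forall i : 'I_d, exists M, 0 <= M /\ forall x,
      cabs_sum_D Bs (D [:: i; i] theta) x <= M.
    move=> i; elim: Bs {H} => [|b Bs [M [M0 HM]]].
      by exists 0; split => // x; rewrite /cabs_sum_D big_nil.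
    have [M' M'0 HM'] := test_bounded (test_D b (test_D [:: i; i] tth)).
    exists (M' + M); split; first exact: addr_ge0.
    by move=> x; rewrite /cabs_sum_D big_cons; apply: lerD; [exact: HM'|exact: HM].
  exists (\sum_i Ms i); first by apply: sumr_ge0 => i _; case: (HMs i).
  move=> i x; have [_ h] := HMs i; apply: le_trans (h x) _.
  by rewrite (bigD1 i)//= lerDl sumr_ge0// => i' _; case: (HMs i').
exists (K * M * (2 * rho) ^+ d).
  by rewrite !mulr_ge0// exprn_ge0// mulr_ge0// ltW.
move=> j il x; apply: le_trans (cabs_conv_dilate_D j _ x (tpsi il.2) sth) _.
have sD := smooth_D [:: il.1; il.1] sth.
have h := H il.2 j _ sD.
have e0 : 0 <= (2^-1 : R) ^+ (j * L) by rewrite exprn_ge0.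
have mG : measurable_fun setT
    (fun y => K * 2^-1 ^+ (j * L) * cabs_sum_D Bs (D [:: il.1; il.1] theta) y).
  by apply: measurable_funM; [exact: measurable_cst|exact: measurable_cabs_sum_D sD].
have G0 y : 0 <= K * 2^-1 ^+ (j * L) * cabs_sum_D Bs (D [:: il.1; il.1] theta) y.
  by rewrite !mulr_ge0 ?cabs_sum_D_ge0.
have GM y : K * 2^-1 ^+ (j * L) * cabs_sum_D Bs (D [:: il.1; il.1] theta) y <=
    K * 2^-1 ^+ (j * L) * M by rewrite ler_wpM2l ?HM ?mulr_ge0.
apply: le_trans (avg_le_sup x (ltW r0) mG G0 h GM) _.
by rewrite le_eqVlt; apply/orP; left; apply/eqP; ring.
Qed.

(* The Laplacian and the vanishing moments are spent on [theta], so that no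
   derivative of the convolutions with the dilates of [chi] is needed. *)
Lemma dconv_weighted_bound (n : nat) (theta : E -> C) :
  (forall n : nat, exists k, Dbound F k n%:R [::]) -> test theta ->
  exists2 B, 0 <= B & lp_le p (fun x => cabs (dconv u theta x) * wt n%:R x) B.
Proof.
move=> HF tth; have sF := dconv_dilate_smooth tchi Du.
have [r r0 Hr] := MDFP_split chi_MDFP.
have [sth [r1 r10 zth]] := (testP _).1 tth.
(* The supports of [phi l], [psi l] and [theta] fix the radius; the summand 1 makes it positive.
   Only then are the weight exponent [n'], the growth [k] that belongs to it and the number [k.+1]
   of moments chosen. *)
pose rho := r + r1 + 1; have rho0 : 0 < rho by rewrite ltr_wpDl// addr_ge0.
have [n' wc] := wcomp_up omega_ge0 omega_moderate rho n.
have [k [B0 B00 HB0]] := HF n'.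
have [phi [psi [tphi tpsi mom iphi [pd phid psid zo]]]] := Hr k.+1.
have [S S0 HS] := dil_lap_conv_small tpsi mom tth.
have [S' S'0 HS'] : exists2 S', 0 <= S' & forall l x, cabs (conv (dilate 0 (phi l)) theta x) <= S'.
  have /choice[Ms HMs] : forall l : 'I_2, exists M, 0 <= M /\ forall x,
      cabs (conv (dilate 0 (phi l)) theta x) <= M.
    move=> l; have [M M0 HM] := test_bounded (conv_test (test_bms (dilate_test 0 (tphi l))) tth).
    by exists M.
  exists (\sum_i Ms i); first by apply: sumr_ge0 => i _; case: (HMs i).
  move=> i x; have [_ h] := HMs i; apply: le_trans (h x) _.
  by rewrite (bigD1 i)//= lerDl sumr_ge0// => i' _; case: (HMs i').
pose G j x := \sum_l cabs (dconv u (dilate j (chi l)) x).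
have mc j l : measurable_fun setT (fun x => cabs (dconv u (dilate j (chi l)) x)).
  exact: cmeas_cabs (ccont_cmeas (smooth_ccont (sF j l))).
have mG j : measurable_fun setT (G j) by apply: measurable_sum => l.
have G0 j x : 0 <= G j x by apply: sumr_ge0 => l _; exact: cabs_ge0.
pose e j := dconv u (conv (dilate j (phi 0)) theta).
have te j : test (conv (dilate j (phi 0)) theta).
  exact: conv_test (test_bms (dilate_test j (tphi 0))) tth.
have se j : smooth (e j) by have [] := dconv_smooth Du (te j).
pose T j x := cabs (e j.+1 x - e j x).
have mT j : measurable_fun setT (T j).
  apply: cmeas_cabs; apply: ccont_cmeas.
  have := ccontD (smooth_ccont (se j.+1)) (ccontZ (-1) (smooth_ccont (se j))).
  by congr ccont; apply/funext => x; rewrite mulN1r.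
have zconv (h : E -> C) : zero_outside r h -> zero_outside rho (conv h theta).
  by move=> zh x xr; apply: (conv_zero_outside zh zth); apply: le_lt_trans xr; rewrite lerDl.
have ltest := smooth_lbm sth.
have avg1 (h : E -> C) j l s : test h -> zero_outside r h -> 0 <= s ->
    (forall x, cabs (conv h theta x) <= s) ->
    avg_le rho (fun x => cabs (conv (dconv u (dilate j (chi l))) (conv h theta) x))
      (fun x => 2 * s * cabs (dconv u (dilate j (chi l)) x)).
  move=> th zh s0 hs; have tc := conv_test (test_bms th) tth.
  rewrite -(conv_comm (test_bms tc) (smooth_lbm (sF j l))).
  exact: conv_avg (test_bms tc) (zconv h zh) (smooth_lbm (sF j l)) s0 hs.
pose K := d%:R * (2 * S) + 2 * S'.
have dS0 : 0 <= d%:R * (2 * S) by rewrite !mulr_ge0.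
have K0 : 0 <= K by rewrite addr_ge0// mulr_ge0.
have mcG (c : R) j : measurable_fun setT (fun x => c * G j x).
  by apply: measurable_funM; [exact: measurable_cst|].
have TG j : avg_le rho (T j) (fun x => K * 2^-1 ^+ (j * k.+1) * G j x).
  have e0 : 0 <= (2^-1 : R) ^+ (j * k.+1) by rewrite exprn_ge0.
  have zl (il : 'I_d * 'I_2) : zero_outside r (dil_lap psi j il).
    have zD := @zero_outside_D _ _ _ _ [:: il.1; il.1] (test_smooth (tpsi il.2)) (zo il.2).2.
    exact: dilate_zero_outside r0 zD.
  have hil (il : 'I_d * 'I_2) := avg1 _ j il.2 _ (dil_lap_test tpsi j il) (zl il)
    (mulr_ge0 S0 e0) (HS j il).
  have mil (il : 'I_d * 'I_2) : measurable_fun setT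
      (fun x => 2 * (S * 2^-1 ^+ (j * k.+1)) * cabs (dconv u (dilate j (chi il.2)) x)).
    by apply: measurable_funM; [exact: measurable_cst|exact: mc].
  have pil (il : 'I_d * 'I_2) x :
      0 <= 2 * (S * 2^-1 ^+ (j * k.+1)) * cabs (dconv u (dilate j (chi il.2)) x).
    by rewrite !mulr_ge0 ?cabs_ge0.
  apply: avg_le_mono (lexx _) _ _ _ _ (avg_le_sum (index_enum ('I_d * 'I_2)%type) mil pil hil).
  - exact: measurable_sum.
  - exact: mcG.
  - move=> x; rewrite /T /e (dconv_telescoping tchi tpsi (tphi 0) pd psid Du j x tth).
    by rewrite addrC addKr; exact: cabs_sum.
  move=> x; rewrite sumr_ge0/=; last by move=> il _; exact: pil.
  rewrite -(pair_big predT predT (fun (i : 'I_d) l => 2 * (S * 2^-1 ^+ (j * k.+1)) *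
     cabs (dconv u (dilate j (chi l)) x)))/= sumr_const card_ord -mulr_sumr -[leLHS]mulr_natl.
  rewrite -/(G j x) [leLHS](_ : _ = d%:R * (2 * S) * 2^-1 ^+ (j * k.+1) * G j x); last by ring.
  by rewrite ler_wpM2r// ler_wpM2r// lerDl mulr_ge0.
have me : measurable_fun setT (fun x => cabs (e 0%N x)).
  exact: cmeas_cabs (ccont_cmeas (smooth_ccont (se 0%N))).
have TG' : avg_le rho (fun x => cabs (e 0%N x)) (fun x => K * G 0%N x).
  have zl l : zero_outside r (dilate 0 (phi l)).
    by apply: dilate_zero_outside => //; exact: (zo l).1.
  have tp l := dilate_test 0 (tphi l); have td l := dilate_test 0 (tchi l).
  have hl l := avg1 _ 0%N l _ (tp l) (zl l) S'0 (HS' l).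
  have ml l : measurable_fun setT (fun x => 2 * S' * cabs (dconv u (dilate 0 (chi l)) x)).
    by apply: measurable_funM; [exact: measurable_cst|exact: mc].
  have pl l x : 0 <= 2 * S' * cabs (dconv u (dilate 0 (chi l)) x).
    by rewrite !mulr_ge0 ?cabs_ge0.
  apply: avg_le_mono (lexx _) _ _ _ _ (avg_le_sum (index_enum 'I_2) ml pl hl).
  - exact: measurable_sum.
  - exact: mcG.
  - move=> x; have tc l : test (conv (dilate 0 (chi l)) (dilate 0 (phi l))).
      exact: conv_test (test_bms (td l)) (tp l).
    have tc2 l : test (conv (dilate 0 (phi l)) theta) by exact: conv_test (test_bms (tp l)) tth.
    have tc3 l : test (conv (dilate 0 (chi l)) (conv (dilate 0 (phi l)) theta)).
      exact: conv_test (test_bms (td l)) (tc2 l).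
    have -> : e 0%N x = \sum_l conv (dconv u (dilate 0 (chi l))) (conv (dilate 0 (phi l)) theta) x.
      have E0 : conv (dilate 0 (phi 0)) theta =
          fun z => \sum_l conv (dilate 0 (chi l)) (conv (dilate 0 (phi l)) theta) z.
        have -> : dilate 0 (phi 0) = fun x => \sum_l conv (dilate 0 (chi l)) (dilate 0 (phi l)) x.
          apply/funext => z; rewrite {1}/dilate phid mulr_sumr; apply: eq_bigr => l _.
          by rewrite (conv_dilate 0 (test_bms (tchi l)) (smooth_lbm (test_smooth (tphi l)))).
        rewrite (conv_comm (test_bms (test_sum (index_enum 'I_2) tc)) ltest).
        rewrite (conv_sum_r _ (test_bms tth)); last by move=> l; exact: bms_lbm (test_bms (tc l)).
        apply/funext => z; apply: eq_bigr => l _.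
        by rewrite (conv_assoc (td l) (tp l) tth) (conv_comm (test_bms (tc l)) ltest).
      rewrite /e E0 (dconv_sum Du _ _ tc3); apply: eq_bigr => l _.
      by rewrite (dconv_conv Du (td l) (tc2 l)).
    exact: cabs_sum.
  move=> x; rewrite sumr_ge0/=; last by move=> l _; exact: pl.
  by rewrite -mulr_sumr -/(G 0%N x) ler_wpM2r// /K lerDr.
have GB j : lp_le p (fun x => G j x * wt n'%:R x) (B0 * 2 * 2 ^+ (k * j)).
  have -> : B0 * 2 * 2 ^+ (k * j) = \sum_(l : 'I_2) B0 * 2 ^+ (k * j).
    by rewrite sumr_const card_ord mulrAC mulr_natr.
  have -> : (fun x => G j x * wt n'%:R x) =
      (fun x => \sum_l wD n'%:R [::] (dconv u (dilate j (chi l))) x).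
    by apply/funext => x; rewrite mulr_suml.
  apply: (@lp_le_sum _ _ _ p (index_enum 'I_2)
    (fun l => wD n'%:R [::] (dconv u (dilate j (chi l)))) (fun=> B0 * 2 ^+ (k * j))) => //.
  - by move=> l; exact: (measurable_wD omega_cont n'%:R [::] (sF j l)).
  - by move=> l x; exact: wD_ge0.
  - by move=> _; rewrite mulr_ge0// exprn_ge0.
have B020 : 0 <= B0 * 2 by rewrite mulr_ge0.
have [B B0' [HB HE0]] := avg_geometric_start omega_cont p_ge1 rho0 K0 B020 wc mT mG me
  (fun _ _ => cabs_ge0 _) G0 (fun _ => cabs_ge0 _) TG TG' GB.
have [sg _] := dconv_smooth Du tth.
exists (2 * (B + B * 2)); first by rewrite mulr_ge0// addr_ge0// mulr_ge0.
apply: (lp_le_telescope omega_cont p_ge1 (fun j => smooth_ccont (se j)) (smooth_ccont sg) B0' _ HE0).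
- move=> x; have [B' B'0 HB'] := dconv_mollify Du (tphi 0) iphi tth `|x|.
  by exists B' => // j; exact: HB'.
- by move=> j; case: (HB j).
Qed.

End convolution_bounds.

(** * A gliding hump argument *)

Section gliding_hump.
Context {R : realType} {d : nat}.
Local Open Scope complex_scope.
Local Notation E := 'rV[R]_d.
Local Notation C := R[i].
Local Notation mu := (lebesgue_rV R d).
Variable p : \bar R.
Hypothesis p_ge1 : (1 <= p)%E.

Definition trunc_real (rho : R) (H : E -> R) x := if `|x| <= rho then H x else 0.

Lemma trunc_real_ge0 rho (H : E -> R) x : (forall x, 0 <= H x) -> 0 <= trunc_real rho H x.
Proof. by move=> H0; rewrite /trunc_real; case: ifP. Qed.

Lemma measurable_trunc_real rho (H : E -> R) : measurable_fun setT H ->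
  measurable_fun setT (trunc_real rho H).
Proof.
move=> mH; apply: measurable_fun_ifT => //.
apply: measurable_fun_ler => //.
by apply: continuous_measurable_rV; exact: norm_continuous.
Qed.

(** One threshold for every [p]: since [c <= 1], the power [c^r] is at most [c], and [c] times the
    volume of the ball is at most 1. *)
Lemma lp_le_trunc_cst (rho c : R) : 0 <= rho -> 0 <= c <= ((2 * rho) ^+ d + 1)^-1 ->
  lp_le p (trunc_real rho (fun=> c)) 1.
Proof.
move=> r0 /andP[c0 cV]; have V0 : 0 <= (2 * rho) ^+ d by rewrite exprn_ge0// mulr_ge0.
have V1 : 0 < (2 * rho) ^+ d + 1 by rewrite ltr_wpDl.
have cV1 : c * ((2 * rho) ^+ d + 1) <= 1 by rewrite -ler_pdivlMr// div1r.
have c1 : c <= 1 by apply: le_trans cV _; rewrite invf_le1// lerDr.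
case: p p_ge1 => [r| |//] r1; last by move=> x; rewrite /trunc_real; case: ifP.
rewrite lee_fin in r1; rewrite /lp_le powR1.
have r00 : r != 0 by rewrite gt_eqF// (lt_le_trans ltr01).
have mb : measurable (ball0 rho : set E) by exact: measurable_ball_rV.
have -> : (\int[mu]_x (trunc_real rho (fun=> c) x `^ r)%:E =
    \int[mu]_(x in ball0 rho) (c `^ r)%:E)%E.
  rewrite [RHS]integral_mkcond; apply: eq_integral => x _.
  rewrite patchE /trunc_real; case: ifPn => h; first by rewrite mem_set.
  by rewrite memNset ?powR0//; exact/negP.
apply: le_trans (_ : (c `^ r)%:E * ((2 * rho) ^+ d)%:E <= _)%E.
  rewrite -lebesgue_rV_ball//.
  by rewrite le_eqVlt; apply/orP; left; apply/eqP; exact: (integral_cst mu mb (c `^ r)%:E).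
rewrite -EFinM lee_fin; apply: le_trans cV1; rewrite ler_pM ?powR_ge0 ?lerDl//.
have [->|cn0] := eqVneq c 0; first by rewrite powR0.
have cp : 0 < c by rewrite lt_neqAle eq_sym cn0.
by apply: ge1r_powR; rewrite ?cp.
Qed.

(** Fatou's lemma along growing balls, in contrapositive form; its lossy factor 2 reappears here. *)
Lemma lp_le_exhaust (H : E -> R) (M : R) : measurable_fun setT H -> (forall x, 0 <= H x) ->
  0 <= M -> ~ lp_le p H (2 * M) -> exists2 rho : R, 0 <= rho & ~ lp_le p (trunc_real rho H) M.
Proof.
move=> mH H0 M0 nH; apply: contrapT => hn; apply: nH.
apply: (@lp_le_fatou _ _ p (fun n => trunc_real n%:R H)) => //.
- by move=> n; exact: measurable_trunc_real.
- by move=> n x; exact: trunc_real_ge0.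
- move=> x e e0; exists (Num.bound `|x|) => n hn'; rewrite /trunc_real ifT ?lerDl ?ltW//.
  by apply: (lt_le_trans (archi_boundP (normr_ge0 x))); rewrite ler_nat.
by move=> n; apply: contrapT => h; apply: hn; exists n%:R.
Qed.

(* A uniform boundedness principle: were no [k] suitable, one could choose a sparse
   rapidly decreasing combination of the [F j] whose norm over growing balls is
   unbounded, each new term being invisible on the balls already used. *)
Lemma gliding_hump (F : nat -> E -> C) : (forall j, ccont (F j)) ->
  (forall j, exists2 B, 0 <= B & lp_le p (fun x => cabs (F j x)) B) ->
  (forall rho : R, exists (c : R) (q : nat), 0 <= c /\ forall j x, `|x| <= rho ->
     cabs (F j x) <= c * 2 ^+ (q * j)) ->
  (forall js es : nat -> nat, (forall k, (js k < js k.+1)%N) -> (forall k, (k <= es k)%N) ->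
     exists S : E -> C, [/\ ccont S,
       exists2 B, 0 <= B & lp_le p (fun x => cabs (S x)) B &
       forall x e, 0 < e -> exists N, forall n, (N <= n)%N ->
         cabs (S x - \sum_(k < n) (2^-1 ^+ (es k * js k))%:C * F (js k) x) <= e]) ->
  exists (k : nat) (B : R), 0 <= B /\ forall j, lp_le p (fun x => cabs (F j x)) (B * 2 ^+ (k * j)).
Proof.
move=> cF finF locF sumF; apply: contrapT => nb.
have mF j : measurable_fun setT (fun x => cabs (F j x)).
  exact: cmeas_cabs (ccont_cmeas (cF j)).
(* Otherwise [e] would be a suitable [k]: the indices from [N] on would obey one bound, and the
   finitely many earlier ones have finite norms. *)
have unb (e N : nat) (M : R) : 0 <= M -> exists2 j, (N <= j)%N &
    ~ lp_le p (fun x => cabs ((2^-1 ^+ (e * j))%:C * F j x)) M.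
  move=> M0; apply: contrapT => h; apply: nb.
  have h1 j : (N <= j)%N -> lp_le p (fun x => cabs (F j x)) (M * 2 ^+ (e * j)).
    move=> Nj; have {}h : lp_le p (fun x => cabs ((2^-1 ^+ (e * j))%:C * F j x)) M.
      by apply: contrapT => h'; apply: h; exists j.
    have e0 : 0 <= (2 : R) ^+ (e * j) by rewrite exprn_ge0.
    have mm : measurable_fun setT (fun x => cabs ((2^-1 ^+ (e * j))%:C * F j x)).
      exact: cmeas_cabs (ccont_cmeas (ccontZ _ (cF j))).
    have := lp_le_scale p_ge1 mm (fun _ => cabs_ge0 _) e0 M0 h; rewrite mulrC.
    congr lp_le; apply/funext => x; rewrite cabsM cabs_real ger0_norm ?exprn_ge0//.
    by rewrite mulrA -exprMn mulfV// expr1n mul1r.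
  have [B B0 HB] : exists2 B, 0 <= B & forall j, (j < N)%N -> lp_le p (fun x => cabs (F j x)) B.
    elim: (N) => [|n [B B0 HB]]; first by exists 0.
    have [B' B'0 HB'] := finF n; exists (B + B'); first exact: addr_ge0.
    move=> j; rewrite ltnS leq_eqVlt => /orP[/eqP ->|jn].
      by apply: lp_le_weak p_ge1 _ HB'; rewrite B'0 lerDr.
    by apply: lp_le_weak p_ge1 _ (HB j jn); rewrite B0 lerDl.
  exists e, (M + B); split; first exact: addr_ge0.
  move=> j; have e1 : 1 <= (2 : R) ^+ (e * j) by rewrite exprn_ege1// ler1n.
  have e0 : 0 <= (2 : R) ^+ (e * j) by exact: le_trans ler01 e1.
  have [Nj|jN] := leqP N j.
    apply: lp_le_weak p_ge1 _ (h1 j Nj); rewrite mulr_ge0//= ler_wpM2r// lerDl//.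
  apply: lp_le_weak p_ge1 _ (HB j jN); rewrite B0/=.
  by apply: le_trans (_ : M + B <= _); rewrite ?lerDr// ler_peMr// addr_ge0.
(* The partial sum, the radius of the ball on which it has been seen to be large, and the last index
   and exponent used. *)
pose state := ((E -> C) * R * nat * nat)%type.
pose good (s : state) := [/\ ccont s.1.1.1, 0 <= s.1.1.2 &
  exists2 B, 0 <= B & lp_le p (fun x => cabs (s.1.1.1 x)) B].
(* Half the threshold of [lp_le_trunc_cst]: two errors of this size on the ball of radius [rho] have
   norm at most 1. *)
pose eps (rho : R) := (2 * ((2 * rho) ^+ d + 1))^-1.
pose term j e x := (2^-1 ^+ (e * j))%:C * F j x.
pose next (s s' : state) := let: (f, rho, j, e) := s in let: (f', rho', j', e') := s' in
  [/\ (j < j')%N, (e < e')%N, rho <= rho', f' = (fun x => f x + term j' e' x) &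
   ~ lp_le p (trunc_real rho' (fun x => cabs (f' x))) j%:R /\
   forall x, `|x| <= rho -> cabs (term j' e' x) <= eps rho * 2^-1 ^+ j'].
have V1 (rho : R) : 0 <= rho -> 0 < (2 * rho) ^+ d + 1.
  by move=> r0; rewrite ltr_wpDl// exprn_ge0// mulr_ge0.
have eps0 rho : 0 <= rho -> 0 < eps rho.
  by move=> r0; rewrite invr_gt0 mulr_gt0// V1.
(* The invariant stands inside the existential so that the choice yields a total function, which can
   be iterated. *)
have exists_next s : exists s', good s -> next s s' /\ good s'.
  have [gs|ngs] := pselect (good s); last by exists s.
  case: s gs => [[[S rho] j] e] [/= cS r0 [BS BS0 HBS]].
  have [c [q [c0 Hc]]] := locF rho.
  have [N HN] := geo_small c (eps0 rho r0).
  (* Of the factor [2^(-(q + 2) j')], the part [2^(-q j')] cancels the local growth, one [2^-j']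
     absorbs the constant [c] because [j' >= N], and the other remains as geometric decay. *)
  pose e' := maxn e.+1 q.+2.
  (* A term of norm above [2 j + BS] leaves the new sum with norm above [2 j]; the passage to a ball
     loses the factor 2. *)
  have M0 : 0 <= 2 * j%:R + BS by rewrite addr_ge0// mulr_ge0.
  have [j' jj nj'] := unb e' (maxn N j.+1) _ M0.
  have ct : ccont (term j' e') by exact: ccontZ.
  have cS' : ccont (fun x => S x + term j' e' x) by exact: ccontD cS ct.
  have mS' := cmeas_cabs (ccont_cmeas cS').
  have mS := cmeas_cabs (ccont_cmeas cS).
  have mt := cmeas_cabs (ccont_cmeas ct).
  have nS' : ~ lp_le p (fun x => cabs (S x + term j' e' x)) (2 * j%:R).
    move=> h; apply: nj'.
    have j0 : 0 <= 2 * j%:R :> R by rewrite mulr_ge0.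
    have := lp_le_add p_ge1 mS' mS (fun _ => cabs_ge0 _) (fun _ => cabs_ge0 _) j0 BS0 h HBS.
    apply: (lp_le_mono p_ge1 mt (measurable_funD mS' mS)) => x.
    rewrite cabs_ge0/=; have := cabsB (S x + term j' e' x) (S x).
    by rewrite addrC addKr.
  have [rho2 r20 nr2] := lp_le_exhaust mS' (fun _ => cabs_ge0 _) (ler0n _ j) nS'.
  exists ((fun x => S x + term j' e' x), rho + rho2, j', e') => _; split; last first.
    split => /=; [exact: cS'|exact: addr_ge0|].
    have [BF BF0 HBF] := finF j'.
    have e0 : 0 <= (2^-1 : R) ^+ (e' * j') by rewrite exprn_ge0.
    exists (BS + 2^-1 ^+ (e' * j') * BF); first by rewrite addr_ge0// mulr_ge0.
    have tE : lp_le p (fun x => cabs (term j' e' x)) (2^-1 ^+ (e' * j') * BF).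
      have := lp_le_scale p_ge1 (mF j') (fun _ => cabs_ge0 _) e0 BF0 HBF.
      by congr lp_le; apply/funext => x; rewrite /term cabsM cabs_real ger0_norm.
    have := lp_le_add p_ge1 mS mt (fun _ => cabs_ge0 _) (fun _ => cabs_ge0 _) BS0
      (mulr_ge0 e0 BF0) HBS tE.
    apply: (lp_le_mono p_ge1 mS' (measurable_funD mS mt)) => x.
    by rewrite cabs_ge0 cabsD.
  move: jj; rewrite geq_max => /andP[Nj' jj']; split => //.
  - by rewrite leq_maxl.
  - by rewrite lerDl.
  split.
    move=> h; apply: nr2; apply: (lp_le_mono p_ge1 _ _ _ h).
    - exact: measurable_trunc_real.
    - exact: measurable_trunc_real.
    move=> x; rewrite trunc_real_ge0/=; last by move=> ?; exact: cabs_ge0.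
    rewrite /trunc_real; case: ifP => hx; last by case: ifP => // _; exact: cabs_ge0.
    by rewrite ifT// (le_trans hx)// lerDr.
  move=> x xr; rewrite /term cabsM cabs_real ger0_norm ?exprn_ge0//.
  apply: le_trans (ler_wpM2l _ (Hc j' x xr)) _; first by rewrite exprn_ge0.
  have he : (q.+2 <= e')%N by rewrite leq_maxr.
  have qe : (e' * j' = q * j' + (e' - q.+2) * j' + j' + j')%N.
    rewrite -[in LHS](subnK he) mulnDl -(addn2 q) mulnDl mul2n -addnn !addnA.
    by rewrite (addnC (_ * _)).
  have e10 n : 0 <= (2^-1 : R) ^+ n by rewrite exprn_ge0.
  have e11 n : (2^-1 : R) ^+ n <= 1 by rewrite exprn_ile1// invf_le1// ler1n.
  have qq : (2^-1 : R) ^+ (q * j') * 2 ^+ (q * j') = 1 by rewrite -exprMn mulVf// expr1n.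
  rewrite qe !exprD; apply: le_trans (_ : c * 2^-1 ^+ j' * 2^-1 ^+ j' <= _); last first.
    by rewrite ler_wpM2r// HN.
  have Hr (a b f g k : R) : a * k = 1 -> a * b * f * f * (g * k) = g * f * f * b.
    by move=> ak; rewrite -[RHS]mulr1 -ak; ring.
  by rewrite (Hr _ _ _ _ _ qq) ler_piMr// !mulr_ge0.
have /choice[f Hf] := exists_next.
pose s0 : state := ((fun=> 0), 0, 0%N, 0%N).
pose st n := iter n f s0.
have gst n : good (st n).
  elim: n => [|n IH]; last by have [_] := Hf _ IH.
  split => //=; first exact: ccont_cst.
  exists 0 => //; have := lp_le_zero (d := d) p_ge1.
  by congr lp_le; apply/funext => x; exact/esym/cabs0.
have nst n : next (st n) (st n.+1) by have [] := Hf _ (gst n).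
pose rh n := (st n).1.1.2; pose jn n := (st n).1.2; pose en n := (st n).2.
pose Sn n := (st n).1.1.1.
have stE n : st n = (Sn n, rh n, jn n, en n) by rewrite /Sn /rh /jn /en; case: (st n) => [[[? ?] ?] ?].
have {}nst n : [/\ (jn n < jn n.+1)%N, (en n < en n.+1)%N, rh n <= rh n.+1,
   Sn n.+1 = (fun x => Sn n x + term (jn n.+1) (en n.+1) x) &
   ~ lp_le p (trunc_real (rh n.+1) (fun x => cabs (Sn n.+1 x))) (jn n)%:R /\
   forall x, `|x| <= rh n -> cabs (term (jn n.+1) (en n.+1) x) <= eps (rh n) * 2^-1 ^+ jn n.+1].
  by have := nst n; rewrite (stE n) (stE n.+1).
have rh0 n : 0 <= rh n by case: (gst n).
have rh_le m n : (m <= n)%N -> rh m <= rh n.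
  elim: n => [|n IH]; first by rewrite leqn0 => /eqP ->.
  rewrite leq_eqVlt => /orP[/eqP ->//|/IH h]; apply: le_trans h _.
  by case: (nst n).
have jn_ge n : (n <= jn n)%N.
  by elim: n => // n IH; have [h _ _ _ _] := nst n; exact: leq_ltn_trans IH h.
have en_ge n : (n <= en n)%N.
  by elim: n => // n IH; have [_ h _ _ _] := nst n; exact: leq_ltn_trans IH h.
have [S [cS [B B0 HB] Slim]] := sumF (fun k => jn k.+1) (fun k => en k.+1)
  (fun k => let: And5 h _ _ _ _ := nst k.+1 in h) (fun k => ltnW (en_ge k.+1)).
have SnE n x : Sn n x = \sum_(k < n) (2^-1 ^+ (en k.+1 * jn k.+1))%:C * F (jn k.+1) x.
  elim: n => [|n IH]; first by rewrite big_ord0.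
  by rewrite big_ord_recr/= -IH; have [_ _ _ -> _] := nst n.
(* On the ball of step [n.+1] the partial sum exceeds norm [jn n >= B + 1], whereas it differs from
   [S], of norm at most [B], by something of norm at most 1. *)
pose n := Num.bound (B + 1).
have nB : B + 1 <= (jn n)%:R.
  have B1 : 0 <= B + 1 by rewrite addr_ge0.
  by apply: le_trans (ltW (archi_boundP B1)) _; rewrite ler_nat jn_ge.
have [_ _ _ _ [nlp _]] := nst n; apply: nlp.
set rho := rh n.+1; have e0 := eps0 _ (rh0 n.+1).
have mSn := cmeas_cabs (ccont_cmeas (let: And3 h _ _ := gst n.+1 in h)).
have mS := cmeas_cabs (ccont_cmeas cS).
(* The thresholds decrease as the balls grow, so on the present ball the later terms are below
   [eps rho] times the terms of a geometric series of sum 1. *)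
have tail m x : `|x| <= rho -> cabs (Sn (n.+1 + m)%N x - Sn n.+1 x) <=
    eps rho * (1 - 2^-1 ^+ m).
  move=> xr; elim: m => [|m IH].
    by rewrite addn0 subrr cabs0 expr0 subrr mulr0.
  rewrite addnS; have [_ _ _ -> [_ h]] := nst (n.+1 + m)%N.
  rewrite addrAC; apply: le_trans (cabsD _ _) _.
  have hr : rho <= rh (n.+1 + m)%N by apply: rh_le; rewrite leq_addr.
  have h1 := h x (le_trans xr hr).
  have h2 : eps (rh (n.+1 + m)%N) <= eps rho.
    have r20 k : 0 <= 2 * rh k by rewrite mulr_ge0.
    have p20 k : 0 < 2 * ((2 * rh k) ^+ d + 1) by rewrite mulr_gt0// V1.
    rewrite lef_pV2 ?posrE; [|exact: p20|exact: p20].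
    rewrite ler_wpM2l// lerD2r; apply: lerXn2r; rewrite ?nnegrE ?r20//.
    by rewrite ler_wpM2l.
  have h3 : (2^-1 : R) ^+ jn (n.+1 + m).+1 <= 2^-1 ^+ m.+1.
    apply: ler_wiXn2l; rewrite ?invr_ge0 ?invf_le1 ?ler1n//.
    by apply: leq_trans (jn_ge _); rewrite ltnS leq_addl.
  have h4 := ler_pM (ltW (eps0 _ (rh0 _))) (exprn_ge0 _ _) h2 h3.
  apply: le_trans (lerD IH (le_trans h1 (h4 _))) _; first by rewrite invr_ge0.
  by rewrite -mulrDr ler_wpM2l ?(ltW e0)// exprS; lra.
(* One [eps rho] for the later terms, another for the distance from a far partial sum to [S]. *)
have pw x : trunc_real rho (fun x => cabs (Sn n.+1 x)) x <=
    cabs (S x) + trunc_real rho (fun=> 2 * eps rho) x.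
  rewrite /trunc_real; case: ifP => xr; last by rewrite addr0 cabs_ge0.
  have [N HN] := Slim x _ e0; have := HN (n.+1 + N)%N (leq_addl _ _).
  rewrite -SnE => h1; have h2 := tail N x xr.
  have -> : Sn n.+1 x = S x + (- (S x - Sn (n.+1 + N)%N x) - (Sn (n.+1 + N)%N x - Sn n.+1 x)).
    by rewrite opprB addrA subrKC opprB addrCA subrr addr0.
  apply: le_trans (cabsD _ _) _; rewrite lerD2l; apply: le_trans (cabsB _ _) _.
  rewrite cabsN mulr_natl mulr2n; apply: lerD => //; apply: le_trans h2 _.
  by rewrite ler_piMr ?(ltW e0)// lerBlDr lerDl exprn_ge0.
have lpc : lp_le p (trunc_real rho (fun=> 2 * eps rho)) 1.
  apply: lp_le_trunc_cst; first exact: rh0.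
  by rewrite mulr_ge0 ?(ltW e0)//= /eps invfM mulrA mulfV// mul1r.
have mtc : measurable_fun setT (trunc_real rho (fun=> 2 * eps rho)).
  by apply: measurable_trunc_real; exact: measurable_cst.
have tc0 x : 0 <= trunc_real rho (fun=> 2 * eps rho) x.
  by apply: trunc_real_ge0 => _; rewrite mulr_ge0// ltW.
have := lp_le_add p_ge1 mS mtc (fun _ => cabs_ge0 _) tc0 B0 ler01 HB lpc.
move=> /(lp_le_weak p_ge1 (B' := (jn n)%:R)) h.
apply: (lp_le_mono p_ge1 _ (measurable_funD mS mtc) _ (h _)).
- exact: measurable_trunc_real.
- by move=> x; rewrite pw trunc_real_ge0// => ?; exact: cabs_ge0.
- by rewrite nB addr_ge0.
Qed.

End gliding_hump.

(** * Necessity of the bounds *)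

Section spaces.
Context {R : realType} {d : nat}.
Local Open Scope complex_scope.
Local Notation E := 'rV[R]_d.
Local Notation C := R[i].
Local Notation D s F := (foldr partial F s).
Variable omega : E -> R.
Hypotheses (omega_ge0 : forall x, 0 <= omega x) (omega_cont : continuous omega).
Hypothesis omega_moderate : moderate omega.
Variable p : \bar R.
Hypothesis p_ge1 : (1 <= p)%E.
Local Notation wt := (wt omega).
Local Notation wD := (wD omega).
Local Notation wcomp := (wcomp omega).
Local Notation Dbound := (Dbound omega p).

Lemma cabs_nat (n : nat) : cabs (n%:R : C) = n%:R.
Proof.
have -> : n%:R = (n%:R : R)%:C :> C by rewrite rmorph_nat.
by rewrite cabs_real ger0_norm.
Qed.

Lemma wD_weight t a (f : E -> C) :
  (fun x => cabs (weight omega t (mpartial a f) x)) = wD t (mseq a) f.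
Proof. by apply/funext => x; rewrite cabs_weight mpartialE. Qed.

Lemma wD_mseq t s (f : E -> C) : smooth f -> wD t s f = wD t (mseq (fun i => count_mem i s)) f.
Proof.
by move=> sf; apply/funext => x; rewrite /wD (D_perm sf (perm_mseq s)).
Qed.

Lemma KspaceP (q : \bar R) (f : E -> C) : (1 <= q)%E -> Kspace q omega f <-> smooth f /\
  forall (n : nat) s, exists2 B, 0 <= B & lp_le q (wD n%:R s f) B.
Proof.
move=> q1; have cw (n : nat) a : smooth f -> ccont (weight omega n%:R (mpartial a f)).
  by move=> sf; apply: ccont_weight => //; rewrite mpartialE; exact: smooth_ccont (smooth_D _ sf).
split=> [[sf Hf]|[sf Hf]]; split=> // n.
  move=> s; rewrite wD_mseq//; have [_ _] := Hf n (fun i => count_mem i s).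
  by move=> /(LpNorm_finiteP q1 (cw n _ sf)).1; rewrite wD_weight.
move=> a; have [m1 m2] := ccont_cmeas (cw n a sf); split=> //.
by apply: (LpNorm_finiteP q1 (cw n a sf)).2; rewrite wD_weight; exact: Hf.
Qed.

Lemma Dbound_sup_norm (F : nat -> 'I_2 -> E -> C) (k : nat) t a :
  (forall j l, smooth (F j l)) -> Dbound F k t (mseq a) ->
  (sup_norm p k%:R (fun j l => weight omega t (mpartial a (F j l))) < +oo)%E.
Proof.
move=> sF [B B0 HB]; apply: (sup_norm_finite (B := B)) => //.
  move=> j l; apply: ccont_weight => //; rewrite mpartialE.
  exact: smooth_ccont (smooth_D _ (sF j l)).
by move=> j l; rewrite wD_weight.
Qed.

Lemma sup_norm_Dbound (F : nat -> 'I_2 -> E -> C) r (k : nat) t a :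
  (forall j l, smooth (F j l)) -> r <= k%:R ->
  (sup_norm p r (fun j l => weight omega t (mpartial a (F j l))) < +oo)%E ->
  Dbound F k t (mseq a).
Proof.
move=> sF rk h; have [|B B0 HB] := sup_norm_bound p_ge1 _ rk h.
  move=> j l; apply: ccont_weight => //; rewrite mpartialE.
  exact: smooth_ccont (smooth_D _ (sF j l)).
by exists B => // j l; rewrite -wD_weight.
Qed.

Lemma Dbound_perm (F : nat -> 'I_2 -> E -> C) k t s : (forall j l, smooth (F j l)) ->
  Dbound F k t (mseq (fun i => count_mem i s)) -> Dbound F k t s.
Proof. by move=> sF [B B0 HB]; exists B => // j l; rewrite wD_mseq. Qed.

Section of_function.
Variables (chi : 'I_2 -> E -> C) (u : (E -> C) -> C) (g : E -> C).
Hypotheses (tchi : forall l, test (chi l)) (sg : smooth g).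
Hypothesis ug : forall theta, test theta -> u theta = distr_of g theta.

Lemma dconv_function theta : test theta -> dconv u theta = conv theta g.
Proof.
move=> tth; rewrite (conv_comm (test_bms tth) (smooth_lbm sg)).
by apply/funext => x; apply: ug; exact: test_reflect.
Qed.

(** The dilates of [chi l] are bounded by [2^(jd)] times a constant and keep their support in one
    ball. The convolution is thus dominated by averages of [g] with this constant, which is where
    the growth exponent [d] comes from. *)
Lemma conv_Dbound : exists rho : R, forall s t t', wcomp rho t t' ->
  (exists2 B, 0 <= B & lp_le p (wD t' s g) B) ->
  Dbound (fun j l => dconv u (dilate j (chi l))) d t s.
Proof.
have [r [S [r0 S0 zr hS]]] : exists r S : R, [/\ 0 <= r, 0 <= S,
    forall l, zero_outside r (chi l) & forall l x, cabs (chi l x) <= S].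
  have /choice[P HP] : forall l, exists P : R * R, [/\ 0 <= P.1, 0 <= P.2,
      zero_outside P.1 (chi l) & forall x, cabs (chi l x) <= P.2].
    move=> l; have [_ [r r0 zr]] := (testP _).1 (tchi l).
    by have [S S0 hS] := test_bounded (tchi l); exists (r, S).
  have S1 (F : 'I_2 -> R) l : (forall l, 0 <= F l) -> F l <= \sum_l F l.
    by move=> F0; rewrite (bigD1 l)//= lerDl sumr_ge0.
  have P10 l : 0 <= (P l).1 by case: (HP l).
  have P20 l : 0 <= (P l).2 by case: (HP l).
  exists (\sum_l (P l).1), (\sum_l (P l).2); split.
  - by apply: sumr_ge0.
  - by apply: sumr_ge0.
  - move=> l x xr; have [_ _ h _] := HP l; apply: h; apply: le_lt_trans xr.
    exact: (S1 (fun l => (P l).1)).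
  - move=> l x; have [_ _ _ h] := HP l; apply: le_trans (h x) _.
    exact: (S1 (fun l => (P l).2)).
exists (r + 1) => s t t' wc [B B0 HB].
have r10 : 0 < r + 1 by rewrite ltr_wpDl.
have V0 : 0 <= 2 * (2 * (r + 1)) ^+ d by rewrite mulr_ge0// exprn_ge0// mulr_ge0// ltW.
exists (2 * (2 * (r + 1)) ^+ d * (2 * S * B)); first by apply: mulr_ge0 => //; rewrite !mulr_ge0.
move=> j l; have td := dilate_test j (tchi l).
have e0 : 0 <= (2 : R) ^+ (d * j) by rewrite exprn_ge0.
have zd : zero_outside (r + 1) (dilate j (chi l)).
  have h := dilate_zero_outside j r0 (zr l).
  by move=> x xr; apply: h; apply: le_lt_trans xr; rewrite lerDl.
have bd x : cabs (dilate j (chi l) x) <= 2 ^+ (d * j) * S.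
  rewrite /dilate cabsM cabs_nat natrX mulnC; apply: ler_pM; rewrite ?exprn_ge0 ?cabs_ge0//.
have sD := smooth_D s sg.
have eS0 : 0 <= 2 ^+ (d * j) * S by rewrite mulr_ge0.
have av := conv_avg (test_bms td) zd (smooth_lbm sD) eS0 bd.
have mg : measurable_fun setT (fun x => cabs (D s g x)).
  exact: cmeas_cabs (ccont_cmeas (smooth_ccont sD)).
have [sc Dc] := conv_smooth (test_bms td) sg.
have mc : measurable_fun setT (fun x => cabs (conv (dilate j (chi l)) (D s g) x)).
  by rewrite -Dc; exact: cmeas_cabs (ccont_cmeas (smooth_ccont (smooth_D s sc))).
have mkg : measurable_fun setT (fun x => 2 * (2 ^+ (d * j) * S) * cabs (D s g x)).
  by apply: measurable_funM; [exact: measurable_cst|].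
have kg0 x : 0 <= 2 * (2 ^+ (d * j) * S) * cabs (D s g x).
  by rewrite mulr_ge0 ?cabs_ge0// mulr_ge0.
have k0 : 0 <= 2 * (2 ^+ (d * j) * S) by rewrite mulr_ge0.
have HB' : lp_le p (fun x => 2 * (2 ^+ (d * j) * S) * cabs (D s g x) * wt t' x)
    (2 * (2 ^+ (d * j) * S) * B).
  have := lp_le_scale p_ge1 (measurable_wD omega_cont t' s sg) (wD_ge0 omega t' s g) k0 B0 HB.
  by congr lp_le; apply/funext => x; rewrite -[RHS]mulrA.
have := lp_le_avg_wt omega_cont p_ge1 r10 wc mc mkg (fun _ => cabs_ge0 _) kg0
  (mulr_ge0 k0 B0) av HB'.
have -> : 2 * (2 * (r + 1)) ^+ d * (2 * (2 ^+ (d * j) * S) * B) =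
    2 * (2 * (r + 1)) ^+ d * (2 * S * B) * 2 ^+ (d * j) by ring.
by rewrite /wD (dconv_function td) Dc.
Qed.

End of_function.

(** Once [k > q], the exponent [es k] beats the growth [q] with a factor [2^(-js k)], at most
    [2^-k], to spare. The finitely many earlier terms are absorbed into the constant. *)
Lemma rapid_bound (js es : nat -> nat) (M : R) (q : nat) : 0 <= M ->
  (forall k, (js k < js k.+1)%N) -> (forall k, (k <= es k)%N) ->
  exists2 B, 0 <= B & forall k,
    2^-1 ^+ (es k * js k) * (M * 2 ^+ (q * js k)) <= B * 2^-1 ^+ k.
Proof.
move=> M0 hj he.
have jk k : (k <= js k)%N by elim: k => // k IH; exact: leq_ltn_trans IH (hj k).
pose a k : R := M * 2 ^+ (q * js k) * 2 ^+ k.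
have a0 k : 0 <= a k by rewrite !mulr_ge0// exprn_ge0.
have S0 : 0 <= \sum_(k < q.+1) a k by apply: sumr_ge0 => k _.
have h0 n : 0 <= (2^-1 : R) ^+ n by rewrite exprn_ge0.
have h1 n : (2^-1 : R) ^+ n <= 1 by rewrite exprn_ile1// invf_le1// ler1n.
have h2 n : (2^-1 : R) ^+ n * 2 ^+ n = 1 by rewrite -exprMn mulVf// expr1n.
exists (M + \sum_(k < q.+1) a k); first exact: addr_ge0.
move=> k; have [kq|qk] := leqP k q.
  apply: le_trans (_ : a k * 2^-1 ^+ k <= _).
    rewrite /a -[leRHS]mulrA [X in _ <= _ * X]mulrC h2 mulr1 ler_piMl// mulr_ge0// exprn_ge0//.
  rewrite ler_wpM2r//; apply: le_trans (_ : \sum_(k < q.+1) a k <= _); last by rewrite lerDr.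
  have kq1 : (k < q.+1)%N by [].
  by rewrite (bigD1 (Ordinal kq1))//= lerDl sumr_ge0.
apply: le_trans (_ : M * 2^-1 ^+ k <= _); last by rewrite ler_wpM2r// lerDl.
have qe : (q < es k)%N by apply: leq_trans (he k).
have -> : (es k * js k = (es k - q.+1) * js k + js k + q * js k)%N.
  by rewrite -[X in (_ = _ + X + _)%N]mul1n -!mulnDl addnAC -addnA addn1 subnK.
rewrite !exprD.
have Hr (x y z w : R) : z * w = 1 -> x * y * z * (M * w) = M * (x * y).
  by move=> zw; rewrite -[RHS]mulr1 -zw; ring.
rewrite (Hr _ _ _ _ (h2 _)) ler_wpM2l//; apply: le_trans (_ : 2^-1 ^+ js k <= _).
  by rewrite ler_piMl.
by apply: ler_wiXn2l; rewrite ?invr_ge0 ?invf_le1 ?ler1n.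
Qed.

Definition rapid_sum (theta : nat -> E -> C) (js es : nat -> nat) (n : nat) : E -> C :=
  fun x => \sum_(k < n) (2^-1 ^+ (es k * js k))%:C * theta (js k) x.

Lemma rapid_sum_smooth theta js es n : (forall j, smooth (theta j)) ->
  smooth (rapid_sum theta js es n) /\ forall s, D s (rapid_sum theta js es n) =
    fun x => \sum_(k < n) (2^-1 ^+ (es k * js k))%:C * D s (theta (js k)) x.
Proof.
move=> sth; have sk (k : 'I_n) := smoothZ ((2^-1 ^+ (es k * js k))%:C) (sth (js k)).
have [h1 h2] := smooth_sum (index_enum 'I_n) (fun k => proj1 (sk k)).
split=> // s; rewrite /rapid_sum h2; apply/funext => x; apply: eq_bigr => k _.
by rewrite (sk k).2.
Qed.

Lemma rapid_series (theta : nat -> E -> C) (js es : nat -> nat) :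
  (forall j, smooth (theta j)) ->
  (forall s, exists (M : R) (q : nat), 0 <= M /\ forall j x, cabs (D s (theta j) x) <= M * 2 ^+ (q * j)) ->
  (forall k, (js k < js k.+1)%N) -> (forall k, (k <= es k)%N) ->
  exists2 phi, smooth phi & forall s rho, exists2 B, 0 <= B & forall n x, `|x| <= rho ->
    cabs (D s (rapid_sum theta js es n) x - D s phi x) <= B * 2^-1 ^+ n.
Proof.
move=> sth Hth hj he.
apply: smooth_limit => [n|s rho]; first by have [] := rapid_sum_smooth js es n sth.
have [M [q [M0 HM]]] := Hth s; have [B B0 HB] := rapid_bound q M0 hj he.
exists B => // n x _.
have [_ ->] := rapid_sum_smooth js es n.+1 sth; have [_ ->] := rapid_sum_smooth js es n sth.
rewrite big_ord_recr/= addrAC subrr add0r cabsM cabs_real ger0_norm ?exprn_ge0//.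
by apply: le_trans (HB n); rewrite ler_wpM2l// exprn_ge0.
Qed.

(** The constants [M] and [B] do not involve the rate [B'] at the particular point, which disappears
    in the limit. This gives a weighted bound uniform in [x] although convergence is only locally
    uniform. *)
Lemma rapid_limit_bound (theta : nat -> E -> C) js es phi s (w M : R) (q : nat) x :
  (forall j, smooth (theta j)) -> 0 <= w -> 0 <= M ->
  (forall j, cabs (D s (theta j) x) * w <= M * 2 ^+ (q * j)) -> forall B,
  (forall k, 2^-1 ^+ (es k * js k) * (M * 2 ^+ (q * js k)) <= B * 2^-1 ^+ k) ->
  (exists2 B', 0 <= B' & forall n,
    cabs (D s (rapid_sum theta js es n) x - D s phi x) <= B' * 2^-1 ^+ n) ->
  cabs (D s phi x) * w <= 2 * B.
Proof.
move=> sth w0 M0 HM B HB [B' B'0 HB'].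
have B0 : 0 <= B.
  have := HB 0%N; rewrite expr0 mulr1; apply: le_trans.
  by rewrite !mulr_ge0// exprn_ge0.
apply: (@le_geo _ _ _ (B' * w)) => n.
have [_ Dr] := rapid_sum_smooth js es n sth.
have h1 : cabs (D s (rapid_sum theta js es n) x) * w <= \sum_(k < n) B * 2^-1 ^+ k.
  rewrite Dr; apply: le_trans (ler_wpM2r w0 (cabs_sum _ _)) _; rewrite mulr_suml.
  apply: ler_sum => k _; rewrite cabsM cabs_real ger0_norm ?exprn_ge0// -mulrA.
  by apply: le_trans (HB k); rewrite ler_wpM2l ?exprn_ge0.
have h2 : \sum_(k < n) B * 2^-1 ^+ k <= 2 * B.
  have -> : \sum_(k < n) B * 2^-1 ^+ k = 2 * B - 2 * B * 2^-1 ^+ n.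
    elim: (n) => [|m IH]; first by rewrite big_ord0 expr0 mulr1 subrr.
    by rewrite big_ord_recr/= IH exprS; field.
  by rewrite lerBlDr lerDl !mulr_ge0// exprn_ge0.
have h3 : cabs (D s phi x) <= cabs (D s (rapid_sum theta js es n) x) + B' * 2^-1 ^+ n.
  rewrite -[D s phi x](subrK (D s (rapid_sum theta js es n) x)) addrC.
  by apply: le_trans (cabsD _ _) _; rewrite lerD2l cabsBC.
apply: le_trans (ler_wpM2r w0 h3) _; rewrite mulrDl mulrAC; apply: lerD => //.
exact: le_trans h1 h2.
Qed.

Lemma dilate_D_bound (f : E -> C) s : test f -> exists2 M, 0 <= M & forall j x,
  cabs (D s (dilate j f) x) <= M * 2 ^+ ((size s + d) * j).
Proof.
move=> tf; have [M M0 HM] := test_bounded (test_D s tf); exists M => // j x.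
rewrite (dilate_D _ _ (test_smooth tf)) /dilate !cabsM -natrX !cabs_nat -expnM.
rewrite mulrA -natrM -expnD natrX mulrC mulnDl [(size s * j)%N]mulnC [(d * j)%N]mulnC.
by rewrite ler_wpM2r ?exprn_ge0.
Qed.

Variable u : (E -> C) -> C.
Hypothesis Du : is_distribution u.

(** The gliding hump is run on the weighted convolutions for one fixed [n]. A rapidly decreasing
    combination of dilates of [chi0] is smooth with support in the ball of [chi0], hence a test
    function, and its convolution with [u] has finite weighted norm by hypothesis. *)
Lemma OC_Dbound1 (chi0 : E -> C) (n : nat) : test chi0 ->
  (forall phi, test phi -> Kspace p omega (dconv u phi)) ->
  exists (k : nat) (B : R), 0 <= B /\ forall j,
    lp_le p (wD n%:R [::] (dconv u (dilate j chi0))) (B * 2 ^+ (k * j)).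
Proof.
move=> tchi HK; have td j := dilate_test j tchi.
have [schi [r r0 zr]] := (testP _).1 tchi.
have sF j : smooth (dconv u (dilate j chi0)) by have [] := dconv_smooth Du (td j).
have wDE theta : (fun x => cabs (weight omega n%:R theta x)) = wD n%:R [::] theta.
  by apply/funext => x; rewrite cabs_weight.
have fin theta : test theta ->
    exists2 B, 0 <= B & lp_le p (wD n%:R [::] (dconv u theta)) B.
  by move=> /HK/(KspaceP _ p_ge1)[_ h]; exact: h.
have [||||k [B [B0 HB]]] := @gliding_hump R d p p_ge1
  (fun j => weight omega n%:R (dconv u (dilate j chi0))).
- by move=> j; apply: ccont_weight => //; exact: smooth_ccont (sF j).
- by move=> j; rewrite wDE; exact: fin.
(* On a ball [u] has a finite order [N], and derivatives of the dilates up to that order grow at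
   most like [2^((N + d) j)]. *)
- move=> rho; have [c [N [c0 Hc]]] := dconv_bound Du rho r.
  have [||M M0 HM] := @seq_uniform_bound R d (fun s M => (size s <= N)%N -> forall j x,
      cabs (D s (dilate j chi0) x) <= M * 2 ^+ ((N + d) * j)) _ _ N.
  + move=> s B B' BB h sN j x.
    by apply: le_trans (h sN j x) _; rewrite ler_wpM2r// exprn_ge0.
  + move=> s; have [M M0 HM] := dilate_D_bound s tchi; exists M => // sN j x.
    apply: le_trans (HM j x) _; rewrite ler_wpM2l// ler_weXn2l ?ler1n//.
    by rewrite leq_mul2r leq_add2r sN orbT.
  have [W W0 HW] := omega_ball omega_ge0 omega_moderate rho.
  exists (c * M * expR (n%:R * W)), (N + d)%N; split.
    by rewrite !mulr_ge0// expR_ge0.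
  move=> j x xr; rewrite cabs_weight.
  have M1 : 0 <= M * 2 ^+ ((N + d) * j) by rewrite mulr_ge0// exprn_ge0.
  have h := Hc _ _ x xr (test_smooth (td j)) (dilate_zero_outside j r0 zr) M1
    (fun s y sN => HM s sN sN j y).
  rewrite -mulrA [_ * 2 ^+ _]mulrC mulrA -[c * _ * _]mulrA.
  apply: ler_pM; rewrite ?cabs_ge0 ?wt_ge0//.
  by rewrite -[leLHS]/(expR (n%:R * omega x)) ler_expR ler_wpM2l// HW.
- move=> js es hj he.
  have [|s|phi sphi Hphi] := @rapid_series (fun j => dilate j chi0) js es _ _ hj he.
  + by move=> j; exact: test_smooth (td j).
  + by have [M M0 HM] := dilate_D_bound s tchi; exists M, (size s + d)%N.
  pose P n := rapid_sum (fun j => dilate j chi0) js es n.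
  have tP m : test (P m).
    exact: (test_sum (index_enum 'I_m)
      (fun k : 'I_m => testZ ((2^-1 ^+ (es k * js k))%:C) (td (js k)))).
  have zP m : zero_outside r (P m).
    move=> x xr; rewrite /P /rapid_sum big1// => k _.
    by rewrite (dilate_zero_outside (js k) r0 zr xr) mulr0.
  have zphi : zero_outside r phi.
    move=> x xr; apply/cabs0_eq0/eqP; rewrite eq_le cabs_ge0 andbT.
    have [B B0 HB] := Hphi [::] `|x|; apply: (@le_geo _ _ _ B) => m; rewrite add0r.
    by have := HB m x (lexx _); rewrite /= -/(P m) zP// sub0r cabsN.
  have tphi : test phi by apply/testP; split=> //; exists r.
  exists (weight omega n%:R (dconv u phi)); split.
  + by apply: ccont_weight => //; apply: smooth_ccont; have [] := dconv_smooth Du tphi.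
  + by rewrite wDE; exact: fin.
  move=> x e e0; have [c [N [c0 Hc]]] := dconv_bound Du `|x| r.
  have [B B0 HB] := @seq_uniform_bound R d (fun s B => forall m y, `|y| <= r ->
      cabs (D s (P m) y - D s phi y) <= B * 2^-1 ^+ m)
    (fun s B B' BB h m y yr => le_trans (h m y yr) (ler_wpM2r (exprn_ge0 m (ltW (geo_gt0 1))) BB))
    (fun s => Hphi s r) N.
  have [N' HN'] := geo_small (c * B * wt n%:R x) e0.
  exists N' => m Nm; apply: le_trans (HN' m Nm).
  have -> : weight omega n%:R (dconv u phi) x -
      \sum_(k < m) (2^-1 ^+ (es k * js k))%:C * weight omega n%:R (dconv u (dilate (js k) chi0)) x =
      weight omega n%:R (dconv u (fun y => phi y - P m y)) x.
    rewrite /weight (dconvB Du _ tphi (tP m)) mulrBl; congr (_ - _).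
    rewrite /P /rapid_sum (dconv_sum Du (index_enum 'I_m) x
      (fun k : 'I_m => testZ ((2^-1 ^+ (es k * js k))%:C) (td (js k)))) mulr_suml.
    by apply: eq_bigr => k _; rewrite (dconvZ Du _ _ (td _)) mulrA.
  have zB : zero_outside r (fun y => phi y - P m y).
    by move=> y yr; rewrite zphi// zP// subrr.
  have sB := test_smooth (testB tphi (tP m)).
  have Be0 : 0 <= B * 2^-1 ^+ m by rewrite mulr_ge0// exprn_ge0.
  rewrite cabs_weight mulrAC; apply: ler_wpM2r; first exact: wt_ge0.
  rewrite -mulrA; apply: (Hc _ _ _ (lexx _) sB zB Be0) => s y sN.
  have [yr|ry] := leP `|y| r; last first.
    by rewrite (zero_outside_D s sB zB ry) cabs0.
  by rewrite (D_sub s sphi (test_smooth (tP m))) cabsBC; exact: HB.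
by exists k, B; split=> // j; rewrite -wDE; exact: HB.
Qed.

End spaces.

(** * Multipliers *)

Section multipliers.
Context {R : realType} {d : nat}.
Local Open Scope complex_scope.
Local Notation E := 'rV[R]_d.
Local Notation C := R[i].
Local Notation D s F := (foldr partial F s).
Local Notation mu := (lebesgue_rV R d).
Variable omega : E -> R.
Hypotheses (omega_ge0 : forall x, 0 <= omega x) (omega_cont : continuous omega).
Hypothesis omega_moderate : moderate omega.
Variable p : \bar R.
Hypothesis p_ge1 : (1 <= p)%E.
Local Notation wt := (wt omega).
Local Notation wD := (wD omega).

Lemma Kspace_partial (q : \bar R) i (f : E -> C) : (1 <= q)%E ->
  Kspace q omega f -> Kspace q omega (partial i f).
Proof.
move=> q1 /(KspaceP omega_cont _ q1)[sf Hf]; apply/(KspaceP omega_cont _ q1).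
split; first exact: smooth_partial.
move=> n s; have [B B0 HB] := Hf n (s ++ [:: i]); exists B => //.
by move: HB; congr lp_le; apply/funext => x; rewrite -[LHS]/(cabs _ * _) foldr_cat.
Qed.

Lemma KspaceB (q : \bar R) (f g : E -> C) : (1 <= q)%E ->
  Kspace q omega f -> Kspace q omega g -> Kspace q omega (fun x => f x - g x).
Proof.
move=> q1 /(KspaceP omega_cont _ q1)[sf Hf] /(KspaceP omega_cont _ q1)[sg Hg].
have sN := (smoothZ (-1) sg).1; have sfg := (smoothD sf sN).1.
have E1 : (fun x => f x - g x) = (fun x => f x + -1 * g x).
  by apply/funext => x; rewrite mulN1r.
apply/(KspaceP omega_cont _ q1); split; first by rewrite E1.
move=> n s; have [B B0 HB] := Hf n s; have [B' B'0 HB'] := Hg n s.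
exists (B + B'); first exact: addr_ge0.
have m1 := measurable_wD omega_cont n%:R s sf; have m2 := measurable_wD omega_cont n%:R s sg.
have := lp_le_add q1 m1 m2 (wD_ge0 _ _ _ _) (wD_ge0 _ _ _ _) B0 B'0 HB HB'.
apply: (lp_le_mono q1 _ (measurable_funD m1 m2)).
  by rewrite E1; exact: measurable_wD.
move=> x; rewrite wD_ge0/= -mulrDl ler_wpM2r ?wt_ge0//.
by rewrite D_sub//; exact: cabsB.
Qed.

(** By the product rule, the derivative of [h] times [phi] is the derivative of [h phi] minus [h]
    times the derivative of [phi], and both belong to the space. *)
Lemma OM_partial i (h : E -> C) : OMspace p omega h -> OMspace p omega (partial i h).
Proof.
move=> [sh Hh]; split; first exact: smooth_partial.
move=> phi Kphi; have [sphi _] := Kphi.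
have Kd : Kspace +oo%E omega (partial i phi) by apply: Kspace_partial => //; rewrite leey.
have [_ DM] := smoothM sh sphi.
have -> : (fun x => partial i h x * phi x) =
    (fun x => partial i (fun x => h x * phi x) x - h x * partial i phi x).
  apply/funext => x; have := cderM (smooth_cder i x sh) (smooth_cder i x sphi).
  by move=> /cder_partial ->; rewrite addrK.
exact: (KspaceB p_ge1 (Kspace_partial i p_ge1 (Hh _ Kphi)) (Hh _ Kd)).
Qed.

Lemma Kspace_bounded (phi : E -> C) : Kspace +oo%E omega phi <-> smooth phi /\
  forall (n : nat) s, exists2 B, 0 <= B & forall x, cabs (D s phi x) * wt n%:R x <= B.
Proof. by apply: KspaceP => //; rewrite leey. Qed.

(** In each Leibniz term the weight of exponent [n] is split as that of [-m], given to the
    derivative of [g], times that of [m + n], given to the derivative of [phi], which decays faster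
    than every weight grows. *)
Lemma multiplier_of_bounds (g : E -> C) : smooth g ->
  (forall s, exists m : nat, exists2 B, 0 <= B & lp_le p (wD (- m%:R) s g) B) ->
  OMspace p omega g.
Proof.
move=> sg Hg; split; [exact: sg|move=> phi /Kspace_bounded[sphi Hphi]].
have [sM DM] := smoothM sg sphi; apply/(KspaceP omega_cont _ p_ge1); split=> // n s.
have -> : wD n%:R s (fun x => g x * phi x) =
    fun x => cabs (\sum_(q <- leibniz s) D q.1 g x * D q.2 phi x) * wt n%:R x.
  by apply/funext => x; rewrite -[LHS]/(cabs _ * _) DM.
have mc (q : seq 'I_d * seq 'I_d) : ccont (fun x => D q.1 g x * D q.2 phi x).
  exact: ccontM (smooth_ccont (smooth_D q.1 sg)) (smooth_ccont (smooth_D q.2 sphi)).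
have mw (f : E -> C) : ccont f -> measurable_fun setT (fun x => cabs (f x) * wt n%:R x).
  move=> cf; apply: measurable_funM; last exact: wt_measurable.
  exact: cmeas_cabs (ccont_cmeas cf).
elim: (leibniz s) => [|q r [B B0 HB]].
  exists 0 => //; have := lp_le_zero (d := d) p_ge1.
  by congr lp_le; apply/funext => x; rewrite big_nil cabs0 mul0r.
have [m [B1 B10 HB1]] := Hg q.1; have [M M0 HM] := Hphi (m + n)%N q.2.
have hq : lp_le p (fun x => cabs (D q.1 g x * D q.2 phi x) * wt n%:R x) (M * B1).
  have m1 := measurable_wD omega_cont (- m%:R) q.1 sg.
  apply: (lp_le_mono p_ge1 (mw _ (mc q)) _ _
    (lp_le_scale p_ge1 m1 (wD_ge0 _ _ _ _) M0 B10 HB1)).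
    by apply: measurable_funM; [exact: measurable_cst|].
  move=> x; rewrite mulr_ge0 ?cabs_ge0 ?wt_ge0//= cabsM.
  have -> : wt n%:R x = wt (- m%:R) x * wt (m + n)%:R x.
    by rewrite -wtD natrD addrA addNr add0r.
  have Hr (a b w w' : R) : a * b * (w * w') = (b * w') * (a * w) by ring.
  by rewrite Hr ler_wpM2r ?wD_ge0// HM.
exists (M * B1 + B); first by rewrite addr_ge0// mulr_ge0.
have cr : ccont (fun x => \sum_(q <- r) D q.1 g x * D q.2 phi x) by exact: ccont_sum.
have := lp_le_add p_ge1 (mw _ (mc q)) (mw _ cr) _ _ (mulr_ge0 M0 B10) B0 hq HB.
have w0 (f : E -> C) x : 0 <= cabs (f x) * wt n%:R x by rewrite mulr_ge0 ?cabs_ge0 ?wt_ge0.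
move=> /(_ (w0 _) (w0 _)); apply: (lp_le_mono p_ge1 _ (measurable_funD (mw _ (mc q)) (mw _ cr))).
  under eq_fun do rewrite big_cons.
  exact: (mw _ (ccontD (mc q) cr)).
move=> x; rewrite big_cons (w0 (fun x => _ + _))/= -mulrDl ler_wpM2r ?wt_ge0//.
exact: cabsD.
Qed.

(** * A partition of unity along the level slabs of the weight *)

Section localization.
Variables (rho0 : E -> C) (r : R).
Hypotheses (trho : test rho0) (irho : cintegral rho0 = 1).
Hypotheses (r0 : 0 <= r) (zrho : zero_outside r rho0).

Definition slab (j : nat) (x : E) : C := if (j%:R <= omega x < j.+1%:R) then 1 else 0.

Lemma slab_lbm j : lbm (slab j).
Proof.
have mo := continuous_measurable_rV omega_cont.
have mi : measurable_fun setT (fun x => if j%:R <= omega x < j.+1%:R then 1 else 0 : R).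
  apply: measurable_fun_ifT => //; apply: measurable_and.
    exact: measurable_fun_ler (measurable_cst _) mo.
  exact: measurable_fun_ltr mo (measurable_cst _).
split.
  split.
    by rewrite (_ : (fun x => _) = (fun x => if j%:R <= omega x < j.+1%:R then 1 else 0 : R))//;
      apply/funext => x; rewrite /slab; case: ifP.
  by rewrite (_ : (fun x => _) = cst (0 : R))//; apply/funext => x; rewrite /slab; case: ifP.
move=> rho; exists 1 => // x _; rewrite /slab; case: ifP => _; last by rewrite cabs0.
by rewrite (cabs_nat 1).
Qed.

Lemma cabs_slab j x : cabs (slab j x) <= 1.
Proof. by rewrite /slab; case: ifP => _; rewrite ?cabs0// (cabs_nat 1). Qed.

(* A smooth partition of unity along the level slabs of [omega], on which the weight
   is controlled by the index [j]. *)
Definition slab_smooth (j : nat) : E -> C := conv (slab j) rho0.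

Lemma slab_smoothP j : smooth (slab_smooth j) /\
  forall s, D s (slab_smooth j) = conv (D s rho0) (slab j).
Proof.
have [h1 h2] := conv_test_smooth (slab_lbm j) trho; split=> // s; rewrite h2.
by rewrite (conv_comm (test_bms (test_D s trho)) (slab_lbm j)).
Qed.

Lemma slab_bound s : exists2 M, 0 <= M & forall j x, cabs (D s (slab_smooth j) x) <= M.
Proof.
have [B B0 HB] := test_bounded (test_D s trho).
exists (2 * (B * 1) * (2 * r) ^+ d).
  by rewrite mulr1 !mulr_ge0// exprn_ge0// mulr_ge0.
move=> j x; rewrite (slab_smoothP j).2.
apply: cintegral_mul_le => //.
- exact: (test_bms (test_D s trho)).1.
- exact: zero_outside_D (test_smooth trho) zrho.
- exact: lbm_reflect (slab_lbm j).
- by move=> y _; exact: cabs_slab.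
Qed.

(** Smoothing spreads a slab over distance at most [r], and by moderateness such a shift changes
    [omega] only by a constant factor. *)
Lemma slab_support : exists2 A : R, 1 <= A & forall j x s, D s (slab_smooth j) x != 0 ->
  omega x <= A * j.+1%:R /\ j%:R <= A * omega x.
Proof.
have [A A1 HA] := omega_shift omega_ge0 omega_moderate r.
have A0 : 0 <= A by exact: le_trans A1.
exists A => // j x s; apply: contra_neqP => hn.
rewrite (slab_smoothP j).2 /conv -[RHS](@cintegral0 R d); congr cintegral.
apply/funext => y; have [yr|ry] := leP `|y| r; last first.
  by rewrite (zero_outside_D s (test_smooth trho) zrho ry) mul0r.
rewrite /slab; case: ifP => [/andP[h1 h2]|]; last by rewrite mulr0.
exfalso; apply: hn; split.
  have := HA (x - y) y yr; rewrite subrK => h; apply: le_trans h _.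
  by rewrite ler_wpM2l// ltW.
by have := HA x (- y); rewrite normrN => /(_ yr) h; exact: le_trans h1 h.
Qed.

(** On the support [omega] is at most [A (j + 1)], so the weight grows at most geometrically in [j],
    a growth that rapidly decreasing coefficients overcome. *)
Lemma slab_weighted (n : nat) s : exists (M : R) (q : nat), 0 <= M /\ forall j x,
  cabs (D s (slab_smooth j) x) * wt n%:R x <= M * 2 ^+ (q * j).
Proof.
have [A A1 HA] := slab_support; have [M M0 HM] := slab_bound s.
have A0 : 0 <= A by exact: le_trans A1.
pose e := expR (n%:R * A); have e0 : 0 <= e by exact: expR_ge0.
pose q := Num.bound e.
have eq2 : e <= 2 ^+ q.
  apply: le_trans (ltW (archi_boundP e0)) _.
  by rewrite -natrX ler_nat ltnW// ltn_expl.
exists (M * e), q; split; first exact: mulr_ge0.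
move=> j x; have [h|h] := eqVneq (D s (slab_smooth j) x) 0.
  by rewrite h cabs0 mul0r !mulr_ge0// exprn_ge0.
have [h1 _] := HA j x s h; rewrite -mulrA.
apply: ler_pM; rewrite ?cabs_ge0 ?wt_ge0//.
apply: le_trans (_ : e ^+ j.+1 <= _); last first.
  by rewrite exprS ler_wpM2l// exprM lerXn2r ?nnegrE// exprn_ge0.
rewrite -expRM_natl -[leLHS]/(expR (n%:R * omega x)) ler_expR.
by rewrite mulrCA [_.+1%:R * A]mulrC ler_wpM2l.
Qed.

(** The first [J] slabs fill the set where [omega < J]. For large [J] this contains the whole ball
    of radius [r] around [x], on which the convolution with [rho0], of integral one, averages. *)
Lemma slab_sum (x : E) : exists N, forall J, (N <= J)%N ->
  \sum_(j < J) slab_smooth j x = 1.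
Proof.
have [A A1 HA] := omega_shift omega_ge0 omega_moderate r.
have A0 : 0 <= A * omega x by rewrite mulr_ge0// (le_trans _ A1).
exists (Num.bound (A * omega x)) => J NJ.
have S1 z : \sum_(j < J) slab j z = if omega z < J%:R then 1 else 0.
  elim: (J) => [|m IH]; first by rewrite big_ord0 ltNge omega_ge0.
  rewrite big_ord_recr/= IH /slab; have mm : m%:R <= m.+1%:R :> R by rewrite ler_nat.
  case: (ltP (omega z) m%:R) => h /=; last by rewrite add0r.
  by rewrite (lt_le_trans h mm) addr0.
have -> : \sum_(j < J) slab_smooth j x = conv rho0 (fun z => \sum_(j < J) slab j z) x.
  rewrite (conv_sum_r _ (test_bms trho)); last by move=> j; exact: slab_lbm.
  by apply: eq_bigr => j _; rewrite /slab_smooth (conv_comm (test_bms trho) (slab_lbm j)).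
rewrite /conv -irho; congr cintegral; apply/funext => y.
have [yr|ry] := leP `|y| r; last by rewrite zrho// mul0r.
rewrite S1 ifT ?mulr1//.
have := HA x (- y); rewrite normrN => /(_ yr) h; apply: le_lt_trans h _.
by apply: lt_le_trans (archi_boundP A0) _; rewrite ler_nat.
Qed.

Lemma slab_Kspace j : Kspace +oo%E omega (slab_smooth j).
Proof.
apply/Kspace_bounded; split; first exact: (slab_smoothP j).1.
move=> n s; have [M [q [M0 HM]]] := slab_weighted n s.
by exists (M * 2 ^+ (q * j)) => //; rewrite mulr_ge0// exprn_ge0.
Qed.

Lemma multiplier_slabs (h : E -> C) : OMspace p omega h ->
  exists (k : nat) (B : R), 0 <= B /\
    forall j, lp_le p (fun x => cabs (h x * slab_smooth j x)) (B * 2 ^+ (k * j)).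
Proof.
move=> [sh Hh]; have fin phi : Kspace +oo%E omega phi ->
    exists2 B, 0 <= B & lp_le p (fun x => cabs (h x * phi x)) B.
  move=> /Hh/(KspaceP omega_cont _ p_ge1)[_ /(_ 0%N [::])[B B0 HB]]; exists B => //.
  move: HB; congr lp_le; apply/funext => x.
  by rewrite -[LHS]/(cabs _ * expR (0 * omega x)) mul0r expR0 mulr1.
have ss j := (slab_smoothP j).1.
apply: gliding_hump => //.
- by move=> j; exact: ccontM (smooth_ccont sh) (smooth_ccont (ss j)).
- by move=> j; apply: fin; exact: slab_Kspace.
- move=> rho; have [c c0 Hc] := smooth_bounded rho sh.
  have [M M0 HM] := slab_bound [::].
  exists (c * M), 0%N; split; first exact: mulr_ge0.
  move=> j x xr; rewrite mul0n expr0 mulr1 cabsM.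
  by apply: ler_pM; rewrite ?cabs_ge0 ?Hc//; exact: HM.
move=> js es hj he.
have [|phi sphi Hphi] := rapid_series ss _ hj he.
  move=> s; have [M M0 HM] := slab_bound s; exists M, 0%N; split=> // j x.
  by rewrite mul0n expr0 mulr1.
have Kphi : Kspace +oo%E omega phi.
  apply/Kspace_bounded; split=> // n s; have [M [q [M0 HM]]] := slab_weighted n s.
  have [B B0 HB] := rapid_bound q M0 hj he; exists (2 * B); first exact: mulr_ge0.
  move=> x; apply: (rapid_limit_bound ss (wt_ge0 omega n%:R x) M0 (HM^~ x) HB).
  by have [B' B'0 HB'] := Hphi s `|x|; exists B' => // m; exact: HB'.
exists (fun x => h x * phi x); split.
- exact: ccontM (smooth_ccont sh) (smooth_ccont sphi).
- exact: fin.
move=> x e e0; have [B B0 HB] := Hphi [::] `|x|.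
have [N HN] := geo_small (cabs (h x) * B) e0.
exists N => n Nn; apply: le_trans (HN n Nn).
rewrite (_ : \sum_(k < n) _ = h x * rapid_sum slab_smooth js es n x); last first.
  by rewrite /rapid_sum mulr_sumr; apply: eq_bigr => k _; rewrite mulrCA.
rewrite -mulrBr cabsM -mulrA ler_wpM2l ?cabs_ge0// cabsBC.
exact: HB.
Qed.

(** Where [slab_smooth j] is nonzero, [j <= A omega x]. With [n >= A (k + 1)] the weight is there at
    most [e^(-(k + 1) j)], below [2^(-(k + 1) j)], which turns the growth [2^(kj)] of
    [multiplier_slabs] into a geometric series. *)
Lemma multiplier_weighted (h : E -> C) : OMspace p omega h ->
  exists n : nat, exists2 B, 0 <= B & lp_le p (fun x => cabs (h x) * wt (- n%:R) x) B.
Proof.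
move=> Oh; have [sh _] := Oh; have [k [B [B0 HB]]] := multiplier_slabs Oh.
have [A A1 HA] := slab_support; have A0 : 0 < A by exact: lt_le_trans A1.
have Ak : 0 <= A * k.+1%:R by rewrite mulr_ge0// ltW.
pose n := Num.bound (A * k.+1%:R); exists n.
exists (2 * (B + B * 2)); first by rewrite mulr_ge0// addr_ge0// mulr_ge0.
pose e J x := \sum_(j < J) h x * slab_smooth j x.
have ct j : ccont (fun x => h x * slab_smooth j x).
  exact: ccontM (smooth_ccont sh) (smooth_ccont (slab_smoothP j).1).
apply: (@lp_le_telescope R d omega omega_cont p p_ge1 e) => //.
- by move=> j; apply: ccont_sum => i.
- exact: smooth_ccont.
(* At each point the partial sums are exact from some index on, so adding up the finitely many
   rescaled errors gives an admissible constant. *)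
- move=> x; have [N HN] := slab_sum x.
  pose a J := cabs (e J x - h x) * 2 ^+ J.
  have a0 J : 0 <= a J by rewrite mulr_ge0 ?cabs_ge0// exprn_ge0.
  exists (\sum_(J < N) a J); first by apply: sumr_ge0.
  move=> J; have [NJ|JN] := leqP N J.
    rewrite /e -mulr_sumr HN// mulr1 subrr cabs0 mulr_ge0 ?exprn_ge0//.
    by apply: sumr_ge0.
  apply: le_trans (_ : a J * 2^-1 ^+ J <= _).
    by rewrite /a -mulrA -exprMn mulfV// expr1n mulr1.
  rewrite ler_wpM2r ?exprn_ge0//.
  by rewrite (bigD1 (Ordinal JN))//= lerDl sumr_ge0.
- have := lp_le_weak p_ge1 (_ : 0 <= 0 <= B) (lp_le_zero (d := d) p_ge1).
  rewrite lexx B0 => /(_ isT); congr lp_le; apply/funext => x.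
  by rewrite /e big_ord0 cabs0 mul0r.
move=> j; have mh := cmeas_cabs (ccont_cmeas (ct j)).
have e0 : 0 <= (2^-1 : R) ^+ (k.+1 * j) by rewrite exprn_ge0.
have b0 : 0 <= B * 2 ^+ (k * j) by rewrite mulr_ge0// exprn_ge0.
have := lp_le_scale p_ge1 mh (fun _ => cabs_ge0 _) e0 b0 (HB j).
have -> : 2^-1 ^+ (k.+1 * j) * (B * 2 ^+ (k * j)) = B * 2^-1 ^+ j.
  rewrite mulSn exprD.
  have h2 : (2^-1 : R) ^+ (k * j) * 2 ^+ (k * j) = 1 by rewrite -exprMn mulVf// expr1n.
  have Hr (x y z w : R) : y * w = 1 -> x * y * (z * w) = z * x.
    by move=> yw; rewrite -[RHS]mulr1 -yw; ring.
  exact: Hr.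
have E1 x : e j.+1 x - e j x = h x * slab_smooth j x.
  by rewrite /e big_ord_recr/= addrAC subrr add0r.
apply: (lp_le_mono p_ge1).
- apply: measurable_funM; last exact: wt_measurable.
  by under eq_fun do rewrite E1.
- by apply: measurable_funM; [exact: measurable_cst|].
move=> x; rewrite mulr_ge0 ?cabs_ge0 ?wt_ge0//= E1.
have [z|nz] := eqVneq (slab_smooth j x) 0; first by rewrite z mulr0 cabs0 mul0r mulr0.
have [_ hj] := HA j x [::] nz.
rewrite mulrC ler_wpM2r ?cabs_ge0//.
apply: le_trans (_ : expR (- (k.+1 * j)%:R) <= _).
  rewrite -[leLHS]/(expR (- n%:R * omega x)) ler_expR mulNr lerN2 natrM.
  apply: le_trans (_ : k.+1%:R * (A * omega x) <= _); first by rewrite ler_wpM2l.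
  by rewrite mulrA [k.+1%:R * A]mulrC ler_wpM2r// ltW// archi_boundP.
rewrite expRN exprVn lef_pV2 ?posrE ?expR_gt0 ?exprn_gt0//.
rewrite -[X in expR X]mulr1 expRM_natl lerXn2r ?nnegrE ?expR_ge0//.
by have := expR_ge1Dx (1 : R); rewrite -natr1.
Qed.

End localization.

End multipliers.

(** * The three equivalences *)

Theorem theorem1p1 (R : realType) (d : nat) (p : \bar R)
    (omega : 'rV[R]_d -> R) (chi : 'I_2 -> 'rV[R]_d -> R[i])
    (d_gt0 : (0 < d)%N) (p_ge1 : (1 <= p)%E)
    (omega_ge0 : forall x, 0 <= omega x) (omega_cont : continuous omega)
    (omega_nondecreasing : nondecreasing_radial omega)
    (omega_moderate : moderate omega)
    (chi_test : forall l, test (chi l)) (chi_MDFP : MDFP chi)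
    (f : ('rV[R]_d -> R[i]) -> R[i]) (f_distr : is_distribution f) :
  [/\ is_function_in (Kspace p omega) f <->
      (exists2 r : R, 0 < r & forall (n : nat) (a : 'I_d -> nat),
        (sup_norm p r (fun j l =>
           weight omega n%:R (mpartial a (dconv f (dilate j (chi l)))))
         < +oo)%E),
      OCspace p omega f <->
      (forall n : nat, exists2 r : R, 0 < r &
        (sup_norm p r (fun j l =>
           weight omega n%:R (dconv f (dilate j (chi l))))
         < +oo)%E) &
      is_function_in (OMspace p omega) f <->
      (exists2 r : R, 0 < r & forall a : 'I_d -> nat, exists n : nat,
        (sup_norm p r (fun j l =>
           weight omega (- n%:R) (mpartial a (dconv f (dilate j (chi l)))))
         < +oo)%E)].
Proof.
have sF := dconv_dilate_smooth chi_test f_distr.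
have m0 : mseq (fun _ : 'I_d => 0%N) = [::].
  by apply/eqP; rewrite -size_eq0 size_mseq /morder big1.
have le_bound (r : R) : 0 < r -> r <= (Num.bound r)%:R.
  by move=> r0; rewrite ltW// archi_boundP// ltW.
have OMD s g : OMspace p omega g -> OMspace p omega (foldr partial g s).
  by move=> Og; elim: s => //= i s; exact: OM_partial.
(* Any [L] would do: what is wanted is a test function of integral one, to smooth the slabs in
   (iii). *)
have [rr rr0 /(_ 0%N)[rho0 [psi0 [trho _ _ irho [_ _ _ zo]]]]] := MDFP_split chi_MDFP.
split; split.
- move=> [g /(KspaceP omega_cont _ p_ge1)[sg Hg] fg].
  have [rho Hrho] := conv_Dbound omega_cont p_ge1 chi_test sg fg.
  exists d%:R => [|n a]; first by rewrite ltr0n.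
  apply: Dbound_sup_norm => //.
  have [m wc] := wcomp_up omega_ge0 omega_moderate rho n.
  exact: (Hrho _ _ _ wc (Hg m _)).
- move=> [r r0 Hr].
  have HD (n : nat) s : Dbound omega p (fun j l => dconv f (dilate j (chi l)))
      (Num.bound r) n%:R s.
    by apply: Dbound_perm => //; exact: sup_norm_Dbound (le_bound _ r0) (Hr n _).
  have [|g sg [fg [rho [Bs HB]]]] := reconstruction omega_ge0 omega_cont omega_moderate
    p_ge1 chi_test chi_MDFP f_distr (k := Num.bound r).
    (* The bounds without weight serve as the decaying ones that the construction of [g] asks
       for. *)
    by move=> s; exists 0%N; rewrite oppr0; exact: (HD 0%N).
  exists g => //; apply/(KspaceP omega_cont _ p_ge1); split=> // n s.
  have [m wc] := wcomp_up omega_ge0 omega_moderate rho n.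
  exact: (HB s _ _ wc (fun b _ => HD m _)).
- move=> [_ HK] n.
  have /choice[P HP] : forall l, exists P : nat * R, 0 <= P.2 /\ forall j,
      lp_le p (wD omega n%:R [::] (dconv f (dilate j (chi l)))) (P.2 * 2 ^+ (P.1 * j)).
    move=> l; have [k [B [B0 HB]]] := OC_Dbound1 omega_ge0 omega_cont omega_moderate
      p_ge1 f_distr n (chi_test l) HK.
    by exists (k, B).
  have P0 l : 0 <= (P l).2 by case: (HP l).
  (* The sum dominates both exponents, and the successor makes [r] positive. *)
  pose k := (\sum_l (P l).1).+1%N; exists k%:R; first by rewrite ltr0n.
  have -> : (fun j l => weight omega n%:R (dconv f (dilate j (chi l)))) =
      (fun j l => weight omega n%:R (mpartial (fun=> 0%N) (dconv f (dilate j (chi l))))).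
    by apply/funext => j; apply/funext => l; rewrite mpartialE m0.
  apply: Dbound_sup_norm => //; rewrite m0.
  exists (\sum_l (P l).2) => [|j l]; first by apply: sumr_ge0.
  have [_ h] := HP l; apply: lp_le_weak p_ge1 _ (h j).
  rewrite mulr_ge0 ?exprn_ge0//=; apply: ler_pM; rewrite ?exprn_ge0//.
    by rewrite (bigD1 l)//= lerDl sumr_ge0.
  apply: ler_weXn2l; rewrite ?ler1n// leq_mul2r; apply/orP; right.
  by rewrite /k (bigD1 l)//= ltnW// ltnS leq_addr.
- move=> HS; split=> // phi tphi; apply/(KspaceP omega_cont _ p_ge1).
  have [sphi Dphi] := dconv_smooth f_distr tphi; split=> // n s.
  (* Derivatives of the convolution fall on the test function, so the bound without derivatives,
     applied to [D s phi], is enough. *)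
  have [n0|B B0 HB] := dconv_weighted_bound omega_ge0 omega_cont omega_moderate p_ge1
    chi_test chi_MDFP f_distr n _ (test_D s tphi).
    have [r r0 Hr] := HS n0; exists (Num.bound r); rewrite -m0.
    apply: sup_norm_Dbound (le_bound _ r0) _ => //.
    have <- : (fun j l => weight omega n0%:R (dconv f (dilate j (chi l)))) =
        (fun j l => weight omega n0%:R (mpartial (fun=> 0%N) (dconv f (dilate j (chi l))))).
      by apply/funext => j; apply/funext => l; rewrite mpartialE m0.
    exact: Hr.
  by exists B => //; rewrite /wD Dphi.
- move=> [g Og fg]; have [sg _] := Og.
  have [rho Hrho] := conv_Dbound omega_cont p_ge1 chi_test sg fg.
  (* As in (i), the exponent is [d] for every derivative. Only the weight exponent depends on [a],
     and it comes from applying [multiplier_weighted] to the derivative of [g]. *)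
  exists d%:R => [|a]; first by rewrite ltr0n.
  have [n Hn] := multiplier_weighted omega_ge0 omega_cont omega_moderate p_ge1
    (trho 0) irho rr0 (zo 0).1 (OMD (mseq a) _ Og).
  have [m wc] := wcomp_down omega_ge0 omega_moderate rho n.
  by exists m; apply: Dbound_sup_norm => //; exact: (Hrho _ _ _ wc Hn).
move=> [r r0 Hr].
have HD s : exists m : nat, Dbound omega p (fun j l => dconv f (dilate j (chi l)))
    (Num.bound r) (- m%:R) s.
  have [n hn] := Hr (fun i => count_mem i s); exists n.
  by apply: Dbound_perm => //; exact: sup_norm_Dbound (le_bound _ r0) hn.
have [g sg [fg [rho [Bs HB]]]] := reconstruction omega_ge0 omega_cont omega_moderate
  p_ge1 chi_test chi_MDFP f_distr HD.
exists g => //; apply: multiplier_of_bounds => // s.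
(* The weight exponent depends on the derivative, but only finitely many derivatives enter the bound
   for a given [s]. *)
have [m hm] := Dbound_uniform omega_ge0 omega_cont p_ge1 s Bs sF HD.
have [m' wc] := wcomp_down omega_ge0 omega_moderate rho m.
by exists m'; exact: HB wc hm.
Qed.
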